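(* Let $a,q$ be fixed integers with $0<a<q$ and $\gcd(a,q)=1$, and let $\beta\in[0,1)$. Let $c$ be a positive real number with $c<\sqrt{2(1-\beta)}$. Then for all sufficiently large $T$, \[ \max_{T^\beta\le t\le T}\left|\zeta\left(\tfrac12+\mathrm{i}t,\tfrac aq\right)\right|\ \ge\ \exp\left(c\sqrt{\frac{\log T\,\log_3 T}{\log_2 T}}\right). \]
   Context: For $0<\alpha\le 1$, $\zeta(s,\alpha)$ denotes the Hurwitz zeta function: $\zeta(s,\alpha)=\sum_{n=0}^\infty (n+\alpha)^{-s}$ for $\operatorname{Re}(s)>1$, continued meromorphically to $\mathbb{C}$ with a unique simple pole at $s=1$ of residue $1$. Iterated logarithms: $\log_2 x=\log\log x$ and $\log_3 x=\log\log\log x$. ''Sufficiently large'' may depend on $a,q,\beta,c$. *)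

(* Defs.v *)
From Stdlib Require Import Reals.
From Coquelicot Require Import Coquelicot.

(* x^s = exp (s * ln x) for real x > 0 and complex s, with real logarithm;
   junk for x <= 0. *)
Definition Rcpow (x : R) (s : C) : C :=
  (Rpower x (Re s) * cos (Im s * ln x), Rpower x (Re s) * sin (Im s * ln x))%R.

(* [is_hurwitz_zeta alpha zeta]: [zeta] is the Hurwitz zeta function
   s |-> zeta(s, alpha), i.e. the Dirichlet series on Re s > 1, continued
   holomorphically to C \ {1}.  The limit makes the singularity at 1 a simple
   pole of residue 1.  By the identity theorem these conditions determine
   [zeta] on C \ {1}; the value [zeta 1] is unconstrained. *)
Definition is_hurwitz_zeta (alpha : R) (zeta : C -> C) : Prop :=
  (forall s : C, (1 < Re s)%R ->
     is_series (fun n : nat => Rcpow (INR n + alpha) (- s)%C) (zeta s)) /\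
  (forall s : C, s <> RtoC 1 -> ex_derive zeta s) /\
  filterlim (fun s : C => ((s - 1) * zeta s)%C)
    (locally' (RtoC 1)) (locally (RtoC 1)).

Definition is_max_on (f : R -> R) (a b M : R) : Prop :=
  (exists t : R, (a <= t <= b)%R /\ f t = M) /\
  (forall t : R, (a <= t <= b)%R -> (f t <= M)%R).

Definition log2 (x : R) : R := ln (ln x).
Definition log3 (x : R) : R := ln (ln (ln x)).

(* Main.v *)
Require Import Defs.
From Stdlib Require Import Reals ZArith Lra Lia Classical.
From Coquelicot Require Import Coquelicot.

(** The proof is the resonance method, run with finite sums only.

    Suppose that [|zeta(1/2 + it, alpha)| <= X] on the whole range, where
    [alpha = a/q].  Averaging [zeta] over the shifts [t + th] and [t - th], and
    repeating this [Q] times, multiplies the term [(n + alpha)^(-1/2 - it)] by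
    [cos (th * ln (n + alpha)) ^ Q].  These weights are nonnegative, they are
    close to 1 for the [n] that matter, and they decay so fast that the sum of
    all coefficients is at most [T^(2 eps)].  What results is a Dirichlet
    polynomial [D(t)] with nonnegative coefficients and [|D| <= X + 2] away from
    the ends of the range ([smoothed_bound]).  This needs [zeta] only through
    its truncated Dirichlet series with the pole term removed ([zeta_approx]).
    The definition of [zeta] gives the convergence of that approximation only
    for [Re s > 1]; it is pushed to the left in steps of 1/32 by bounding a
    holomorphic function at the centre of a circle ([circle_bound], which rests
    on [goursat]).

    The resonator is [R(t) = sum f(e) m(e)^(-it)] over exponent vectors [e] in
    [{0,1,2}^P], with [m(e)] the product of the [p^(e p)] over a set [P] of
    primes slightly above [G], of order [log T log_2 T / log_3 T].  Exponent 1
    carries weight 1 and the exponents 0 and 2 carry a small weight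
    [g p = sqrt G / (sqrt p * ln (p / G))].  From the centre [e p = 1] one can
    move both up and down, so a prime contributes four cross terms
    [g p / sqrt p] at an entropy cost of two; the squarefree choice [{0,1}]
    has two cross terms for a cost of one, and loses a factor [sqrt 2] in the
    final constant.

    [resonance] compares a mean value of [|D R|^2] over differences of integers
    below [V], about [T/2], from both sides.  From above it is the bound for [D]
    times the mean square of [R], plus a trivial bound for differences below
    [V0], about [T^b], where nothing is known of [D]; there the cardinality of
    the support of [R] must stay below [T^(1-b)].  From below, the Fejer kernel
    is nonnegative and the coefficients are nonnegative, so only the exact
    coincidences [(n + alpha) m = (n' + alpha) m'] need be kept.  Frequencies
    [ln m(e)] are rounded to bins modulo [2 pi], which is harmless because the
    kernel is sampled at integers.

    Coincidences come from pairs [(e, e')] with [m(e)] and [m(e')] in one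
    residue class modulo [q]: multiplying the reduced fraction [m(e')/m(e)] by
    some [j < q] puts numerator and denominator in the class of [a].  The sum
    over such pairs is at least [1/q] of the sum over all pairs, because the
    kernel [1 / sqrt (numerator * denominator)] is positive semidefinite
    ([class_sum]).  The full sum is an Euler product, and Rankin's trick removes
    the pairs whose vectors are heavy or whose reduced fraction is large
    ([gcd_sum_lower]).

    Mertens' estimate, applied on blocks [G e^(iH) < p <= G e^((i+1)H)], gives
    [sum 1 / (p ln (p/G)) ~ log_3 T / log_2 T] over [P] ([prime_family]).  With
    [G = g0 log T log_2 T / log_3 T] the support of [R] has size about
    [T^(2 g0)], so any [2 g0 < 1 - b] is allowed, and the gain is
    [X^2 >= exp (4 sqrt g0 sqrt (log T log_3 T / log_2 T))] up to lower order
    terms.  Hence every [c < 2 sqrt g0], that is every [c < sqrt (2 (1 - b))],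
    is reached ([large_value]). *)

Local Open Scope R_scope.
Local Open Scope C_scope.

(** * Complex differentiability *)

Definition ccont (f : C -> C) (z : C) : Prop :=
  forall eps : R, (0 < eps)%R -> exists d : R, (0 < d)%R /\
    forall w, (Cmod (w - z) < d)%R -> (Cmod (f w - f z) < eps)%R.

(** Caratheodory's form of differentiability: it makes products, compositions
    and the Goursat remainder purely algebraic. *)
Definition cdiff (f : C -> C) (z : C) : Prop :=
  exists phi : C -> C, ccont phi z /\ forall w, f w - f z = phi w * (w - z).

Lemma ccont_const a z : ccont (fun _ => a) z.
Proof.
intros eps He; exists 1%R; split; [lra|]; intros w _.
replace (a - a) with (RtoC 0) by ring. now rewrite Cmod_0.
Qed.

Lemma ccont_id z : ccont (fun w => w) z.
Proof. intros eps He; exists eps; auto. Qed.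

Lemma ccont_plus f g z : ccont f z -> ccont g z -> ccont (fun w => f w + g w) z.
Proof.
intros Hf Hg eps He.
destruct (Hf (eps / 2)%R) as [d [Hd H]]; [lra|].
destruct (Hg (eps / 2)%R) as [d' [Hd' H']]; [lra|].
exists (Rmin d d'); split; [now apply Rmin_glb_lt|]; intros w Hw.
assert (A := H w (Rlt_le_trans _ _ _ Hw (Rmin_l _ _))).
assert (B := H' w (Rlt_le_trans _ _ _ Hw (Rmin_r _ _))).
replace (f w + g w - (f z + g z)) with ((f w - f z) + (g w - g z)) by ring.
eapply Rle_lt_trans; [apply Cmod_triangle|lra].
Qed.

Lemma ccont_bound f z : ccont f z ->
  exists d M : R, (0 < d)%R /\ (0 < M)%R /\ forall w, (Cmod (w - z) < d)%R -> (Cmod (f w) <= M)%R.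
Proof.
intros Hf; destruct (Hf 1%R) as [d [Hd H]]; [lra|].
exists d, (Cmod (f z) + 1)%R; assert (P := Cmod_ge_0 (f z)).
split; [assumption|split; [lra|]]; intros w Hw.
replace (f w) with (f z + (f w - f z)) by ring.
eapply Rle_trans; [apply Cmod_triangle|]. specialize (H w Hw); lra.
Qed.

Lemma ccont_mult f g z : ccont f z -> ccont g z -> ccont (fun w => f w * g w) z.
Proof.
intros Hf Hg eps He.
destruct (ccont_bound g z Hg) as [d0 [M [Hd0 [HM B]]]].
assert (P := Cmod_ge_0 (f z)).
destruct (Hf (eps / (2 * M))%R) as [d [Hd H]]; [apply Rdiv_lt_0_compat; lra|].
destruct (Hg (eps / (2 * (Cmod (f z) + 1)))%R) as [d' [Hd' H']]; [apply Rdiv_lt_0_compat; lra|].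
exists (Rmin d0 (Rmin d d')); split; [repeat apply Rmin_glb_lt; assumption|]; intros w Hw.
assert (W0 := Rlt_le_trans _ _ _ Hw (Rmin_l _ _)).
assert (W := Rlt_le_trans _ _ _ Hw (Rmin_r _ _)).
assert (A1 := H w (Rlt_le_trans _ _ _ W (Rmin_l _ _))).
assert (A2 := H' w (Rlt_le_trans _ _ _ W (Rmin_r _ _))).
specialize (B w W0).
replace (f w * g w - f z * g z) with ((f w - f z) * g w + f z * (g w - g z)) by ring.
eapply Rle_lt_trans; [apply Cmod_triangle|]. rewrite 2!Cmod_mult.
assert (Cmod (f w - f z) * Cmod (g w) <= eps / (2 * M) * M)%R.
{ apply Rmult_le_compat; try apply Cmod_ge_0; lra. }
assert (Cmod (f z) * Cmod (g w - g z) <= Cmod (f z) * (eps / (2 * (Cmod (f z) + 1))))%R.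
{ apply Rmult_le_compat_l; lra. }
assert (Cmod (f z) * (eps / (2 * (Cmod (f z) + 1))) < eps / 2)%R.
{ replace (Cmod (f z) * (eps / (2 * (Cmod (f z) + 1))))%R
    with (eps / 2 - eps / (2 * (Cmod (f z) + 1)))%R by (field; lra).
  assert (0 < eps / (2 * (Cmod (f z) + 1)))%R by (apply Rdiv_lt_0_compat; lra). lra. }
replace (eps / (2 * M) * M)%R with (eps / 2)%R in * by (field; lra). lra.
Qed.

Lemma ccont_comp f g z : ccont g z -> ccont f (g z) -> ccont (fun w => f (g w)) z.
Proof.
intros Hg Hf eps He. destruct (Hf eps He) as [d [Hd H]].
destruct (Hg d Hd) as [d' [Hd' H']]. exists d'; split; auto.
Qed.

Lemma ccont_inv (z : C) : z <> 0 -> ccont (fun w => / w) z.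
Proof.
intros Hz eps He. assert (P : (0 < Cmod z)%R) by (apply -> Cmod_gt_0; assumption).
set (m := Cmod z) in *.
exists (Rmin (m / 2) (eps * m * m / 2)); split.
{ apply Rmin_glb_lt; [lra|]. assert (0 < eps * m * m)%R by (repeat apply Rmult_lt_0_compat; lra). lra. }
intros w Hw.
assert (W1 := Rlt_le_trans _ _ _ Hw (Rmin_l _ _)).
assert (W2 := Rlt_le_trans _ _ _ Hw (Rmin_r _ _)).
assert (Hm : (m / 2 < Cmod w)%R).
{ assert (m <= Cmod w + Cmod (w - z))%R; [|lra].
  unfold m. replace z with (w - (w - z)) at 1 by ring.
  eapply Rle_trans; [apply Cmod_triangle|]. rewrite Cmod_opp; lra. }
assert (Hw0 : w <> 0). { intros E; rewrite E, Cmod_0 in Hm; lra. }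
replace (/ w - / z) with (- ((w - z) * / w * / z)) by (field; auto).
rewrite Cmod_opp, 2!Cmod_mult, 2!Cmod_inv; auto. fold m.
assert (/ Cmod w < 2 / m)%R.
{ replace (2 / m)%R with (/ (m / 2))%R by (field; lra). apply Rinv_lt_contravar; [nra|lra]. }
assert (0 < / Cmod w)%R by (apply Rinv_0_lt_compat; lra).
assert (0 < / m)%R by (apply Rinv_0_lt_compat; lra).
assert (Cmod (w - z) * / Cmod w <= (Cmod (w - z)) * (2 / m))%R.
{ apply Rmult_le_compat_l; [apply Cmod_ge_0|lra]. }
apply Rle_lt_trans with (Cmod (w - z) * (2 / m) * / m)%R; [apply Rmult_le_compat_r; lra|].
apply Rlt_le_trans with (eps * m * m / 2 * (2 / m) * / m)%R.
{ apply Rmult_lt_compat_r; auto. apply Rmult_lt_compat_r; auto. apply Rdiv_lt_0_compat; lra. }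
right; field; lra.
Qed.

Lemma cdiff_ccont f z : cdiff f z -> ccont f z.
Proof.
intros [phi [Hc E]].
assert (H : ccont (fun w => f z + phi w * (w + - z)) z).
{ apply ccont_plus; [apply ccont_const|]. apply ccont_mult; auto.
  apply ccont_plus; [apply ccont_id|apply ccont_const]. }
intros eps He; destruct (H eps He) as [d [Hd D]]; exists d; split; auto.
intros w Hw; specialize (D w Hw). rewrite E.
replace (phi w * (w - z)) with (f z + phi w * (w + - z) - (f z + phi z * (z + - z))) by ring. auto.
Qed.

Lemma cdiff_ext f g z : (forall w, f w = g w) -> cdiff f z -> cdiff g z.
Proof.
intros E [phi [Hc H]]; exists phi; split; auto. intros w; rewrite <- 2!E; auto.
Qed.

Lemma cdiff_const a z : cdiff (fun _ => a) z.
Proof. exists (fun _ => 0); split; [apply ccont_const|intros; ring]. Qed.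

Lemma cdiff_id z : cdiff (fun w => w) z.
Proof. exists (fun _ => 1); split; [apply ccont_const|intros; ring]. Qed.

Lemma cdiff_plus f g z : cdiff f z -> cdiff g z -> cdiff (fun w => f w + g w) z.
Proof.
intros [p [Hp E]] [p' [Hp' E']]; exists (fun w => p w + p' w); split; [now apply ccont_plus|].
intros w. replace (f w + g w - (f z + g z)) with ((f w - f z) + (g w - g z)) by ring.
rewrite E, E'; ring.
Qed.

Lemma cdiff_mult f g z : cdiff f z -> cdiff g z -> cdiff (fun w => f w * g w) z.
Proof.
intros Hf Hg; assert (Cg := cdiff_ccont _ _ Hg).
destruct Hf as [p [Hp E]], Hg as [p' [Hp' E']].
exists (fun w => p w * g w + f z * p' w); split.
- apply ccont_plus; apply ccont_mult; auto. apply ccont_const.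
- intros w. replace (f w * g w - f z * g z) with ((f w - f z) * g w + f z * (g w - g z)) by ring.
  rewrite E, E'; ring.
Qed.

Lemma cdiff_opp f z : cdiff f z -> cdiff (fun w => - f w) z.
Proof.
intros H. apply cdiff_ext with (fun w => (- (1)) * f w); [intros; ring|].
apply cdiff_mult; auto. apply cdiff_const.
Qed.

Lemma cdiff_minus f g z : cdiff f z -> cdiff g z -> cdiff (fun w => f w - g w) z.
Proof. intros; apply cdiff_plus; auto. now apply cdiff_opp. Qed.

Lemma cdiff_comp f g z : cdiff g z -> cdiff f (g z) -> cdiff (fun w => f (g w)) z.
Proof.
intros Hg Hf; assert (Cg := cdiff_ccont _ _ Hg).
destruct Hg as [p [Hp E]], Hf as [p' [Hp' E']].
exists (fun w => p' (g w) * p w); split.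
- apply ccont_mult; auto. now apply ccont_comp.
- intros w; rewrite E', E; ring.
Qed.

Lemma cdiff_inv (z : C) : z <> 0 -> cdiff (fun w => / w) z.
Proof.
intros Hz.
exists (fun w => if Ceq_dec w 0 then (/ w - / z) * / (w - z) else - (/ w * / z)); split.
- assert (H : ccont (fun w => - (1) * (/ w * / z)) z).
  { apply ccont_mult; [apply ccont_const|]. apply ccont_mult; [now apply ccont_inv|apply ccont_const]. }
  assert (P : (0 < Cmod z)%R) by (apply -> Cmod_gt_0; assumption).
  intros eps He; destruct (H eps He) as [d [Hd D]].
  exists (Rmin d (Cmod z)); split; [now apply Rmin_glb_lt|]; intros w Hw.
  assert (W1 := Rlt_le_trans _ _ _ Hw (Rmin_l _ _)).
  assert (W2 := Rlt_le_trans _ _ _ Hw (Rmin_r _ _)).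
  destruct (Ceq_dec w 0) as [e|n].
  { rewrite e in W2. replace (0 - z) with (- z) in W2 by ring. rewrite Cmod_opp in W2; lra. }
  destruct (Ceq_dec z 0) as [e|n']; [contradiction|].
  specialize (D w W1).
  replace (- (/ w * / z) - - (/ z * / z)) with (- (1) * (/ w * / z) - - (1) * (/ z * / z)) by ring. exact D.
- intros w; destruct (Ceq_dec w 0) as [e|n].
  + assert (w - z <> 0). { rewrite e; intros F; apply Hz. replace z with (- (0 - z)) by ring. rewrite F; ring. }
    rewrite <- Cmult_assoc, (Cinv_l (w - z)) by assumption. ring.
  + field; auto.
Qed.

Lemma cdiff_ex_derive (f : C -> C) z : ex_derive f z -> cdiff f z.
Proof.
intros [l [_ H]].
specialize (H z (fun P HP => HP)).
exists (fun w => if Ceq_dec w z then l else (f w - f z) / (w - z)); split.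
- intros eps He.
  assert (He2 : (0 < eps / 2)%R) by lra.
  destruct (H (mkposreal _ He2)) as [d Hd].
  exists d; split; [apply cond_pos|]; intros w Hw.
  destruct (Ceq_dec z z) as [_|]; [|congruence].
  destruct (Ceq_dec w z) as [e|n].
  + replace (l - l) with (RtoC 0) by ring; rewrite Cmod_0; auto.
  + assert (n' : w - z <> 0). { intros F; apply n. replace w with (w - z + z) by ring. rewrite F; ring. }
    specialize (Hd w Hw). simpl in Hd.
    change (Cmod (f w - f z - (w - z) * l) <= eps / 2 * Cmod (w - z))%R in Hd.
    replace ((f w - f z) / (w - z) - l) with ((f w - f z - (w - z) * l) * / (w - z)) by (field; auto).
    rewrite Cmod_mult, Cmod_inv; auto.
    assert (0 < Cmod (w - z))%R by (apply -> Cmod_gt_0; assumption).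
    apply Rle_lt_trans with (eps / 2 * Cmod (w - z) * / Cmod (w - z))%R.
    * apply Rmult_le_compat_r; [|exact Hd]. left; now apply Rinv_0_lt_compat.
    * replace (eps / 2 * Cmod (w - z) * / Cmod (w - z))%R with (eps / 2)%R by (field; lra). lra.
- intros w; destruct (Ceq_dec w z) as [e|n].
  + rewrite e; ring.
  + assert (n' : w - z <> 0). { intros F; apply n. replace w with (w - z + z) by ring. rewrite F; ring. }
    field; auto.
Qed.

(** * Goursat's theorem on rectangles *)

Lemma Cmod_le_abs (z : C) : (Cmod z <= Rabs (fst z) + Rabs (snd z))%R.
Proof.
unfold Cmod. apply Rsqr_incr_0_var.
- rewrite Rsqr_sqrt; [|nra]. unfold Rsqr.
  assert (A := Rabs_pos (fst z)). assert (B := Rabs_pos (snd z)).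
  rewrite <- (pow2_abs (fst z)), <- (pow2_abs (snd z)). nra.
- assert (A := Rabs_pos (fst z)). assert (B := Rabs_pos (snd z)). lra.
Qed.

Lemma fst_le_Cmod (z : C) : (Rabs (fst z) <= Cmod z)%R.
Proof. eapply Rle_trans; [apply Rmax_l|apply Rmax_Cmod]. Qed.

Lemma snd_le_Cmod (z : C) : (Rabs (snd z) <= Cmod z)%R.
Proof. eapply Rle_trans; [apply Rmax_r|apply Rmax_Cmod]. Qed.

Definition Cint (f : R -> C) (a b : R) : C :=
  (RInt (fun x => fst (f x)) a b, RInt (fun x => snd (f x)) a b).

Definition pathcont (f : R -> C) (a b : R) : Prop :=
  forall x, (a <= x <= b)%R ->
    continuous (fun x => fst (f x)) x /\ continuous (fun x => snd (f x)) x.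

Lemma pathcont_ex f a b : (a <= b)%R -> pathcont f a b ->
  ex_RInt (fun x => fst (f x)) a b /\ ex_RInt (fun x => snd (f x)) a b.
Proof.
intros ab H; split; apply (ex_RInt_continuous (V := R_CompleteNormedModule)); intros z;
  rewrite Rmin_left, Rmax_right; auto; apply H.
Qed.

Lemma pathcont_sub f a b a' b' : (a <= a')%R -> (b' <= b)%R -> pathcont f a b -> pathcont f a' b'.
Proof. intros A B H x Hx; apply H; lra. Qed.

Lemma Cint_ext f g a b : (a <= b)%R -> (forall x, (a <= x <= b)%R -> f x = g x) -> Cint f a b = Cint g a b.
Proof.
intros ab E; unfold Cint; f_equal; apply RInt_ext; intros x;
rewrite Rmin_left, Rmax_right; auto; intros Hx; rewrite E; auto; lra.
Qed.

Lemma Cint_Chasles f a b c : (a <= b)%R -> (b <= c)%R -> pathcont f a c ->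
  Cint f a c = Cint f a b + Cint f b c.
Proof.
intros ab bc H.
destruct (pathcont_ex f a b ab (pathcont_sub _ _ _ _ _ (Rle_refl _) bc H)) as [A B].
destruct (pathcont_ex f b c bc (pathcont_sub _ _ _ _ _ ab (Rle_refl _) H)) as [A' B'].
unfold Cint, Cplus; simpl; f_equal; symmetry; now apply (RInt_Chasles (V := R_CompleteNormedModule)).
Qed.

Lemma Cint_plus f g a b : (a <= b)%R -> pathcont f a b -> pathcont g a b ->
  Cint (fun x => f x + g x) a b = Cint f a b + Cint g a b.
Proof.
intros ab Hf Hg. destruct (pathcont_ex f a b ab Hf), (pathcont_ex g a b ab Hg).
unfold Cint, Cplus; simpl; f_equal; now apply (RInt_plus (V := R_CompleteNormedModule)).
Qed.

Lemma RInt_abs_le f a b M : (a <= b)%R -> ex_RInt f a b ->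
  (forall x, (a <= x <= b)%R -> (Rabs (f x) <= M)%R) -> (Rabs (RInt f a b) <= M * (b - a))%R.
Proof.
intros ab E H.
destruct (Rle_lt_or_eq_dec _ _ ab) as [lt|e].
- replace (M * (b - a))%R with ((b - a) * M)%R by ring.
  apply (norm_RInt_le_const (V := R_NormedModule) f a b (RInt f a b) M ab).
  + intros x Hx; apply H; lra.
  + now apply (RInt_correct (V := R_CompleteNormedModule)).
- subst b. rewrite RInt_point. unfold zero; simpl. rewrite Rabs_R0; lra.
Qed.

Lemma Cint_bound f a b M : (a <= b)%R -> pathcont f a b ->
  (forall x, (a <= x <= b)%R -> (Cmod (f x) <= M)%R) -> (Cmod (Cint f a b) <= 2 * M * (b - a))%R.
Proof.
intros ab H B. destruct (pathcont_ex f a b ab H) as [E1 E2].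
eapply Rle_trans; [apply Cmod_le_abs|]; simpl.
assert (Rabs (RInt (fun x => fst (f x)) a b) <= M * (b - a))%R.
{ apply RInt_abs_le; auto. intros x Hx; eapply Rle_trans; [apply fst_le_Cmod|auto]. }
assert (Rabs (RInt (fun x => snd (f x)) a b) <= M * (b - a))%R.
{ apply RInt_abs_le; auto. intros x Hx; eapply Rle_trans; [apply snd_le_Cmod|auto]. }
lra.
Qed.

Lemma RInt_affine p q a b : RInt (fun x => p + q * x)%R a b = (p * (b - a) + q * (b ^ 2 - a ^ 2) / 2)%R.
Proof.
apply is_RInt_unique.
replace (p * (b - a) + q * (b ^ 2 - a ^ 2) / 2)%R
  with (minus (p * b + q * b ^ 2 / 2)%R (p * a + q * a ^ 2 / 2)%R)
  by (unfold minus, plus, opp; simpl; field).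
apply (is_RInt_derive (fun x => (p * x + q * x ^ 2 / 2)%R)).
- intros x _; auto_derive; auto; field.
- intros x _. apply (ex_derive_continuous (K := R_AbsRing) (V := R_NormedModule)). auto_derive; auto.
Qed.

Lemma continuous_of_ccont (g : C -> C) (p : R -> C) (x : R) :
  (forall u, (Cmod (p u - p x) <= Rabs (u - x))%R) -> ccont g (p x) ->
  continuous (fun u => fst (g (p u))) x /\ continuous (fun u => snd (g (p u))) x.
Proof.
intros Hp Hg; split; apply (proj2 (filterlim_locally _ _)); intros eps;
  destruct (Hg eps (cond_pos eps)) as [d [Hd D]]; exists (mkposreal d Hd); intros u Hu;
  specialize (D (p u) (Rle_lt_trans _ _ _ (Hp u) Hu));
  (eapply Rle_lt_trans; [|exact D]).
- apply (fst_le_Cmod (g (p u) - g (p x))).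
- apply (snd_le_Cmod (g (p u) - g (p x))).
Qed.

Lemma pathcont_hor g y a b : (forall x, (a <= x <= b)%R -> ccont g (x, y)) -> pathcont (fun x => g (x, y)) a b.
Proof.
intros H x Hx. apply (continuous_of_ccont g (fun x => (x, y)) x); auto.
intros u. eapply Rle_trans; [apply Cmod_le_abs|]; simpl.
replace (y + - y)%R with 0%R by ring. rewrite Rabs_R0, Rplus_0_r. apply Rle_refl.
Qed.

Lemma pathcont_ver g x a b : (forall y, (a <= y <= b)%R -> ccont g (x, y)) -> pathcont (fun y => g (x, y)) a b.
Proof.
intros H y Hy. apply (continuous_of_ccont g (fun y => (x, y)) y); auto.
intros u. eapply Rle_trans; [apply Cmod_le_abs|]; simpl.
replace (x + - x)%R with 0%R by ring. rewrite Rabs_R0, Rplus_0_l. apply Rle_refl.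
Qed.

(** The integral of [f] along the boundary of [[a,b] x [c,d]], counterclockwise. *)
Definition rectint (f : C -> C) (a b c d : R) : C :=
  Cint (fun x => f (x, c)) a b - Cint (fun x => f (x, d)) a b
  + Ci * (Cint (fun y => f (b, y)) c d - Cint (fun y => f (a, y)) c d).

Definition contrect f a b c d := forall x y, (a <= x <= b)%R -> (c <= y <= d)%R -> ccont f (x, y).

Lemma rectint_bound f a b c d M : (a <= b)%R -> (c <= d)%R -> contrect f a b c d ->
  (forall x y, (a <= x <= b)%R -> (c <= y <= d)%R -> (Cmod (f (x, y)) <= M)%R) ->
  (Cmod (rectint f a b c d) <= 4 * M * ((b - a) + (d - c)))%R.
Proof.
intros ab cd H B.
assert (H1 : (Cmod (Cint (fun x => f (x, c)) a b) <= 2 * M * (b - a))%R).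
{ apply Cint_bound; auto. apply pathcont_hor; intros; apply H; lra. intros; apply B; lra. }
assert (H2 : (Cmod (Cint (fun x => f (x, d)) a b) <= 2 * M * (b - a))%R).
{ apply Cint_bound; auto. apply pathcont_hor; intros; apply H; lra. intros; apply B; lra. }
assert (H3 : (Cmod (Cint (fun y => f (b, y)) c d) <= 2 * M * (d - c))%R).
{ apply Cint_bound; auto. apply pathcont_ver; intros; apply H; lra. intros; apply B; lra. }
assert (H4 : (Cmod (Cint (fun y => f (a, y)) c d) <= 2 * M * (d - c))%R).
{ apply Cint_bound; auto. apply pathcont_ver; intros; apply H; lra. intros; apply B; lra. }
unfold rectint. eapply Rle_trans; [apply Cmod_triangle|]. rewrite Cmod_mult, Cmod_Ci.
unfold Cminus.
assert (T1 := Cmod_triangle (Cint (fun x => f (x, c)) a b) (- Cint (fun x => f (x, d)) a b)).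
assert (T2 := Cmod_triangle (Cint (fun y => f (b, y)) c d) (- Cint (fun y => f (a, y)) c d)).
rewrite Cmod_opp in T1, T2. lra.
Qed.

Lemma rectint_ext f g a b c d : (a <= b)%R -> (c <= d)%R -> (forall z, f z = g z) ->
  rectint f a b c d = rectint g a b c d.
Proof.
intros ab cd E; unfold rectint.
rewrite (Cint_ext (fun x => f (x, c)) (fun x => g (x, c)) a b), (Cint_ext (fun x => f (x, d)) (fun x => g (x, d)) a b),
 (Cint_ext (fun y => f (b, y)) (fun y => g (b, y)) c d), (Cint_ext (fun y => f (a, y)) (fun y => g (a, y)) c d); auto.
Qed.

Lemma rectint_plus f g a b c d : (a <= b)%R -> (c <= d)%R -> contrect f a b c d -> contrect g a b c d ->
  rectint (fun z => f z + g z) a b c d = rectint f a b c d + rectint g a b c d.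
Proof.
intros ab cd Hf Hg; unfold rectint.
rewrite 4!Cint_plus; auto; try (apply pathcont_hor; intros; auto; (apply Hf || apply Hg); lra);
  try (apply pathcont_ver; intros; auto; (apply Hf || apply Hg); lra).
ring.
Qed.

Lemma RInt_affine_ext f p q a b : (forall x, f x = p + q * x)%R ->
  RInt f a b = (p * (b - a) + q * (b ^ 2 - a ^ 2) / 2)%R.
Proof. intros E; rewrite <- RInt_affine; apply RInt_ext; auto. Qed.

Lemma rectint_affine A B a b c d : rectint (fun z => A + B * z) a b c d = 0.
Proof.
destruct A as [A1 A2], B as [B1 B2].
unfold rectint, Cint; simpl.
rewrite (RInt_affine_ext _ (A1 - B2 * c) B1 a b) by (intros; ring).
rewrite (RInt_affine_ext _ (A2 + B1 * c) B2 a b) by (intros; ring).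
rewrite (RInt_affine_ext _ (A1 - B2 * d) B1 a b) by (intros; ring).
rewrite (RInt_affine_ext _ (A2 + B1 * d) B2 a b) by (intros; ring).
rewrite (RInt_affine_ext _ (A1 + B1 * b) (- B2) c d) by (intros; ring).
rewrite (RInt_affine_ext _ (A2 + B2 * b) B1 c d) by (intros; ring).
rewrite (RInt_affine_ext _ (A1 + B1 * a) (- B2) c d) by (intros; ring).
rewrite (RInt_affine_ext _ (A2 + B2 * a) B1 c d) by (intros; ring).
unfold Cminus, Cplus, Copp, Cmult, Ci, RtoC; simpl. f_equal; field.
Qed.

Lemma rectint_split f a m b c n d : (a <= m <= b)%R -> (c <= n <= d)%R -> contrect f a b c d ->
  rectint f a b c d = rectint f a m c n + rectint f m b c n + rectint f a m n d + rectint f m b n d.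
Proof.
intros [am mb] [cn nd] H; unfold rectint.
rewrite (Cint_Chasles (fun x => f (x, c)) a m b); auto;
  [|apply pathcont_hor; intros; apply H; lra].
rewrite (Cint_Chasles (fun x => f (x, d)) a m b); auto;
  [|apply pathcont_hor; intros; apply H; lra].
rewrite (Cint_Chasles (fun y => f (b, y)) c n d); auto;
  [|apply pathcont_ver; intros; apply H; lra].
rewrite (Cint_Chasles (fun y => f (a, y)) c n d); auto;
  [|apply pathcont_ver; intros; apply H; lra].
ring.
Qed.

Section Goursat.
Variables (f : C -> C) (a b c d : R).
Hypotheses (ab : (a <= b)%R) (cd : (c <= d)%R).
Hypothesis Hf : forall x y, (a <= x <= b)%R -> (c <= y <= d)%R -> cdiff f (x, y).

Let w n := ((b - a) / 2 ^ n)%R.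
Let h n := ((d - c) / 2 ^ n)%R.
Let piece n (p : R * R) := rectint f (fst p) (fst p + w n) (snd p) (snd p + h n).

(* bisection: keep a quarter that carries at least a quarter of the integral *)
Let step n (p : R * R) : R * R :=
  let big p' := Rle_dec (Cmod (piece n p)) (4 * Cmod (piece (S n) p')) in
  let p1 := (fst p, snd p) in let p2 := (fst p + w (S n), snd p)%R in
  let p3 := (fst p, snd p + h (S n))%R in let p4 := (fst p + w (S n), snd p + h (S n))%R in
  if big p1 then p1 else if big p2 then p2 else if big p3 then p3 else p4.

Fixpoint corner n : R * R := match n with O => (a, c) | S n => step n (corner n) end.

Lemma corner_half n : w n = (2 * w (S n))%R /\ h n = (2 * h (S n))%R /\ (0 <= w n)%R /\ (0 <= h n)%R.
Proof.
unfold w, h. assert (0 < 2 ^ n)%R by (apply pow_lt; lra). simpl.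
repeat split; try (field; lra); apply Rdiv_le_0_compat; lra.
Qed.

Lemma corner_step n :
  (fst (corner n) <= fst (corner (S n)) /\ fst (corner (S n)) + w (S n) <= fst (corner n) + w n /\
   snd (corner n) <= snd (corner (S n)) /\ snd (corner (S n)) + h (S n) <= snd (corner n) + h n)%R.
Proof.
destruct (corner_half n) as [E [F [P Q]]].
destruct (corner_half (S n)) as [_ [_ [P' Q']]].
simpl corner; unfold step.
repeat (destruct (Rle_dec _ _)); cbn [fst snd]; lra.
Qed.

Lemma corner_range n : (a <= fst (corner n) /\ fst (corner n) + w n <= b /\
  c <= snd (corner n) /\ snd (corner n) + h n <= d)%R.
Proof.
induction n as [|n IH].
- simpl; unfold w, h; simpl; lra.
- assert (S := corner_step n); lra.
Qed.

Lemma corner_big n : (Cmod (piece n (corner n)) <= 4 * Cmod (piece (S n) (corner (S n))))%R.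
Proof.
destruct (corner_half n) as [E [F [P Q]]].
destruct (corner_half (S n)) as [_ [_ [P' Q']]].
destruct (corner_range n) as [R1 [R2 [R3 R4]]].
simpl corner; unfold step.
set (p := corner n) in *. destruct p as [x y]; cbn [fst snd] in *.
destruct (Rle_dec _ _) as [|N1]; auto.
destruct (Rle_dec _ _) as [|N2]; auto.
destruct (Rle_dec _ _) as [|N3]; auto.
destruct (Rle_dec (Cmod (piece n (x, y))) (4 * Cmod (piece (S n) (x + w (S n), y + h (S n))%R))) as [|N4]; auto.
exfalso.
assert (X : piece n (x, y) = piece (S n) (x, y) + piece (S n) (x + w (S n), y)%R
   + piece (S n) (x, y + h (S n))%R + piece (S n) (x + w (S n), y + h (S n))%R).
{ unfold piece; cbn [fst snd].
  replace (x + w (S n) + w (S n))%R with (x + w n)%R by lra.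
  replace (y + h (S n) + h (S n))%R with (y + h n)%R by lra.
  apply rectint_split; try lra.
  intros u v Hu Hv; apply cdiff_ccont; apply Hf; lra. }
assert (T1 := Cmod_triangle (piece (S n) (x, y) + piece (S n) (x + w (S n), y)%R
   + piece (S n) (x, y + h (S n))%R) (piece (S n) (x + w (S n), y + h (S n))%R)).
assert (T2 := Cmod_triangle (piece (S n) (x, y) + piece (S n) (x + w (S n), y)%R)
   (piece (S n) (x, y + h (S n))%R)).
assert (T3 := Cmod_triangle (piece (S n) (x, y)) (piece (S n) (x + w (S n), y)%R)).
rewrite <- X in T1. lra.
Qed.

Lemma corner_big0 n : (Cmod (rectint f a b c d) <= 4 ^ n * Cmod (piece n (corner n)))%R.
Proof.
induction n as [|n IH].
- simpl; unfold piece, w, h; simpl.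
  replace (a + (b - a) / 1)%R with b by field. replace (c + (d - c) / 1)%R with d by field. lra.
- assert (B := corner_big n). assert (0 < 4 ^ n)%R by (apply pow_lt; lra).
  eapply Rle_trans; [exact IH|].
  replace (4 ^ S n)%R with (4 ^ n * 4)%R by (simpl; ring).
  rewrite Rmult_assoc. apply Rmult_le_compat_l; lra.
Qed.

Lemma nested_limit (u l : nat -> R) : (forall n, u n <= u (S n))%R ->
  (forall n, u (S n) + l (S n) <= u n + l n)%R -> (forall n, 0 <= l n)%R ->
  exists x : R, forall n, (u n <= x <= u n + l n)%R.
Proof.
intros H1 H2 H3.
assert (M1 : forall n m, (u n <= u (n + m)%nat)%R).
{ intros n m; induction m as [|m IH]; [rewrite Nat.add_0_r; lra|].
  rewrite Nat.add_succ_r; specialize (H1 (n + m)%nat); lra. }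
assert (M2 : forall n m, (u (n + m)%nat + l (n + m)%nat <= u n + l n)%R).
{ intros n m; induction m as [|m IH]; [rewrite Nat.add_0_r; lra|].
  rewrite Nat.add_succ_r; specialize (H2 (n + m)%nat); lra. }
assert (M3 : forall n m, (u m <= u n + l n)%R).
{ intros n m. destruct (Nat.le_ge_cases n m) as [L|L].
  - replace m with (n + (m - n))%nat by lia. specialize (M2 n (m - n)%nat); specialize (H3 (n + (m - n))%nat); lra.
  - replace n with (m + (n - m))%nat by lia. specialize (M1 m (n - m)%nat); specialize (H3 (m + (n - m))%nat); lra. }
destruct (completeness (fun y => exists n, y = u n)) as [x [X1 X2]].
- exists (u O + l O)%R; intros y [n ->]; auto.
- exists (u O); now exists O.
- exists x; intros n; split; [apply X1; now exists n|].
  apply X2; intros y [m ->]; auto.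
Qed.

(** On a quarter of generation [n] around the limit point, [f] is affine up to an
    error [e] times the diameter.  The affine part has integral 0, the rest at
    most a constant times [e / 4^n], and the quartering lost at most [4^n]. *)
Theorem goursat : rectint f a b c d = 0.
Proof.
apply Cmod_eq_0. apply Rle_antisym; [|apply Cmod_ge_0].
destruct (nested_limit (fun n => fst (corner n)) w) as [x Hx].
{ intros n; apply corner_step. } { intros n; apply corner_step. } { intros n; apply corner_half. }
destruct (nested_limit (fun n => snd (corner n)) h) as [y Hy].
{ intros n; apply corner_step. } { intros n; apply corner_step. } { intros n; apply corner_half. }
assert (Hxy : cdiff f (x, y)).
{ apply Hf.
  - specialize (Hx O); simpl in Hx; unfold w in Hx; simpl in Hx; lra.
  - specialize (Hy O); simpl in Hy; unfold h in Hy; simpl in Hy; lra. }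
destruct Hxy as [phi [Hphi E]].
set (s := ((b - a) + (d - c))%R).
assert (s0 : (0 <= s)%R) by (unfold s; lra).
apply le_epsilon; intros eps He. rewrite Rplus_0_l.
set (e := (eps / (4 * s * s + 1))%R).
assert (Pos : (0 < 4 * s * s + 1)%R) by nra.
assert (e0 : (0 < e)%R) by (apply Rdiv_lt_0_compat; lra).
destruct (Hphi e e0) as [dl [Hdl D]].
destruct (Rle_lt_or_eq_dec 0 s s0) as [sp|sz].
(* a rectangle reduced to a point *)
2:{ specialize (corner_big0 0). simpl. 
    assert (B := rectint_bound f a b c d).
    intros _. assert (contrect f a b c d) by (intros u v Hu Hv; apply cdiff_ccont; auto).
    destruct (ccont_bound f (a, c)) as [d1 [M [Hd1 [HM BM]]]]. { apply H; lra. }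
    specialize (B M ab cd H).
    unfold s in sz.
    eapply Rle_trans; [apply B|].
    - intros u v Hu Hv. apply BM. replace u with a by lra. replace v with c by lra.
      replace ((a, c) - (a, c)) with (RtoC 0) by ring. rewrite Cmod_0; auto.
    - rewrite <- sz. lra. }
(* a generation whose pieces have diameter below dl *)
assert (Hn : exists n, (s / 2 ^ n < dl)%R).
{ destruct (pow_lt_1_zero (/ 2) ltac:(rewrite Rabs_pos_eq; lra) (dl / s) ltac:(apply Rdiv_lt_0_compat; lra)) as [n N].
  exists n. specialize (N n (Nat.le_refl n)).
  rewrite Rabs_pos_eq in N by (apply pow_le; lra). rewrite pow_inv in N.
  apply Rmult_lt_reg_r with (/ s)%R; [apply Rinv_0_lt_compat; lra|].
  replace (s / 2 ^ n * / s)%R with (/ 2 ^ n)%R by (assert (2 ^ n <> 0)%R by (apply pow_nonzero; lra); field; split; lra). exact N. }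
destruct Hn as [n Hn].
assert (P2 : (0 < 2 ^ n)%R) by (apply pow_lt; lra).
destruct (corner_range n) as [R1 [R2 [R3 R4]]].
destruct (corner_half n) as [_ [_ [P Q]]].
specialize (Hx n); specialize (Hy n). cbv beta in Hx, Hy.
set (z := (x, y)) in *.
assert (EI : piece n (corner n) = rectint (fun u => (f z - phi z * z + phi z * u) + (phi u - phi z) * (u - z))
   (fst (corner n)) (fst (corner n) + w n) (snd (corner n)) (snd (corner n) + h n)).
{ unfold piece. apply rectint_ext; try lra. intros u.
  replace (f u) with (f z + (f u - f z)) by ring. rewrite E. ring. }
assert (Clin : forall A B u, ccont (fun u => A + B * u) u).
{ intros A B u; apply ccont_plus; [apply ccont_const|]. apply ccont_mult; [apply ccont_const|apply ccont_id]. }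
assert (Crem : contrect (fun u => (phi u - phi z) * (u - z)) (fst (corner n)) (fst (corner n) + w n)
   (snd (corner n)) (snd (corner n) + h n)).
{ intros u v Hu Hv eps' He'.
  assert (CC : ccont (fun u => f u + (- (f z - phi z * z) + (- phi z) * u)) (u, v)).
  { apply ccont_plus; [|apply Clin]. apply cdiff_ccont, Hf; lra. }
  destruct (CC eps' He') as [dd [Hdd DD]]. exists dd; split; auto. intros t Ht. specialize (DD t Ht).
  assert (EE : forall u, (phi u - phi z) * (u - z) = f u + (- (f z - phi z * z) + (- phi z) * u)).
  { intros u'. replace (f u') with (f z + (f u' - f z)) by ring. rewrite E. ring. }
  rewrite 2!EE. exact DD. }
rewrite rectint_plus in EI; try lra; auto.
2:{ intros u v _ _. apply Clin. }
rewrite rectint_affine, Cplus_0_l in EI.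
eapply Rle_trans; [apply (corner_big0 n)|]. rewrite EI.
eapply Rle_trans.
{ apply Rmult_le_compat_l; [apply pow_le; lra|].
  apply (rectint_bound _ _ _ _ _ (e * (s / 2 ^ n))%R); auto; try lra.
  intros u v Hu Hv. rewrite Cmod_mult.
  assert (L : (Cmod ((u, v) - z) <= s / 2 ^ n)%R).
  { eapply Rle_trans; [apply Cmod_le_abs|]. simpl.
    assert (Rabs (u + - x) <= w n)%R by (apply Rabs_le; lra).
    assert (Rabs (v + - y) <= h n)%R by (apply Rabs_le; lra).
    replace (s / 2 ^ n)%R with (w n + h n)%R by (unfold w, h, s; field; lra). lra. }
  apply Rmult_le_compat; try apply Cmod_ge_0; auto.
  left; apply D. lra. }
replace (fst (corner n) + w n - fst (corner n) + (snd (corner n) + h n - snd (corner n)))%R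
  with (s / 2 ^ n)%R by (unfold w, h, s; field; lra).
replace (4 ^ n)%R with (2 ^ n * 2 ^ n)%R by (rewrite <- Rpow_mult_distr; f_equal; lra).
replace (2 ^ n * 2 ^ n * (4 * (e * (s / 2 ^ n)) * (s / 2 ^ n)))%R with (e * (4 * s * s))%R by (field; lra).
unfold e. replace eps with (eps / (4 * s * s + 1) * (4 * s * s + 1))%R at 2 by (field; lra).
apply Rmult_le_compat_l; [left; exact e0|lra].
Qed.
End Goursat.

(** * The value at the centre of a circle *)

Definition cexp (z : C) : C := (exp (fst z) * cos (snd z), exp (fst z) * sin (snd z))%R.

Lemma cexp_plus z w : cexp (z + w) = cexp z * cexp w.
Proof.
destruct z as [x y], w as [x' y']. unfold cexp, Cplus, Cmult; simpl.
rewrite exp_plus, cos_plus, sin_plus. f_equal; ring.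
Qed.

Lemma exp_mono x y : (x <= y)%R -> (exp x <= exp y)%R.
Proof. intros [H| ->]; [left; now apply exp_increasing|apply Rle_refl]. Qed.

Lemma cexp_0 : cexp 0 = 1.
Proof. unfold cexp, RtoC; simpl. rewrite exp_0, cos_0, sin_0. f_equal; ring. Qed.

Lemma Cmod_cexp z : Cmod (cexp z) = exp (fst z).
Proof.
destruct z as [x y]; unfold cexp, Cmod; simpl.
replace (exp x * cos y * (exp x * cos y * 1) + exp x * sin y * (exp x * sin y * 1))%R
  with (Rsqr (exp x)).
- rewrite sqrt_Rsqr; auto. left; apply exp_pos.
- assert (P := sin2_cos2 y). unfold Rsqr in *.
  replace (exp x * cos y * (exp x * cos y * 1) + exp x * sin y * (exp x * sin y * 1))%R
   with (exp x * exp x * (sin y * sin y + cos y * cos y))%R by ring. rewrite P; ring.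
Qed.

Lemma derive_at0_bound (f : R -> R) l : is_derive f 0 l -> forall eps : R, (0 < eps)%R ->
  exists d : R, (0 < d)%R /\ forall x, (Rabs x < d)%R -> (Rabs (f x - f 0 - l * x) <= eps * Rabs x)%R.
Proof.
intros H eps He. apply is_derive_Reals in H. destruct (H eps He) as [d D].
exists d; split; [apply cond_pos|]; intros x Hx.
destruct (Req_dec x 0) as [->|n].
- replace (f 0 - f 0 - l * 0)%R with 0%R by ring. rewrite Rabs_R0; lra.
- specialize (D x n Hx). rewrite Rplus_0_l in D.
  replace (f x - f 0 - l * x)%R with (((f x - f 0) / x - l) * x)%R by (field; auto).
  rewrite Rabs_mult. apply Rmult_le_compat_r; [apply Rabs_pos|lra].
Qed.

Lemma cexp_near0 eps : (0 < eps)%R -> exists d : R, (0 < d)%R /\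
  forall h, (Cmod h < d)%R -> (Cmod (cexp h - 1 - h) <= eps * Cmod h)%R.
Proof.
intros He.
set (e := Rmin (eps / 8) 1).
assert (e0 : (0 < e)%R) by (apply Rmin_glb_lt; lra).
assert (e1 : (e <= eps / 8)%R) by apply Rmin_l.
assert (e2 : (e <= 1)%R) by apply Rmin_r.
destruct (derive_at0_bound exp 1 ltac:(auto_derive; [auto|rewrite exp_0; ring]) e e0) as [d1 [D1 H1]].
destruct (derive_at0_bound sin 1 ltac:(auto_derive; [auto|rewrite cos_0; ring]) e e0) as [d2 [D2 H2]].
destruct (derive_at0_bound cos 0 ltac:(auto_derive; [auto|rewrite sin_0; ring]) e e0) as [d3 [D3 H3]].
rewrite exp_0 in H1; rewrite sin_0 in H2; rewrite cos_0 in H3.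
exists (Rmin (Rmin d1 d2) (Rmin d3 (e / 2))); split; [repeat apply Rmin_glb_lt; lra|].
intros h Hh.
assert (W1 := Rlt_le_trans _ _ _ Hh (Rmin_l _ _)).
assert (W2 := Rlt_le_trans _ _ _ Hh (Rmin_r _ _)).
assert (V1 := Rlt_le_trans _ _ _ W1 (Rmin_l _ _)).
assert (V2 := Rlt_le_trans _ _ _ W1 (Rmin_r _ _)).
assert (V3 := Rlt_le_trans _ _ _ W2 (Rmin_l _ _)).
assert (V4 := Rlt_le_trans _ _ _ W2 (Rmin_r _ _)).
assert (F := fst_le_Cmod h). assert (S := snd_le_Cmod h).
destruct h as [x y]; cbn [fst snd] in F, S. set (m := Cmod (x, y)) in *.
specialize (H1 x ltac:(lra)). specialize (H2 y ltac:(lra)). specialize (H3 y ltac:(lra)).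
eapply Rle_trans; [apply Cmod_le_abs|]. simpl.
assert (m0 : (0 <= m)%R) by apply Cmod_ge_0.
assert (X0 := Rabs_pos x). assert (Y0 := Rabs_pos y).
assert (em : (0 <= e * m)%R) by (apply Rmult_le_pos; lra).
assert (L1 : (Rabs (exp x - 1 - 1 * x) <= e * m)%R).
{ eapply Rle_trans; [exact H1|]. apply Rmult_le_compat_l; lra. }
assert (L2 : (Rabs (sin y - 0 - 1 * y) <= e * m)%R).
{ eapply Rle_trans; [exact H2|]. apply Rmult_le_compat_l; lra. }
assert (L3 : (Rabs (cos y - 1 - 0 * y) <= e * m)%R).
{ eapply Rle_trans; [exact H3|]. apply Rmult_le_compat_l; lra. }
assert (L4 : (Rabs (exp x - 1) <= e)%R).
{ replace (exp x - 1)%R with ((exp x - 1 - 1 * x) + x)%R by ring.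
  eapply Rle_trans; [apply Rabs_triang|]. nra. }
assert (E1 : (Rabs (exp x * cos y + - (1) + - x) <= 3 * (e * m))%R).
{ replace (exp x * cos y + - (1) + - x)%R
   with ((exp x - 1) * (cos y - 1 - 0 * y) + ((cos y - 1 - 0 * y) + (exp x - 1 - 1 * x)))%R by ring.
  eapply Rle_trans; [apply Rabs_triang|]. rewrite Rabs_mult.
  assert (T := Rabs_triang (cos y - 1 - 0 * y) (exp x - 1 - 1 * x)).
  assert (Rabs (exp x - 1) * Rabs (cos y - 1 - 0 * y) <= 1 * (e * m))%R.
  { apply Rmult_le_compat; try apply Rabs_pos; lra. } lra. }
assert (E2 : (Rabs (exp x * sin y + - 0 + - y) <= 3 * (e * m))%R).
{ replace (exp x * sin y + - 0 + - y)%R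
   with ((exp x - 1) * (sin y - 0 - 1 * y) + ((sin y - 0 - 1 * y) + (exp x - 1) * y))%R by ring.
  eapply Rle_trans; [apply Rabs_triang|]. rewrite Rabs_mult.
  assert (T := Rabs_triang (sin y - 0 - 1 * y) ((exp x - 1) * y)). rewrite Rabs_mult in T.
  assert (Rabs (exp x - 1) * Rabs (sin y - 0 - 1 * y) <= 1 * (e * m))%R.
  { apply Rmult_le_compat; try apply Rabs_pos; lra. }
  assert (Rabs (exp x - 1) * Rabs y <= e * m)%R.
  { apply Rmult_le_compat; try apply Rabs_pos; lra. } lra. }
apply Rle_trans with (6 * (e * m))%R; [lra|]. 
apply Rle_trans with (8 * (e * m))%R; [lra|]. 
rewrite <- Rmult_assoc. apply Rmult_le_compat_r; lra.
Qed.

Lemma cdiff_cexp z : cdiff cexp z.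
Proof.
exists (fun w => cexp z * (if Ceq_dec (w - z) 0 then 1 else (cexp (w - z) - 1) / (w - z))); split.
- apply ccont_mult; [apply ccont_const|].
  intros eps He. destruct (cexp_near0 (eps / 2) ltac:(lra)) as [d [Hd D]].
  exists d; split; auto; intros w Hw.
  destruct (Ceq_dec (z - z) 0) as [_|n]; [|exfalso; apply n; ring].
  destruct (Ceq_dec (w - z) 0) as [e|n].
  + replace (RtoC 1 - 1) with (RtoC 0) by ring. rewrite Cmod_0; auto.
  + specialize (D _ Hw).
    assert (P : (0 < Cmod (w - z))%R) by (apply -> Cmod_gt_0; assumption).
    replace ((cexp (w - z) - 1) / (w - z) - 1) with ((cexp (w - z) - 1 - (w - z)) / (w - z)) by (field; auto).
    rewrite Cmod_div; auto. apply Rle_lt_trans with (eps / 2)%R; [|lra].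
    apply Rmult_le_reg_r with (Cmod (w - z)); auto.
    unfold Rdiv at 1. rewrite Rmult_assoc, Rinv_l; [lra|lra].
- intros w. replace (cexp w) with (cexp z * cexp (w - z)).
  2:{ rewrite <- cexp_plus. f_equal; ring. }
  destruct (Ceq_dec (w - z) 0) as [e|n].
  + rewrite e, cexp_0; ring.
  + field; auto.
Qed.

Lemma cexp_2PI x : cexp (x, 2 * PI)%R = cexp (x, 0%R).
Proof. unfold cexp; simpl. rewrite sin_2PI, cos_2PI, sin_0, cos_0; auto. Qed.

Lemma Cint_const A a b : Cint (fun _ => A) a b = RtoC (b - a)%R * A.
Proof.
unfold Cint. rewrite 2!RInt_const. unfold Cmult, RtoC; simpl. unfold scal; simpl; unfold mult; simpl.
f_equal; ring.
Qed.

(** In logarithmic polar coordinates [G z = g (s0 + exp z)] the disc becomes a half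
    strip and circles become vertical segments of length [2 PI].  By Goursat and
    periodicity the integral of [G] over such a segment does not depend on its
    abscissa; letting the abscissa tend to minus infinity gives [2 PI * g s0].
    The factor 2 comes from bounding real and imaginary parts separately. *)
Theorem circle_bound g s0 r M : (0 < r)%R ->
  (forall w, (Cmod (w - s0) <= r)%R -> cdiff g w) ->
  (forall y, (0 <= y <= 2 * PI)%R -> (Cmod (g (s0 + cexp (ln r, y))%C) <= M)%R) ->
  (Cmod (g s0) <= 2 * M)%R.
Proof.
intros Hr Hg HM.
assert (PI0 := PI_RGT_0).
set (G := fun z => g (s0 + cexp z)).
assert (HG : forall x y, (exp x <= r)%R -> cdiff G (x, y)).
{ intros x y Hx. unfold G. apply (cdiff_comp g (fun z => s0 + cexp z)).
  - apply cdiff_plus; [apply cdiff_const|apply cdiff_cexp].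
  - apply Hg. replace (s0 + cexp (x, y) - s0) with (cexp (x, y)) by ring. now rewrite Cmod_cexp. }
assert (Er : exp (ln r) = r) by (apply exp_ln; auto).
assert (Same : forall x, (x <= ln r)%R ->
  Cint (fun y => G (ln r, y)) 0 (2 * PI) = Cint (fun y => G (x, y)) 0 (2 * PI)).
{ intros x Hx. assert (GG := goursat G x (ln r) 0 (2 * PI) Hx ltac:(lra)).
  unfold rectint in GG. rewrite (Cint_ext (fun u => G (u, (2 * PI)%R)) (fun u => G (u, 0%R))) in GG; auto.
  2:{ intros; unfold G. now rewrite cexp_2PI. }
  assert (H : Ci * (Cint (fun y => G (ln r, y)) 0 (2 * PI) - Cint (fun y => G (x, y)) 0 (2 * PI)) = 0).
  { rewrite <- GG; [ring|]. intros u v Hu Hv. apply HG. rewrite <- Er.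
    destruct (Req_dec u (ln r)) as [->|]; [lra|]. left; apply exp_increasing; lra. }
  apply Ceq_minus.
  replace (Cint (fun y : R => G (ln r, y)) 0 (2 * PI) - Cint (fun y : R => G (x, y)) 0 (2 * PI))
    with (- Ci * (Ci * (Cint (fun y => G (ln r, y)) 0 (2 * PI) - Cint (fun y => G (x, y)) 0 (2 * PI)))).
  - rewrite H; ring.
  - rewrite Cmult_assoc. replace (- Ci * Ci) with (RtoC 1). ring.
    unfold Ci, Cmult, Copp, RtoC; simpl. f_equal; ring. }
assert (Pc : forall x, (x <= ln r)%R -> pathcont (fun y => G (x, y)) 0 (2 * PI)).
{ intros x Hx; apply pathcont_ver; intros y _. apply cdiff_ccont, HG.
  rewrite <- Er. destruct (Req_dec x (ln r)) as [->|]; [lra|]. left; apply exp_increasing; lra. }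
assert (B1 : (Cmod (Cint (fun y => G (ln r, y)) 0 (2 * PI)) <= 2 * M * (2 * PI))%R).
{ replace (2 * M * (2 * PI))%R with (2 * M * (2 * PI - 0))%R by ring.
  apply Cint_bound; [lra|apply Pc; lra|]. intros y Hy. now apply HM. }
assert (B2 : (Cmod (Cint (fun y => G (ln r, y)) 0 (2 * PI) - RtoC (2 * PI - 0)%R * g s0) <= 0)%R).
{ apply le_epsilon; intros eps He. rewrite Rplus_0_l.
  set (e := (eps / (4 * PI + 1))%R).
  assert (e0 : (0 < e)%R) by (apply Rdiv_lt_0_compat; lra).
  assert (Cs : ccont g s0).
  { apply cdiff_ccont, Hg. replace (s0 - s0) with (RtoC 0) by ring. rewrite Cmod_0; lra. }
  destruct (Cs e e0) as [d [Hd D]].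
  set (x := Rmin (ln r) (ln (d / 2))).
  assert (X1 : (x <= ln r)%R) by apply Rmin_l.
  assert (X2 : (exp x < d)%R).
  { apply Rle_lt_trans with (d / 2)%R; [|lra].
    rewrite <- (exp_ln (d / 2)) by lra.
    assert (x <= ln (d / 2))%R by apply Rmin_r.
    destruct (Req_dec x (ln (d / 2))) as [->|]; [lra|]. left; apply exp_increasing; lra. }
  rewrite (Same x X1), <- Cint_const.
  assert (Pk : pathcont (fun _ => - g s0) 0 (2 * PI)).
  { intros y _; split; apply continuous_const. }
  replace (Cint (fun y => G (x, y)) 0 (2 * PI) - Cint (fun _ => g s0) 0 (2 * PI))
    with (Cint (fun y => G (x, y) + - g s0) 0 (2 * PI)).
  2:{ rewrite Cint_plus; auto; [|lra]. rewrite 2!Cint_const. ring. }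
  eapply Rle_trans.
  - apply (Cint_bound _ _ _ e); [lra| |].
    + intros y Hy. destruct (Pc x X1 y Hy) as [A B].
      split; simpl; [apply (continuous_plus (V := R_NormedModule) (fun y => fst (G (x, y))) (fun _ => - fst (g s0))%R)
       |apply (continuous_plus (V := R_NormedModule) (fun y => snd (G (x, y))) (fun _ => - snd (g s0))%R)]; auto; apply continuous_const.
    + intros y _. left. apply D. replace (s0 + cexp (x, y) - s0) with (cexp (x, y)) by ring. now rewrite Cmod_cexp.
  - unfold e. replace (2 * (eps / (4 * PI + 1)) * (2 * PI - 0))%R with (eps / (4 * PI + 1) * (4 * PI))%R by ring.
    replace eps with (eps / (4 * PI + 1) * (4 * PI + 1))%R at 2 by (field; lra).
    apply Rmult_le_compat_l; [left; exact e0|lra]. }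
assert (B3 : (Cmod (RtoC (2 * PI - 0)%R * g s0) <= 2 * M * (2 * PI))%R).
{ assert (T := Cmod_triangle (Cint (fun y => G (ln r, y)) 0 (2 * PI))
   (- (Cint (fun y => G (ln r, y)) 0 (2 * PI) - RtoC (2 * PI - 0)%R * g s0))).
  rewrite Cmod_opp in T.
  replace (Cint (fun y => G (ln r, y)) 0 (2 * PI) + - (Cint (fun y => G (ln r, y)) 0 (2 * PI) - RtoC (2 * PI - 0)%R * g s0))
   with (RtoC (2 * PI - 0)%R * g s0) in T by ring. lra. }
rewrite Cmod_mult, Cmod_R, Rabs_pos_eq in B3; [|lra].
apply Rmult_le_reg_l with (2 * PI)%R; lra.
Qed.

(** * The truncated Hurwitz series *)

Definition cder (p : R -> C) (t : R) (l : C) : Prop :=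
  is_derive (fun u => fst (p u)) t (fst l) /\ is_derive (fun u => snd (p u)) t (snd l).

Lemma cder_eq p t l l' : l = l' -> cder p t l -> cder p t l'.
Proof. now intros ->. Qed.

Lemma cder_plus p q t l m : cder p t l -> cder q t m -> cder (fun u => p u + q u) t (l + m).
Proof. intros [A B] [A' B']; split; now apply (is_derive_plus (K := R_AbsRing) (V := R_NormedModule)). Qed.

Lemma is_derive_lin2 (f g : R -> R) t l m a b : is_derive f t l -> is_derive g t m ->
  is_derive (fun u => a * f u + b * g u)%R t (a * l + b * m)%R.
Proof.
intros A B. apply (is_derive_plus (K := R_AbsRing) (V := R_NormedModule) (fun u => a * f u)%R (fun u => b * g u)%R);
 now apply is_derive_scal.
Qed.

Lemma cder_scal A p t l : cder p t l -> cder (fun u => A * p u) t (A * l).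
Proof.
intros [X Y]; split; simpl.
- replace (fst A * fst l - snd A * snd l)%R with (fst A * fst l + (- snd A) * snd l)%R by ring.
  eapply is_derive_ext; [|apply (is_derive_lin2 _ _ t _ _ (fst A) (- snd A)%R X Y)] .
  intros; simpl; ring.
- apply (is_derive_lin2 _ _ t _ _ (fst A) (snd A)%R Y X).
Qed.

Lemma cder_ext p q t l : (forall u, p u = q u) -> cder p t l -> cder q t l.
Proof. intros E [A B]; split; eapply is_derive_ext; eauto; intros u; simpl; now rewrite E. Qed.

Lemma cder_comp p g t l d : cder p (g t) l -> is_derive g t d -> cder (fun u => p (g u)) t (RtoC d * l).
Proof.
intros [A B] D; split; simpl.
- replace (d * fst l - 0 * snd l)%R with (scal d (fst l)) by (unfold scal; simpl; unfold mult; simpl; ring).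
  now apply (is_derive_comp (fun u => fst (p u)) g).
- replace (d * snd l + 0 * fst l)%R with (scal d (snd l)) by (unfold scal; simpl; unfold mult; simpl; ring).
  now apply (is_derive_comp (fun u => snd (p u)) g).
Qed.

Lemma cder_rmult k p t k' l : is_derive k t k' -> cder p t l ->
  cder (fun u => RtoC (k u) * p u) t (RtoC k' * p t + RtoC (k t) * l).
Proof.
intros D [A B]; split; simpl.
- replace (k' * fst (p t) - 0 * snd (p t) + (k t * fst l - 0 * snd l))%R with (k' * fst (p t) + k t * fst l)%R by ring.
  eapply is_derive_ext; [|apply (is_derive_mult (K := R_AbsRing) k (fun u => fst (p u)) t _ _ D A Rmult_comm)].
  intros u; simpl. unfold mult; simpl; ring.
- replace (k' * snd (p t) + 0 * fst (p t) + (k t * snd l + 0 * fst l))%R with (k' * snd (p t) + k t * snd l)%R by ring.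
  eapply is_derive_ext; [|apply (is_derive_mult (K := R_AbsRing) k (fun u => snd (p u)) t _ _ D B Rmult_comm)].
  intros u; simpl. unfold mult; simpl; ring.
Qed.

Lemma cder_exp (c : C) l : cder (fun u => cexp (c * RtoC u)) l (c * cexp (c * RtoC l)).
Proof.
destruct c as [c1 c2].
assert (E1 : forall u, (c1 * u - c2 * 0 = c1 * u)%R) by (intros; ring).
assert (E2 : forall u, (c1 * 0 + c2 * u = c2 * u)%R) by (intros; ring).
split; simpl; rewrite E1, E2.
- apply is_derive_ext with (fun u => exp (c1 * u) * cos (c2 * u))%R.
  { intros u; now rewrite E1, E2. }
  auto_derive; auto; ring.
- apply is_derive_ext with (fun u => exp (c1 * u) * sin (c2 * u))%R.
  { intros u; now rewrite E1, E2. }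
  auto_derive; auto; ring.
Qed.

(** The factor 2 comes from applying the real mean value theorem to both
    components. *)
Lemma cmean_value p dp a b M : (a <= b)%R -> (forall t, (a <= t <= b)%R -> cder p t (dp t)) ->
  (forall t, (a <= t <= b)%R -> (Cmod (dp t) <= M)%R) -> (Cmod (p b - p a) <= 2 * M * (b - a))%R.
Proof.
intros ab D B.
destruct (Rle_lt_or_eq_dec _ _ ab) as [lt|<-].
2:{ replace (p a - p a) with (RtoC 0) by ring. rewrite Cmod_0; lra. }
eapply Rle_trans; [apply Cmod_le_abs|]. simpl.
destruct (MVT_gen (fun u => fst (p u)) a b (fun t => fst (dp t))) as [x [X1 X2]];
 rewrite ?Rmin_left, ?Rmax_right in *; try lra.
{ intros x Hx; apply D; lra. }
{ intros x Hx; apply continuity_pt_filterlim. apply (ex_derive_continuous (K := R_AbsRing) (V := R_NormedModule)).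
  exists (fst (dp x)); apply D; lra. }
destruct (MVT_gen (fun u => snd (p u)) a b (fun t => snd (dp t))) as [y [Y1 Y2]];
 rewrite ?Rmin_left, ?Rmax_right in *; try lra.
{ intros y Hy; apply D; lra. }
{ intros y Hy; apply continuity_pt_filterlim. apply (ex_derive_continuous (K := R_AbsRing) (V := R_NormedModule)).
  exists (snd (dp y)); apply D; lra. }
change (fst (p b) + - fst (p a))%R with (fst (p b) - fst (p a))%R.
change (snd (p b) + - snd (p a))%R with (snd (p b) - snd (p a))%R.
rewrite X2, Y2, 2!Rabs_mult, (Rabs_pos_eq (b - a)) by lra.
assert (Rabs (fst (dp x)) <= M)%R by (eapply Rle_trans; [apply fst_le_Cmod|auto]).
assert (Rabs (snd (dp y)) <= M)%R by (eapply Rle_trans; [apply snd_le_Cmod|auto]).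
nra.
Qed.

Fixpoint csum (f : nat -> C) (n : nat) : C := match n with O => 0 | S n => csum f n + f n end.

Definition lpow (y : R) (s : C) : C := cexp (s * RtoC (ln y)).

Lemma Rcpow_lpow y s : Rcpow y s = lpow y s.
Proof.
unfold Rcpow, lpow, cexp, Rpower. destruct s as [a b]; simpl.
f_equal; f_equal; f_equal; ring.
Qed.

Lemma Cmod_lpow y s : Cmod (lpow y s) = Rpower y (fst s).
Proof. unfold lpow; rewrite Cmod_cexp. unfold Rpower; simpl. f_equal; ring. Qed.

Lemma lpow_1 y s : (0 < y)%R -> lpow y (1 - s) = RtoC y * lpow y (- s).
Proof.
intros Hy; unfold lpow. replace ((1 - s) * RtoC (ln y)) with (RtoC (ln y) + (- s) * RtoC (ln y)) by ring.
rewrite cexp_plus. f_equal. unfold cexp; simpl. rewrite cos_0, sin_0, exp_ln; auto.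
unfold RtoC; f_equal; ring.
Qed.

Lemma cder_lpow s y : (0 < y)%R -> cder (fun u => lpow u s) y (s * RtoC (/ y) * lpow y s).
Proof.
intros Hy. unfold lpow.
eapply cder_eq; [|apply (cder_comp (fun l => cexp (s * RtoC l)) ln y _ (/ y)%R (cder_exp s (ln y)))].
- ring.
- apply is_derive_Reals, derivable_pt_lim_ln; auto.
Qed.

(** The subtracted term is the primitive of [u^(-s)] at [N + alpha]; without the growth
    of that integral the partial sums converge for [Re s > 0]. *)
Definition hpart (alpha : R) (N : nat) (s : C) : C :=
  csum (fun n => lpow (INR n + alpha) (- s)) N - lpow (INR N + alpha) (1 - s) / (1 - s).

Section Hurwitz.
Variable alpha : R.
Hypothesis alpha_pos : (0 < alpha)%R.

Lemma Rpower_le_base x y z : (0 < x)%R -> (x <= y)%R -> (z <= 0)%R -> (Rpower y z <= Rpower x z)%R.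
Proof.
intros Hx xy Hz. unfold Rpower.
assert (L : (ln x <= ln y)%R) by (apply ln_le; auto).
assert (z * ln y <= z * ln x)%R by nra.
destruct (Req_dec (z * ln y) (z * ln x)) as [->|]; [lra|]. left; apply exp_increasing; lra.
Qed.

(** The step is the error of approximating the integral of [u^(-s)] over an interval
    of length 1 by its left end value, so the mean value theorem is used twice. *)
Lemma hpart_step (N : nat) (s : C) : s <> 1 -> (0 <= fst s)%R ->
  (Cmod (hpart alpha (S N) s - hpart alpha N s) <= 4 * Cmod s * Rpower (INR N + alpha) (- fst s - 1))%R.
Proof.
intros Hs Hs0. set (y := (INR N + alpha)%R).
assert (Hy : (0 < y)%R) by (assert (Q := pos_INR N); unfold y; lra).
assert (Hs' : 1 - s <> 0).
{ intros F; apply Hs. replace s with (1 - (1 - s)) by ring. rewrite F; ring. }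
set (psi := fun u : R => lpow u (1 - s) / (1 - s) + - RtoC u * lpow y (- s)).
replace (hpart alpha (S N) s - hpart alpha N s) with (- (psi (y + 1)%R - psi y)).
2:{ unfold hpart, psi. replace (INR (S N) + alpha)%R with (y + 1)%R by (rewrite S_INR; unfold y; ring).
    simpl csum. fold y. rewrite RtoC_plus. ring. }
rewrite Cmod_opp.
set (M := (2 * Cmod s * Rpower y (- fst s - 1))%R).
replace (4 * Cmod s * Rpower y (- fst s - 1))%R with (2 * M * (y + 1 - y))%R by (unfold M; ring).
apply (cmean_value psi (fun u => lpow u (- s) - lpow y (- s))); [lra| |].
- intros t Ht. unfold psi.
  replace (lpow t (- s) - lpow y (- s)) with (/ (1 - s) * ((1 - s) * RtoC (/ t) * lpow t (1 - s)) + (- lpow y (- s)) * (RtoC 1 * 1)).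
  + apply (cder_plus (fun u => lpow u (1 - s) / (1 - s)) (fun u => - RtoC u * lpow y (- s))).
    * apply cder_ext with (fun u => / (1 - s) * lpow u (1 - s)); [intros; unfold Cdiv; ring|].
      apply cder_scal, cder_lpow; lra.
    * apply cder_ext with (fun u => (- lpow y (- s)) * RtoC u); [intros; ring|].
      apply cder_scal. apply cder_eq with (RtoC 1 * 1)%C; [reflexivity|].
      split; simpl; auto_derive; auto; ring.
  + rewrite lpow_1 by lra. rewrite RtoC_inv by lra. field. split; auto.
    intros F; injection F; lra.
- intros t Ht.
  replace M with (2 * (Cmod s * Rpower y (- fst s - 1)) * 1)%R by (unfold M; ring).
  apply Rle_trans with (2 * (Cmod s * Rpower y (- fst s - 1)) * (t - y))%R.
  + apply (cmean_value (fun u => lpow u (- s)) (fun u => (- s) * RtoC (/ u) * lpow u (- s))); [lra| |].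
    * intros u Hu; apply cder_lpow; lra.
    * intros u Hu. rewrite 2!Cmod_mult, Cmod_opp, Cmod_lpow, Cmod_R.
      rewrite Rabs_pos_eq by (left; apply Rinv_0_lt_compat; lra).
      rewrite Rmult_assoc. apply Rmult_le_compat_l; [apply Cmod_ge_0|].
      apply Rle_trans with (Rpower u (- fst s - 1)).
      -- replace (- fst s - 1)%R with (- (1) + fst (- s)%C)%R by (simpl; ring).
         rewrite Rpower_plus. rewrite Rpower_Ropp, Rpower_1 by lra. lra.
      -- apply Rpower_le_base; lra.
  + apply Rmult_le_compat_l; [|lra]. 
    assert (0 <= Cmod s * Rpower y (- fst s - 1))%R; [|lra].
    apply Rmult_le_pos; [apply Cmod_ge_0|]. left; apply exp_pos.
Qed.

(** The shift by -1 makes [tail_rate N - tail_rate N.+1] dominate the [N]-th step, so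
    that the steps telescope. *)
Definition tail_rate (N : nat) : R := Rpower (INR N - 1 + alpha) (- / 4).

Lemma tail_rate_pos N : (0 < tail_rate N)%R.
Proof. apply exp_pos. Qed.

Lemma hpart_step' (N : nat) (s : C) : s <> 1 -> (1 / 4 <= fst s)%R -> (1 <= N)%nat ->
  (Cmod (hpart alpha (S N) s - hpart alpha N s) <= 16 * Cmod s * (tail_rate N - tail_rate (S N)))%R.
Proof.
intros Hs Hs0 HN. eapply Rle_trans; [apply hpart_step; auto; lra|].
assert (Q := le_INR _ _ HN). simpl in Q.
set (y := (INR N + alpha)%R) in *. assert (Hy : (1 < y)%R) by (unfold y; lra).
replace (16 * Cmod s * (tail_rate N - tail_rate (S N)))%R with (4 * Cmod s * (4 * (tail_rate N - tail_rate (S N))))%R by ring.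
apply Rmult_le_compat_l; [assert (P := Cmod_ge_0 s); lra|].
unfold tail_rate. rewrite S_INR. replace (INR N + 1 - 1 + alpha)%R with y by (unfold y; ring).
replace (INR N - 1 + alpha)%R with (y - 1)%R by (unfold y; ring).
destruct (MVT_cor2 (fun u => Rpower u (- / 4)) (fun u => - / 4 * Rpower u (- / 4 - 1))%R (y - 1) y) as [x [X1 X2]]; [lra| |].
{ intros u Hu. apply derivable_pt_lim_power; unfold y in *; lra. }
assert (Hx : (0 < x)%R) by (unfold y in *; lra).
apply Rle_trans with (Rpower x (- / 4 - 1)); [|lra].
apply Rle_trans with (Rpower y (- / 4 - 1)).
- apply Rle_Rpower; lra.
- apply Rpower_le_base; lra.
Qed.

Lemma hpart_diff (N M : nat) (s : C) : s <> 1 -> (1 / 4 <= fst s)%R -> (1 <= N)%nat -> (N <= M)%nat ->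
  (Cmod (hpart alpha M s - hpart alpha N s) <= 16 * Cmod s * (tail_rate N - tail_rate M))%R.
Proof.
intros Hs Hs0 HN HM. induction HM as [|M HM IH].
- replace (hpart alpha N s - hpart alpha N s) with (RtoC 0) by ring. rewrite Cmod_0; lra.
- replace (hpart alpha (S M) s - hpart alpha N s) with ((hpart alpha (S M) s - hpart alpha M s) + (hpart alpha M s - hpart alpha N s)) by ring.
  eapply Rle_trans; [apply Cmod_triangle|].
  assert (A := hpart_step' M s Hs Hs0 (Nat.le_trans _ _ _ HN HM)). lra.
Qed.

Definition clim (u : nat -> C) (l : C) : Prop :=
  forall eps : R, (0 < eps)%R -> exists n0, forall n, (n0 <= n)%nat -> (Cmod (u n - l) <= eps)%R.

Lemma hpart_lim_bound (N : nat) (s l : C) : s <> 1 -> (1 / 4 <= fst s)%R -> (1 <= N)%nat ->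
  clim (fun N => hpart alpha N s) l -> (Cmod (l - hpart alpha N s) <= 16 * Cmod s * tail_rate N)%R.
Proof.
intros Hs Hs0 HN L. apply le_epsilon; intros eps He.
destruct (L eps He) as [n0 H0].
set (M := Nat.max n0 N).
specialize (H0 M (Nat.le_max_l _ _)).
assert (A := hpart_diff N M s Hs Hs0 HN (Nat.le_max_r _ _)).
replace (l - hpart alpha N s) with ((hpart alpha M s - hpart alpha N s) - (hpart alpha M s - l)) by ring.
unfold Cminus at 1. eapply Rle_trans; [apply Cmod_triangle|]. rewrite Cmod_opp.
assert (0 <= 16 * Cmod s * tail_rate M)%R; [|lra].
apply Rmult_le_pos; [assert (P := Cmod_ge_0 s); lra|left; apply tail_rate_pos].
Qed.

Lemma Rpower_to_0 e : (e < 0)%R -> forall eps : R, (0 < eps)%R ->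
  exists n0, forall n, (n0 <= n)%nat -> (Rpower (INR n - 1 + alpha) e <= eps)%R.
Proof.
intros He eps Heps.
destruct (INR_unbounded (Rpower eps (/ e) + 1)) as [n0 H0].
exists n0; intros n Hn. apply le_INR in Hn.
assert (P : (0 < Rpower eps (/ e))%R) by apply exp_pos.
apply Rle_trans with (Rpower (Rpower eps (/ e)) e).
- apply Rpower_le_base; lra.
- rewrite Rpower_mult. replace (/ e * e)%R with 1%R by (field; lra). rewrite Rpower_1; lra.
Qed.

Lemma tail_rate_to_0 : forall eps : R, (0 < eps)%R -> exists n0, forall n, (n0 <= n)%nat -> (tail_rate n <= eps)%R.
Proof. apply Rpower_to_0; lra. Qed.
End Hurwitz.

(** * Continuation of the approximation to the critical line *)

Lemma cmod_continuity f x : continuous (fun u => fst (f u)) x /\ continuous (fun u => snd (f u)) x ->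
  continuity_pt (fun u : R => Cmod (f u)) x.
Proof.
intros [A B]. apply continuity_pt_filterlim. unfold Cmod.
apply (continuous_comp (fun u => fst (f u) ^ 2 + snd (f u) ^ 2)%R sqrt).
- apply (continuous_plus (V := R_NormedModule) (fun u => fst (f u) ^ 2)%R (fun u => snd (f u) ^ 2)%R).
  + apply (continuous_comp (fun u => fst (f u)) (fun v => v ^ 2)%R); auto.
    apply (ex_derive_continuous (K := R_AbsRing) (V := R_NormedModule)). auto_derive; auto.
  + apply (continuous_comp (fun u => snd (f u)) (fun v => v ^ 2)%R); auto.
    apply (ex_derive_continuous (K := R_AbsRing) (V := R_NormedModule)). auto_derive; auto.
- apply continuity_pt_filterlim. apply continuity_pt_sqrt. nra.
Qed.

Lemma circle_max g s0 r : (forall y, (0 <= y <= 2 * PI)%R -> ccont g (s0 + cexp (r, y))) ->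
  exists B : R, forall y, (0 <= y <= 2 * PI)%R -> (Cmod (g (s0 + cexp (r, y))%C) <= B)%R.
Proof.
intros H. assert (PI0 := PI_RGT_0).
destruct (continuity_ab_maj (fun y => Cmod (g (s0 + cexp (r, y))%C)) 0 (2 * PI)) as [m [Hm _]]; [lra| |].
- intros y Hy. apply cmod_continuity.
  assert (E : ccont (fun z => g (s0 + cexp z)) (r, y)).
  { apply (ccont_comp g (fun z => s0 + cexp z)); auto.
    apply ccont_plus; [apply ccont_const|apply cdiff_ccont, cdiff_cexp]. }
  assert (PC : pathcont (fun y => g (s0 + cexp (r, y))) y y).
  { apply (pathcont_ver (fun z => g (s0 + cexp z))). intros u Hu. replace u with y by lra. exact E. }
  apply PC; lra.
- exists (Cmod (g (s0 + cexp (r, m)))); auto.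
Qed.

Lemma cdiff_lpow y z f : cdiff f z -> cdiff (fun s => lpow y (f s)) z.
Proof.
intros H; unfold lpow. apply (cdiff_comp cexp (fun s => f s * RtoC (ln y))); [|apply cdiff_cexp].
apply cdiff_mult; auto. apply cdiff_const.
Qed.

Lemma cdiff_hpart alpha N (z : C) : z <> 1 -> cdiff (hpart alpha N) z.
Proof.
intros Hz. unfold hpart. apply cdiff_minus.
- induction N as [|N IH]; simpl; [apply cdiff_const|].
  apply cdiff_plus; auto. apply (cdiff_lpow _ _ (fun s => - s)). apply cdiff_opp, cdiff_id.
- apply cdiff_mult.
  + apply (cdiff_lpow _ _ (fun s => 1 - s)). apply cdiff_minus; [apply cdiff_const|apply cdiff_id].
  + apply (cdiff_comp Cinv (fun s => 1 - s)).
    * apply cdiff_minus; [apply cdiff_const|apply cdiff_id].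
    * apply cdiff_inv. intros F; apply Hz. replace z with (1 - (1 - z)) by ring. rewrite F; ring.
Qed.

Lemma sum_n_csum f n : @sum_n C_AbelianMonoid f n = csum f (S n).
Proof.
induction n as [|n IH].
- rewrite sum_O. symmetry. apply Cplus_0_l.
- rewrite sum_Sn, IH. reflexivity.
Qed.

Section Continuation.
Variables (alpha : R) (zeta : C -> C).
Hypothesis alpha_pos : (0 < alpha)%R.
Hypothesis hz : is_hurwitz_zeta alpha zeta.

Definition hpart_converges (s : C) : Prop := clim (fun N => hpart alpha N s) (zeta s).

Lemma hpart_converges_right (s : C) : (1 < fst s)%R -> hpart_converges s.
Proof.
intros Hs eps He.
destruct hz as [H _]. specialize (H s Hs).
assert (H1 := proj1 (filterlim_locally _ _) H (mkposreal (eps / 4) ltac:(lra))).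
destruct H1 as [n1 H1].
assert (Hd : 1 - s <> 0).
{ intros F. assert (G : fst (1 - s) = fst (RtoC 0)) by now rewrite F. simpl in G; lra. }
assert (Pd : (0 < Cmod (1 - s))%R) by (apply -> Cmod_gt_0; assumption).
destruct (Rpower_to_0 alpha alpha_pos (1 - fst s) ltac:(lra) (eps / 2 * Cmod (1 - s))%R ltac:(nra)) as [n2 H2].
exists (Nat.max (S n1) (S n2)); intros n Hn.
assert (L1 := Nat.max_lub_l _ _ _ Hn). assert (L2 := Nat.max_lub_r _ _ _ Hn).
destruct n as [|n]; [lia|].
assert (B := H1 n ltac:(lia)).
assert (B' : (Cmod (csum (fun n => lpow (INR n + alpha) (- s)) (S n) - zeta s) <= eps / 2)%R).
{ rewrite sum_n_csum in B.
  replace (csum (fun n => lpow (INR n + alpha) (- s)) (S n)) with (csum (fun n => Rcpow (INR n + alpha) (- s)) (S n)).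
  2:{ generalize (S n) as m. intros m; induction m as [|m IH]; simpl; auto. rewrite IH, Rcpow_lpow; auto. }
  destruct B as [B1 B2]. simpl in B1, B2.
  change (Rabs (fst (csum (fun n => Rcpow (INR n + alpha) (- s)) (S n)) - fst (zeta s)) < eps / 4)%R in B1.
  change (Rabs (snd (csum (fun n => Rcpow (INR n + alpha) (- s)) (S n)) - snd (zeta s)) < eps / 4)%R in B2.
  eapply Rle_trans; [apply Cmod_le_abs|].
  change (Rabs (fst (csum (fun n => Rcpow (INR n + alpha) (- s)) (S n)) - fst (zeta s))
   + Rabs (snd (csum (fun n => Rcpow (INR n + alpha) (- s)) (S n)) - snd (zeta s)) <= eps / 2)%R. lra. }
unfold hpart. unfold Cminus at 1. unfold Cminus at 1.
replace (csum (fun n => lpow (INR n + alpha) (- s)) (S n) + - (lpow (INR (S n) + alpha) (1 - s) / (1 - s)) + - zeta s)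
 with ((csum (fun n => lpow (INR n + alpha) (- s)) (S n) - zeta s) + - (lpow (INR (S n) + alpha) (1 - s) / (1 - s))) by ring.
eapply Rle_trans; [apply Cmod_triangle|]. rewrite Cmod_opp, Cmod_div, Cmod_lpow; auto.
replace (fst (1 - s)) with (1 - fst s)%R by (simpl; ring).
assert (Q := pos_INR n).
assert (Rpower (INR (S n) + alpha) (1 - fst s) <= eps / 2 * Cmod (1 - s))%R.
{ eapply Rle_trans; [|apply (H2 (S n)); lia].
  apply Rpower_le_base; rewrite ?S_INR; lra. }
assert (Rpower (INR (S n) + alpha) (1 - fst s) / Cmod (1 - s) <= eps / 2)%R; [|lra].
apply Rmult_le_reg_r with (Cmod (1 - s)); auto.
unfold Rdiv at 1. rewrite Rmult_assoc, Rinv_l; lra.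
Qed.

Lemma zeta_cdiff (z : C) : z <> 1 -> cdiff zeta z.
Proof. intros Hn. apply cdiff_ex_derive. now apply hz. Qed.

(** The weight decays on the part of the circle that is not known yet: there the
    real part of [u + 4 u^2] is negative when [|u| = 1/8] and [Re u <= 1/32]. *)
Lemma weight_neg x y : (x * x + y * y = 1 / 64)%R -> (x <= 1 / 32)%R -> (x + 4 * (x * x - y * y) <= - (3 / 128))%R.
Proof. intros E H. assert (- (1 / 8) <= x)%R by nra. nra. Qed.

Lemma weight_le x y : (x * x + y * y = 1 / 64)%R -> (x + 4 * (x * x - y * y) <= 1)%R.
Proof. intros E. assert (x <= 1 / 8)%R by nra. nra. Qed.

(** One step of continuation, on the circle of radius 1/8 around [s0].  The part of
    the circle with [Re s > sg] lies where convergence is known; on the rest the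
    error is only bounded, uniformly in [N].  The weight
    [exp (k ((s - s0) + 4 (s - s0)^2))] equals 1 at [s0] and is exponentially
    small in [k] on that rest, so one lets first [N] and then [k] tend to
    infinity. *)
Lemma hpart_converges_step (sg t0 : R) (s0 : C) : (0 <= t0)%R -> (3 / 8 <= fst s0)%R ->
  (forall s : C, (sg < fst s)%R -> (t0 < snd s)%R -> hpart_converges s) ->
  (sg - 1 / 32 < fst s0)%R -> (t0 + 1 / 8 < snd s0)%R -> hpart_converges s0.
Proof.
intros Ht0 H38 IH Hs1 Hs2.
set (r := (1 / 8)%R).
assert (In : forall w, (Cmod (w - s0) <= r)%R -> (1 / 4 <= fst w)%R /\ (t0 < snd w)%R /\ w <> 1 /\ (Cmod w <= Cmod s0 + r)%R).
{ intros w Hw. assert (F := fst_le_Cmod (w - s0)). assert (S := snd_le_Cmod (w - s0)).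
  simpl in F, S. apply Rabs_le_between in F. apply Rabs_le_between in S. unfold r in *.
  repeat split; try lra.
  - intros E; rewrite E in *; simpl in *; lra.
  - replace w with (s0 + (w - s0)) by ring. eapply Rle_trans; [apply Cmod_triangle|lra]. }
assert (On : forall y, Cmod (s0 + cexp (ln r, y) - s0) = r).
{ intros y; replace (s0 + cexp (ln r, y) - s0) with (cexp (ln r, y)) by ring. rewrite Cmod_cexp; simpl.
  apply exp_ln; unfold r; lra. }
destruct (circle_max (fun w => zeta w - hpart alpha 1 w) s0 (ln r)) as [B1 HB1].
{ intros y _. apply cdiff_ccont. destruct (In (s0 + cexp (ln r, y))) as [_ [_ [N _]]]; [rewrite On; lra|].
  apply cdiff_minus; [now apply zeta_cdiff|now apply cdiff_hpart]. }
set (m := (Cmod s0 + r)%R).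
assert (m0 : (0 <= m)%R) by (unfold m, r; assert (P := Cmod_ge_0 s0); lra).
set (B := (Rabs B1 + 16 * m * tail_rate alpha 1)%R).
assert (B0 : (0 <= B)%R).
{ unfold B. assert (P := Rabs_pos B1). assert (Q := tail_rate_pos alpha 1). assert (0 <= m * tail_rate alpha 1)%R by (apply Rmult_le_pos; lra). lra. }
assert (HB : forall N y, (1 <= N)%nat -> (0 <= y <= 2 * PI)%R ->
   (Cmod (zeta (s0 + cexp (ln r, y))%C - hpart alpha N (s0 + cexp (ln r, y))%C) <= B)%R).
{ intros N y HN Hy. set (w := s0 + cexp (ln r, y)).
  destruct (In w) as [W1 [W2 [W3 W4]]]; [unfold w; rewrite On; lra|].
  replace (zeta w - hpart alpha N w) with ((zeta w - hpart alpha 1 w) + - (hpart alpha N w - hpart alpha 1 w)) by ring.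
  eapply Rle_trans; [apply Cmod_triangle|]. rewrite Cmod_opp.
  assert (D := hpart_diff alpha alpha_pos 1 N w W3 W1 (Nat.le_refl _) HN).
  specialize (HB1 y Hy). fold w in HB1. unfold B. fold m in W4.
  assert (16 * Cmod w * (tail_rate alpha 1 - tail_rate alpha N) <= 16 * m * tail_rate alpha 1)%R.
  { assert (Q := tail_rate_pos alpha 1). assert (Q' := tail_rate_pos alpha N). assert (P := Cmod_ge_0 w).
    apply Rle_trans with (16 * Cmod w * tail_rate alpha 1)%R; [apply Rmult_le_compat_l; lra|].
    apply Rmult_le_compat_r; lra. }
  assert (A := Rle_abs B1). lra. }
assert (Key : forall N k, (1 <= N)%nat ->
  (Cmod (zeta s0 - hpart alpha N s0) <=
     2 * (16 * m * tail_rate alpha N * exp (INR k) + B * exp (- (3 / 128) * INR k)))%R).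
{ intros N k HN.
  set (wt := fun w => RtoC (INR k) * ((w - s0) + RtoC 4 * ((w - s0) * (w - s0)))).
  assert (CB := circle_bound (fun w => (zeta w - hpart alpha N w) * cexp (wt w)) s0 r
    (16 * m * tail_rate alpha N * exp (INR k) + B * exp (- (3 / 128) * INR k)) ltac:(unfold r; lra)).
  cbv beta in CB.
  replace (cexp (wt s0)) with (RtoC 1) in CB.
  2:{ unfold wt. replace (RtoC (INR k) * ((s0 - s0) + RtoC 4 * ((s0 - s0) * (s0 - s0)))) with (RtoC 0) by ring.
      now rewrite cexp_0. }
  rewrite Cmult_1_r in CB. apply CB; clear CB.
  - intros w Hw. destruct (In w Hw) as [_ [_ [W3 _]]].
    apply cdiff_mult.
    + apply cdiff_minus; [now apply zeta_cdiff|now apply cdiff_hpart].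
    + apply (cdiff_comp cexp wt); [|apply cdiff_cexp]. unfold wt.
      assert (I : cdiff (fun w => w - s0) w) by (apply cdiff_minus; [apply cdiff_id|apply cdiff_const]).
      apply cdiff_mult; [apply cdiff_const|]. apply cdiff_plus; auto.
      apply cdiff_mult; [apply cdiff_const|]. now apply cdiff_mult.
  - intros y Hy. assert (HB' := HB N y HN Hy). assert (O := On y).
    set (w := s0 + cexp (ln r, y)) in *.
    destruct (In w) as [W1 [W2 [W3 W4]]]; [rewrite O; lra|]. fold m in W4.
    rewrite Cmod_mult, Cmod_cexp.
    assert (Ew : exists a b : R, w - s0 = (a, b) /\ (a * a + b * b = 1 / 64)%R).
    { exists (fst (w - s0)), (snd (w - s0)); split; [apply surjective_pairing|].
      assert (O2 : (Cmod (w - s0) * Cmod (w - s0) = 1 / 64)%R) by (rewrite O; unfold r; lra).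
      rewrite <- O2. unfold Cmod at 1 2. rewrite sqrt_sqrt; [ring|]. nra. }
    destruct Ew as [a [b [Ew Eab]]].
    assert (Fw : fst (wt w) = (INR k * (a + 4 * (a * a - b * b)))%R).
    { unfold wt. rewrite Ew. simpl. ring. }
    rewrite Fw.
    assert (Qk := pos_INR k). assert (E1 := exp_pos (INR k)). assert (E2 := exp_pos (- (3 / 128) * INR k)).
    assert (T := tail_rate_pos alpha N).
    assert (0 <= 16 * m * tail_rate alpha N)%R by (repeat apply Rmult_le_pos; lra).
    destruct (Rlt_le_dec sg (fst w)) as [L|L].
    + assert (C1 := hpart_lim_bound alpha alpha_pos N w (zeta w) W3 W1 HN (IH w L W2)).
      apply Rle_trans with (16 * m * tail_rate alpha N * exp (INR k))%R; [|nra].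
      apply Rmult_le_compat; [apply Cmod_ge_0|left; apply exp_pos| |].
      * eapply Rle_trans; [exact C1|]. apply Rmult_le_compat_r; lra.
      * apply exp_mono. assert (X := weight_le a b Eab). nra.
    + apply Rle_trans with (B * exp (- (3 / 128) * INR k))%R; [|nra].
      apply Rmult_le_compat; [apply Cmod_ge_0|left; apply exp_pos|exact HB'|].
      apply exp_mono.
      assert (a <= 1 / 32)%R. { assert (G : fst (w - s0) = a) by now rewrite Ew. change (fst w - fst s0 = a)%R in G. lra. }
      assert (X := weight_neg a b Eab H0). nra. }
intros eps He.
assert (Hk : exists k : nat, (2 * B * exp (- (3 / 128) * INR k) <= eps / 2)%R).
{ destruct (INR_unbounded (128 / 3 * (4 * B / eps))) as [k Hk]. exists k.
  rewrite Ropp_mult_distr_l_reverse, exp_Ropp.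
  assert (X := exp_ineq1_le (3 / 128 * INR k)).
  assert (0 <= 4 * B / eps)%R by (apply Rdiv_le_0_compat; lra).
  assert (Y : (4 * B / eps < exp (3 / 128 * INR k))%R) by lra.
  apply Rmult_le_reg_r with (exp (3 / 128 * INR k)); [apply exp_pos|].
  rewrite Rmult_assoc, Rinv_l; [|apply Rgt_not_eq, exp_pos].
  replace (2 * B * 1)%R with (eps / 2 * (4 * B / eps))%R by (field; lra).
  apply Rmult_le_compat_l; lra. }
destruct Hk as [k Hk].
assert (Ek := exp_pos (INR k)).
assert (Pos : (0 < 32 * m * exp (INR k) + 1)%R) by nra.
destruct (tail_rate_to_0 alpha alpha_pos (eps / 2 / (32 * m * exp (INR k) + 1))%R) as [n0 H0].
{ apply Rdiv_lt_0_compat; lra. }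
exists (Nat.max 1 n0); intros n Hn.
assert (L1 := Nat.max_lub_l _ _ _ Hn). assert (L2 := Nat.max_lub_r _ _ _ Hn).
specialize (H0 n L2). specialize (Key n k L1).
replace (hpart alpha n s0 - zeta s0) with (- (zeta s0 - hpart alpha n s0)) by ring. rewrite Cmod_opp.
eapply Rle_trans; [exact Key|].
assert (T := tail_rate_pos alpha n).
assert (tail_rate alpha n * (32 * m * exp (INR k)) <= eps / 2)%R; [|nra].
apply Rle_trans with (tail_rate alpha n * (32 * m * exp (INR k) + 1))%R; [nra|].
apply Rle_trans with (eps / 2 / (32 * m * exp (INR k) + 1) * (32 * m * exp (INR k) + 1))%R.
- apply Rmult_le_compat_r; lra.
- right; field; lra.
Qed.

(** Twenty steps lead from abscissa 1 to 3/8 and raise the lower bound for [Im s] to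
    5/2. *)
Lemma hpart_converges_iter k : (k <= 20)%nat -> forall s : C, (1 - INR k / 32 < fst s)%R -> (INR k / 8 < snd s)%R -> hpart_converges s.
Proof.
induction k as [|k IH]; intros Hk s H1 H2.
- apply hpart_converges_right. simpl in H1; lra.
- rewrite S_INR in *. assert (Q := pos_INR k). assert (Q' := le_INR _ _ Hk). rewrite S_INR in Q'. 
  replace (INR 20) with 20%R in Q' by (simpl; lra).
  apply (hpart_converges_step (1 - INR k / 32) (INR k / 8) s); try lra.
  apply IH; lia.
Qed.

Theorem zeta_approx (s : C) N : (1 / 2 <= fst s)%R -> (3 <= snd s)%R -> (1 <= N)%nat ->
  (Cmod (zeta s - hpart alpha N s) <= 16 * Cmod s * tail_rate alpha N)%R.
Proof.
intros H1 H2 HN. apply hpart_lim_bound; auto; try lra.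
- intros E; rewrite E in H2; simpl in H2; lra.
- apply (hpart_converges_iter 20); auto; simpl; lra.
Qed.
End Continuation.

(** * Smoothing zeta into a short Dirichlet polynomial *)

(** The function [t |-> x^(sg - it)] with [x = exp l]. *)
Definition twist (sg l t : R) : C := cexp ((sg, - t)%R * RtoC l).

Section Smoothing.
Variable th : R.
Hypothesis th_pos : (0 <= th)%R.

Definition smooth_step (f : R -> C) (t : R) : C := (f (t + th)%R + f (t - th)%R) / 2.

Fixpoint smooth_iter (Q : nat) (f : R -> C) : R -> C := match Q with O => f | S Q => smooth_step (smooth_iter Q f) end.

Lemma smooth_iter_bound Q f t X : (forall u, (t - INR Q * th <= u <= t + INR Q * th)%R -> (Cmod (f u) <= X)%R) ->
  (Cmod (smooth_iter Q f t) <= X)%R.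
Proof.
revert t; induction Q as [|Q IH]; intros t H.
- apply H; simpl; lra.
- rewrite S_INR in H. simpl smooth_iter. unfold smooth_step.
  assert (H1 : (Cmod (smooth_iter Q f (t + th)%R) <= X)%R) by (apply IH; intros; apply H; lra).
  assert (H2 : (Cmod (smooth_iter Q f (t - th)%R) <= X)%R) by (apply IH; intros; apply H; lra).
  assert (T := Cmod_triangle (smooth_iter Q f (t + th)%R) (smooth_iter Q f (t - th)%R)).
  unfold Cdiv. rewrite Cmod_mult, Cmod_inv, Cmod_R, Rabs_pos_eq; try lra.
  intros F; injection F; lra.
Qed.

Lemma smooth_iter_ext Q f g t : (forall u, f u = g u) -> smooth_iter Q f t = smooth_iter Q g t.
Proof.
intros E; revert t; induction Q as [|Q IH]; intros t; simpl; auto.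
unfold smooth_step; now rewrite 2!IH.
Qed.

Lemma smooth_iter_plus Q f g t : smooth_iter Q (fun u => f u + g u) t = smooth_iter Q f t + smooth_iter Q g t.
Proof.
revert t; induction Q as [|Q IH]; intros t; simpl; auto.
unfold smooth_step; rewrite 2!IH. field.
Qed.

Lemma smooth_iter_scal Q A f t : smooth_iter Q (fun u => A * f u) t = A * smooth_iter Q f t.
Proof.
revert t; induction Q as [|Q IH]; intros t; simpl; auto.
unfold smooth_step; rewrite 2!IH. field.
Qed.

Lemma twist_shift sg l t h : twist sg l (t + h) = cexp (0%R, (- h * l)%R) * twist sg l t.
Proof.
unfold twist. rewrite <- cexp_plus. f_equal. unfold Cmult, Cplus, RtoC; simpl. f_equal; ring.
Qed.

(** Oscillations are eigenfunctions of the averaging operator. *)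
Lemma smooth_iter_twist Q sg l t : smooth_iter Q (twist sg l) t = RtoC (cos (th * l) ^ Q) * twist sg l t.
Proof.
revert t; induction Q as [|Q IH]; intros t.
- simpl smooth_iter. rewrite pow_O. ring.
- simpl smooth_iter. unfold smooth_step. rewrite 2!IH. unfold Rminus. rewrite 2!twist_shift.
  replace (cexp (0%R, (- - th * l)%R)) with (2 * RtoC (cos (th * l)) - cexp (0%R, (- th * l)%R)).
  + rewrite <- tech_pow_Rmult, RtoC_mult. field.
  + unfold cexp; simpl. rewrite exp_0.
    replace (- - th * l)%R with (th * l)%R by ring. replace (- th * l)%R with (- (th * l))%R by ring.
    rewrite cos_neg, sin_neg. unfold Cminus, Cplus, Cmult, Copp, RtoC; simpl. f_equal; ring.
Qed.

Lemma smooth_iter_cder Q (F : R -> R -> C) F' l t : (forall t, cder (fun l => F l t) l (F' t)) ->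
  cder (fun l => smooth_iter Q (F l) t) l (smooth_iter Q F' t).
Proof.
intros H; revert t; induction Q as [|Q IH]; intros t; simpl; auto.
unfold smooth_step.
apply cder_ext with (fun l => / 2 * (smooth_iter Q (F l) (t + th)%R + smooth_iter Q (F l) (t - th)%R)).
{ intros; unfold Cdiv; ring. }
apply cder_eq with (/ 2 * (smooth_iter Q F' (t + th)%R + smooth_iter Q F' (t - th)%R)); [unfold Cdiv; ring|].
apply cder_scal, cder_plus; auto.
Qed.

Lemma Cmod_twist sg l t : Cmod (twist sg l t) = exp (sg * l).
Proof. unfold twist; rewrite Cmod_cexp; simpl. f_equal; ring. Qed.

(** The pole term of the truncated series at height [t], as a function of the
    logarithm [l] of the truncation point. *)
Definition pole (l t : R) : C := twist (1 / 2) l t / ((1 / 2)%R, (- t)%R).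

Lemma half_ne0 t : ((1 / 2)%R, (- t)%R) <> RtoC 0.
Proof. intros F; injection F; lra. Qed.

Lemma Cmod_half t : (0 < t)%R -> (t <= Cmod ((1 / 2)%R, (- t)%R))%R.
Proof.
intros Ht. eapply Rle_trans; [|apply snd_le_Cmod]. simpl. rewrite Rabs_Ropp, Rabs_pos_eq; lra.
Qed.

Lemma Cmod_pole l t : (0 < t)%R -> (Cmod (pole l t) <= exp (l / 2) / t)%R.
Proof.
intros Ht. unfold pole. rewrite Cmod_div, Cmod_twist by apply half_ne0.
replace (1 / 2 * l)%R with (l / 2)%R by field.
apply Rmult_le_compat_l; [left; apply exp_pos|]. apply Rinv_le_contravar; auto. now apply Cmod_half.
Qed.

Lemma cder_twist sg l t : cder (fun l => twist sg l t) l ((sg, - t)%R * twist sg l t).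
Proof. apply cder_exp. Qed.

Lemma cder_pole l t : cder (fun l => pole l t) l (twist (1 / 2) l t).
Proof.
apply cder_ext with (fun l => / ((1 / 2)%R, (- t)%R) * twist (1 / 2) l t).
{ intros; unfold pole, Cdiv; ring. }
eapply cder_eq; [|apply cder_scal, cder_twist].
field. apply half_ne0.
Qed.

(** For a large truncation point [exp L] the pole term itself is huge, but it is
    smoothed too.  The difference between smoothing [pole l] and multiplying it
    by [cos (th * l) ^ Q] has, as a function of [l], the small derivative
    [- (cos (th l) ^ Q)' * pole l]: the main parts cancel because [pole l] is a
    primitive in [l] of an eigenfunction. *)
Lemma smooth_iter_pole_bound Q L t E : (1 <= Q)%nat -> (0 <= L)%R -> (INR Q * th < t)%R ->
  (forall l, (0 <= l <= L)%R -> (0 <= cos (th * l))%R) ->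
  (forall l, (0 <= l <= L)%R -> (exp (l / 2) * cos (th * l) ^ (Q - 1) <= E)%R) ->
  (Cmod (smooth_iter Q (pole L) t) <= (2 * (INR Q * th) * L * E + E + 2) / (t - INR Q * th))%R.
Proof.
intros HQ HL Ht Hc HE.
assert (Q0 : (0 <= INR Q * th)%R) by (apply Rmult_le_pos; [apply pos_INR|auto]).
assert (t0 : (0 < t)%R) by lra.
assert (E0 : (0 <= E)%R).
{ eapply Rle_trans; [|apply (HE 0%R); lra]. apply Rmult_le_pos; [left; apply exp_pos|]. apply pow_le, Hc; lra. }
set (d := (t - INR Q * th)%R). assert (d0 : (0 < d)%R) by (unfold d; lra).
assert (Pd : forall x, (0 <= x)%R -> (x / t <= x / d)%R).
{ intros x Hx. apply Rmult_le_compat_l; auto. apply Rinv_le_contravar; unfold d; lra. }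
set (q := fun l => smooth_iter Q (pole l) t + (- (1)) * (RtoC (cos (th * l) ^ Q) * pole l t)).
assert (D : forall l, (0 <= l <= L)%R -> cder q l (RtoC (INR Q * th * sin (th * l) * cos (th * l) ^ (Q - 1)) * pole l t)).
{ intros l Hl. unfold q.
  eapply cder_eq; [|apply cder_plus; [apply (smooth_iter_cder Q pole (twist (1 / 2) l) l t); intros; apply cder_pole|
    apply cder_scal; apply (cder_rmult (fun l => cos (th * l) ^ Q)%R (fun l => pole l t) l
      (- (INR Q * th * sin (th * l) * cos (th * l) ^ (Q - 1)))%R); [|apply cder_pole]]].
  - rewrite smooth_iter_twist. rewrite RtoC_opp. ring.
  - auto_derive; auto. replace (Nat.pred Q) with (Q - 1)%nat by lia. ring. }
assert (B : (Cmod (q L - q 0%R) <= 2 * (INR Q * th * E / t) * (L - 0))%R).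
{ apply (cmean_value q (fun l => RtoC (INR Q * th * sin (th * l) * cos (th * l) ^ (Q - 1)) * pole l t)); auto.
  intros l Hl. rewrite Cmod_mult, Cmod_R.
  assert (P1 := Cmod_pole l t t0).
  rewrite 2!Rabs_mult, (Rabs_pos_eq (INR Q * th)), (Rabs_pos_eq (cos (th * l) ^ (Q - 1))); auto;
    [|apply pow_le, Hc; lra].
  assert (S1 : (Rabs (sin (th * l)) <= 1)%R) by (apply Rabs_le; destruct (SIN_bound (th * l)); lra).
  assert (c0 : (0 <= cos (th * l) ^ (Q - 1))%R) by (apply pow_le, Hc; lra).
  apply Rle_trans with (INR Q * th * 1 * cos (th * l) ^ (Q - 1) * (exp (l / 2) / t))%R.
  - apply Rmult_le_compat; auto; try apply Cmod_ge_0.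
    + repeat apply Rmult_le_pos; auto; try apply Rabs_pos. apply pos_INR.
    + apply Rmult_le_compat_r; auto. apply Rmult_le_compat_l; auto.
  - replace (INR Q * th * 1 * cos (th * l) ^ (Q - 1) * (exp (l / 2) / t))%R
     with ((INR Q * th / t) * (exp (l / 2) * cos (th * l) ^ (Q - 1)))%R by (field; lra).
    replace (INR Q * th * E / t)%R with ((INR Q * th / t) * E)%R by (field; lra).
    apply Rmult_le_compat_l; auto. apply Rdiv_le_0_compat; auto. }
assert (B0 : (Cmod (q 0%R) <= 1 / d + 1 / t)%R).
{ unfold q. eapply Rle_trans; [apply Cmod_triangle|]. apply Rplus_le_compat.
  - apply smooth_iter_bound. intros u Hu. eapply Rle_trans; [apply Cmod_pole; lra|].
    replace (0 / 2)%R with 0%R by field. rewrite exp_0.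
    apply Rmult_le_compat_l; [lra|]. apply Rinv_le_contravar; unfold d; lra.
  - rewrite 2!Cmod_mult, Cmod_opp, 2!Cmod_R, Rabs_R1, Rmult_0_r, cos_0, pow1, Rabs_R1.
    assert (P1 := Cmod_pole 0 t t0). replace (0 / 2)%R with 0%R in P1 by field. rewrite exp_0 in P1. lra. }
assert (BL : (Cmod (RtoC (cos (th * L) ^ Q) * pole L t) <= E / t)%R).
{ rewrite Cmod_mult, Cmod_R, Rabs_pos_eq by (apply pow_le, Hc; lra).
  assert (P1 := Cmod_pole L t t0). assert (HEL := HE L ltac:(lra)).
  assert (c0 := Hc L ltac:(lra)). assert (c1 : (0 <= cos (th * L) ^ (Q - 1))%R) by now apply pow_le.
  apply Rle_trans with (cos (th * L) ^ (Q - 1) * (exp (L / 2) / t))%R.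
  - apply Rmult_le_compat; auto; [apply pow_le; auto|apply Cmod_ge_0|].
    replace Q with (S (Q - 1)) at 1 by lia. rewrite <- tech_pow_Rmult.
    destruct (COS_bound (th * L)). nra.
  - replace (cos (th * L) ^ (Q - 1) * (exp (L / 2) / t))%R with (exp (L / 2) * cos (th * L) ^ (Q - 1) * / t)%R by (field; lra).
    apply Rmult_le_compat_r; auto. left; now apply Rinv_0_lt_compat. }
replace (smooth_iter Q (pole L) t) with ((q L - q 0%R) + (q 0%R + RtoC (cos (th * L) ^ Q) * pole L t)).
2:{ unfold q; ring. }
eapply Rle_trans; [apply Cmod_triangle|].
assert (T2 := Cmod_triangle (q 0%R) (RtoC (cos (th * L) ^ Q) * pole L t)).
apply Rle_trans with (2 * (INR Q * th) * L * E / d + (2 / d + E / d))%R.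
- apply Rplus_le_compat.
  + eapply Rle_trans; [exact B|].
    replace (2 * (INR Q * th * E / t) * (L - 0))%R with (2 * (INR Q * th) * L * E / t)%R by (field; lra).
    apply Pd. repeat apply Rmult_le_pos; auto; try lra. apply pos_INR.
  + assert (A1 := Pd 1%R ltac:(lra)). assert (A2 := Pd E E0). 
    replace (2 / d)%R with (1 / d + 1 / d)%R by (field; lra). lra.
- right. field. lra.
Qed.
End Smoothing.

Lemma csum_ext f g N : (forall n, f n = g n) -> csum f N = csum g N.
Proof. intros E; induction N; simpl; auto. now rewrite IHN, E. Qed.

Lemma smooth_iter_csum th Q (F : nat -> R -> C) N t :
  smooth_iter th Q (fun u => csum (fun n => F n u) N) t = csum (fun n => smooth_iter th Q (F n) t) N.
Proof.
induction N as [|N IH]; simpl.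
- transitivity (smooth_iter th Q (fun u => 0 * RtoC 0) t); [apply smooth_iter_ext; intros; ring|].
  rewrite (smooth_iter_scal th Q 0 (fun _ => RtoC 0)). ring.
- now rewrite (smooth_iter_plus th Q (fun u => csum (fun n => F n u) N) (F N)), IH.
Qed.

(** The three terms bound the smoothed zeta function, the truncation error and the
    pole term. *)
Theorem short_poly_bound alpha zeta th Q N t X E :
  (0 < alpha)%R -> is_hurwitz_zeta alpha zeta -> (0 <= th)%R -> (1 <= Q)%nat -> (1 <= N)%nat ->
  let L := ln (INR N + alpha) in
  (forall l, (0 <= l <= L)%R -> (0 <= cos (th * l))%R) ->
  (forall l, (0 <= l <= L)%R -> (exp (l / 2) * cos (th * l) ^ (Q - 1) <= E)%R) ->
  (INR Q * th + 3 <= t)%R ->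
  (forall u, (t - INR Q * th <= u <= t + INR Q * th)%R -> (Cmod (zeta ((1 / 2)%R, u)) <= X)%R) ->
  (Cmod (csum (fun n => (RtoC (cos (th * ln (INR n + alpha)) ^ Q) * twist (- (1 / 2)) (ln (INR n + alpha)) t)%C) N)
   <= X + 16 * (t + INR Q * th + 1) * tail_rate alpha N
      + (2 * (INR Q * th) * L * E + E + 2) / (t - INR Q * th))%R.
Proof.
intros Ha hz Hth HQ HN L Hc HE Ht HX.
assert (HL : (0 <= L)%R).
{ unfold L. rewrite <- ln_1. assert (Y := le_INR _ _ HN). simpl in Y. apply ln_le; lra. }
set (z := fun u : R => zeta ((1 / 2)%R, u)).
set (er := fun u : R => zeta ((1 / 2)%R, u) - hpart alpha N ((1 / 2)%R, u)).
assert (Q0 : (0 <= INR Q * th)%R) by (apply Rmult_le_pos; [apply pos_INR|auto]).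
replace (csum (fun n => RtoC (cos (th * ln (INR n + alpha)) ^ Q) * twist (- (1 / 2)) (ln (INR n + alpha)) t) N)
  with (smooth_iter th Q (fun u => z u + ((- (1)) * er u + pole L u)) t).
2:{ transitivity (smooth_iter th Q (fun u => csum (fun n => twist (- (1 / 2)) (ln (INR n + alpha)) u) N) t).
    - apply smooth_iter_ext; intros u. unfold z, er, hpart.
      replace (csum (fun n => lpow (INR n + alpha) (- ((1 / 2)%R, u))) N)
        with (csum (fun n => twist (- (1 / 2)) (ln (INR n + alpha)) u) N) by (apply csum_ext; reflexivity).
      replace (pole L u) with (lpow (INR N + alpha) (1 - ((1 / 2)%R, u)) / (1 - ((1 / 2)%R, u))); [ring|].
      replace (1 - ((1 / 2)%R, u)) with ((1 / 2)%R, (- u)%R); [reflexivity|].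
      unfold Cminus, Cplus, Copp, RtoC; simpl. f_equal; field.
    - rewrite smooth_iter_csum. apply csum_ext; intros n. apply smooth_iter_twist. }
rewrite (smooth_iter_plus th Q z), (smooth_iter_plus th Q (fun u => (- (1)) * er u)), (smooth_iter_scal th Q (- (1)) er).
eapply Rle_trans; [apply Cmod_triangle|]. rewrite Rplus_assoc. apply Rplus_le_compat.
{ now apply smooth_iter_bound. }
eapply Rle_trans; [apply Cmod_triangle|]. apply Rplus_le_compat.
- rewrite Cmod_mult, Cmod_opp, Cmod_R, Rabs_R1, Rmult_1_l.
  apply (smooth_iter_bound th Hth). intros u Hu. unfold er.
  eapply Rle_trans; [apply (zeta_approx alpha zeta); auto; simpl; lra|].
  apply Rmult_le_compat_r; [left; apply tail_rate_pos|]. apply Rmult_le_compat_l; [lra|].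
  eapply Rle_trans; [apply Cmod_le_abs|]. simpl. rewrite 2!Rabs_pos_eq; lra.
- apply smooth_iter_pole_bound; auto. lra.
Qed.

Local Close Scope C_scope.

From HB Require Import structures.
From mathcomp Require Import all_boot.
From mathcomp Require Import zify_ssreflect.
Set Warnings "-redundant-canonical-projection,-notation-overridden,-ambiguous-paths".
Delimit Scope R_scope with R.
Set Bullet Behavior "Strict Subproofs".
Local Open Scope R_scope.

(** * Finite sums and products of real numbers *)

Lemma Rplus_assoc' : associative Rplus. Proof. by move=> x y z; rewrite Rplus_assoc. Qed.
Lemma Rmult_assoc' : associative Rmult. Proof. by move=> x y z; rewrite Rmult_assoc. Qed.
HB.instance Definition _ := Monoid.isComLaw.Build R 0%R Rplus Rplus_assoc' Rplus_comm Rplus_0_l.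
HB.instance Definition _ := Monoid.isComLaw.Build R 1%R Rmult Rmult_assoc' Rmult_comm Rmult_1_l.
HB.instance Definition _ := Monoid.isMulLaw.Build R 0%R Rmult Rmult_0_l Rmult_0_r.
HB.instance Definition _ := Monoid.isAddLaw.Build R Rmult Rplus Rmult_plus_distr_r Rmult_plus_distr_l.

Notation "\sum_ ( i <- r | P ) F" := (\big[Rplus/0%R]_(i <- r | P%B) F%R) : R_scope.
Notation "\sum_ ( i <- r ) F" := (\big[Rplus/0%R]_(i <- r) F%R) : R_scope.
Notation "\sum_ ( m <= i < n | P ) F" := (\big[Rplus/0%R]_(m <= i < n | P%B) F%R) : R_scope.
Notation "\sum_ ( m <= i < n ) F" := (\big[Rplus/0%R]_(m <= i < n) F%R) : R_scope.
Notation "\sum_ ( i | P ) F" := (\big[Rplus/0%R]_(i | P%B) F%R) : R_scope.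
Notation "\sum_ i F" := (\big[Rplus/0%R]_i F%R) : R_scope.
Notation "\sum_ ( i : t ) F" := (\big[Rplus/0%R]_(i : t) F%R) : R_scope.
Notation "\sum_ ( i : t | P ) F" := (\big[Rplus/0%R]_(i : t | P%B) F%R) : R_scope.
Notation "\sum_ ( i < n ) F" := (\big[Rplus/0%R]_(i < n) F%R) : R_scope.
Notation "\sum_ ( i < n | P ) F" := (\big[Rplus/0%R]_(i < n | P%B) F%R) : R_scope.
Notation "\sum_ ( i 'in' A ) F" := (\big[Rplus/0%R]_(i in A) F%R) : R_scope.
Notation "\prod_ i F" := (\big[Rmult/1%R]_i F%R) : R_scope.
Notation "\prod_ ( i | P ) F" := (\big[Rmult/1%R]_(i | P%B) F%R) : R_scope.
Notation "\prod_ ( i : t ) F" := (\big[Rmult/1%R]_(i : t) F%R) : R_scope.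

Local Open Scope R_scope.

Section BigR.
Variables (I : Type) (r : seq I) (P : pred I).
Implicit Types F G : I -> R.

Lemma sumR_ge0 F : (forall i, P i -> 0 <= F i) -> 0 <= \sum_(i <- r | P i) F i.
Proof. by move=> H; elim/big_rec: _ => [|i x Pi Hx]; [lra | have := H i Pi; lra]. Qed.

Lemma sumR_le F G : (forall i, P i -> F i <= G i) -> \sum_(i <- r | P i) F i <= \sum_(i <- r | P i) G i.
Proof. by move=> H; elim/big_rec2: _ => [|i x y Pi Hx]; [lra | have := H i Pi; lra]. Qed.

Lemma sumR_mulr a F : \sum_(i <- r | P i) (F i * a) = (\sum_(i <- r | P i) F i) * a.
Proof. by rewrite big_distrl. Qed.

Lemma sumR_mull a F : \sum_(i <- r | P i) (a * F i) = a * (\sum_(i <- r | P i) F i).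
Proof. by rewrite big_distrr. Qed.

Lemma prodR_ge0 F : (forall i, P i -> 0 <= F i) -> 0 <= \big[Rmult/1]_(i <- r | P i) F i.
Proof. by move=> H; elim/big_rec: _ => [|i x Pi Hx]; [lra | apply: Rmult_le_pos => //; exact: H]. Qed.

Lemma prodR_gt0 F : (forall i, P i -> 0 < F i) -> 0 < \big[Rmult/1]_(i <- r | P i) F i.
Proof. by move=> H; elim/big_rec: _ => [|i x Pi Hx]; [lra | apply: Rmult_lt_0_compat => //; exact: H]. Qed.

Lemma prodR_le F G : (forall i, P i -> 0 <= F i <= G i) ->
  \big[Rmult/1]_(i <- r | P i) F i <= \big[Rmult/1]_(i <- r | P i) G i.
Proof.
move=> H; suff: 0 <= \big[Rmult/1]_(i <- r | P i) F i <= \big[Rmult/1]_(i <- r | P i) G i by case.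
elim/big_rec2: _ => [|i x y Pi [Hx Hy]]; first lra.
have [H0 H1] := H i Pi; split; [exact: Rmult_le_pos | exact: Rmult_le_compat].
Qed.

Lemma prodR_exp F : \big[Rmult/1]_(i <- r | P i) exp (F i) = exp (\sum_(i <- r | P i) F i).
Proof.
elim/big_rec2: _ => [|i x y _ ->]; first by rewrite exp_0.
by rewrite exp_plus.
Qed.

End BigR.

Lemma sumR_sub_le (I : finType) (P Q : pred I) (F : I -> R) :
  (forall i, Q i -> 0 <= F i) -> (forall i, P i -> Q i) -> \sum_(i | P i) F i <= \sum_(i | Q i) F i.
Proof.
move=> F0 PQ; rewrite (bigID P Q) /=.
rewrite (eq_bigl P) => [|i]; last by rewrite andbC; case E: (P i) => //=; apply: PQ.
suff : 0 <= \sum_(i | Q i && ~~ P i) F i by lra.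
by apply: sumR_ge0 => i /andP[Qi _]; apply: F0.
Qed.

Lemma sumR_const (I : finType) (P : pred I) (a : R) : \sum_(i | P i) a = INR #|P| * a.
Proof.
rewrite big_const; elim: #|P| => [|n IH] /=; first by lra.
by rewrite IH; case: n {IH} => [|n]; rewrite /=; lra.
Qed.

(** The Cauchy-Schwarz inequality, from the nonnegative quadratic form [Q]; with
    [A = 0] the form is linear in its first argument. *)
Lemma sumR_CS (I : finType) (P : pred I) (a b : I -> R) :
  (\sum_(i | P i) (a i * b i)) ^ 2 <= (\sum_(i | P i) (a i ^ 2)) * (\sum_(i | P i) (b i ^ 2)).
Proof.
set A := \sum_(i | P i) (a i ^ 2); set B := \sum_(i | P i) (b i ^ 2); set D := \sum_(i | P i) (a i * b i).
have A0 : 0 <= A by apply: sumR_ge0 => i _; nra.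
have Q x y : 0 <= x ^ 2 * A + 2 * (x * y) * D + y ^ 2 * B.
  rewrite /A /B /D -!sumR_mull -!big_split /=; apply: sumR_ge0 => i _.
  have := pow2_ge_0 (x * a i + y * b i); nra.
have B0 : 0 <= B by apply: sumR_ge0 => i _; nra.
have [A1|A1] := Req_dec A 0.
- have H := Q (- (B + 1)) D; rewrite A1 in H |- *.
  have H2 : 0 <= - (D ^ 2) * (B + 2) by nra.
  have := pow2_ge_0 D; nra.
- have H := Q (- D) A; have : 0 <= A * (A * B - D ^ 2) by nra.
  move=> H2; apply: Rnot_lt_le => H3; nra.
Qed.

(** * Mertens' estimate for the sum of ln p / p *)

Lemma INRM m n : INR (m * n)%N = INR m * INR n. Proof. exact: mult_INR. Qed.
Lemma INRD m n : INR (m + n)%N = INR m + INR n. Proof. exact: plus_INR. Qed.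
Lemma INRX m n : INR (m ^ n)%N = INR m ^ n.
Proof. by elim: n => [|n IH] //; rewrite expnS INRM IH. Qed.
Lemma leq_INR m n : (m <= n)%N -> INR m <= INR n. Proof. by move=> /leP; exact: le_INR. Qed.
Lemma ltn_INR m n : (m < n)%N -> INR m < INR n. Proof. by move=> /ltP; exact: lt_INR. Qed.
Lemma INR_sum (I : Type) (r : seq I) (P : pred I) (F : I -> nat) :
  INR (\big[addn/0%N]_(i <- r | P i) F i) = \sum_(i <- r | P i) INR (F i).
Proof. exact: (big_morph INR INRD). Qed.

Lemma ln_prodn (I : Type) (r : seq I) (P : pred I) (F : I -> nat) : (forall i, P i -> (0 < F i)%N) ->
  ln (INR (\big[muln/1%N]_(i <- r | P i) F i)) = \sum_(i <- r | P i) ln (INR (F i)).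
Proof.
move=> H; suff: (0 < \big[muln/1%N]_(i <- r | P i) F i)%N /\ 
  ln (INR (\big[muln/1%N]_(i <- r | P i) F i)) = \sum_(i <- r | P i) ln (INR (F i)) by case.
elim/big_rec2: _ => [|i x y Pi [y0 E]]; first by rewrite ln_1.
split; first by rewrite muln_gt0 H.
rewrite INRM ln_mult ?E //; [exact: (ltn_INR 0 (F i) (H i Pi)) | exact: (ltn_INR 0 y)].
Qed.

Lemma ln_INR_ge0 n : 0 <= ln (INR n).
Proof.
case: n => [|n]; first by rewrite /ln; case: Rlt_dec => [h|h]; [by case: (Rlt_irrefl 0) | exact: Rle_refl].
have H := leq_INR 1 n.+1 isT; rewrite -ln_1; apply: ln_le; [lra | exact H].
Qed.

Lemma ln_nat_decomp N m : (0 < m <= N)%N ->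
  ln (INR m) = \sum_(0 <= p < N.+1 | prime p) (INR (logn p m) * ln (INR p)).
Proof.
case/andP=> m0 mN.
rewrite -{1}(partnT m0) (widen_partn _ mN) ln_prodn; last first.
  move=> p _; case: (boolP (prime p)) => [pp|]; first by rewrite expn_gt0 prime_gt0.
  by move=> /negbTE pp; rewrite lognE pp.
rewrite [RHS]big_mkcond; apply: eq_bigr => p _.
case: (boolP (prime p)) => [pp|/negbTE pp]; last by rewrite lognE pp /= ln_1.
by rewrite INRX ln_pow //; exact: (ltn_INR 0 p (prime_gt0 pp)).
Qed.

Lemma ln_fact_decomp N n : (n <= N)%N ->
  ln (INR n`!) = \sum_(0 <= p < N.+1 | prime p) (INR (logn p n`!) * ln (INR p)).
Proof.
elim: n => [|n IH] nN.
  by rewrite big1 ?ln_1 // => p _; rewrite logn1 Rmult_0_l.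
rewrite factS INRM ln_mult; [|exact: (ltn_INR 0 n.+1 isT)|exact: (ltn_INR 0 _ (fact_gt0 n))].
rewrite IH ?(ltnW nN) // (@ln_nat_decomp N n.+1) ?nN // -big_split /=.
by apply: eq_bigr => p pp; rewrite lognM ?fact_gt0 // INRD; lra.
Qed.

Lemma INR_div_le n d : (0 < d)%N -> INR (n %/ d) <= INR n / INR d.
Proof.
move=> d0; have D := ltn_INR 0 d d0; rewrite /= in D.
apply: (Rmult_le_reg_r (INR d)) => //.
rewrite /Rdiv Rmult_assoc Rinv_l; last lra.
by rewrite Rmult_1_r -INRM; apply: leq_INR; exact: leq_divM.
Qed.

Lemma INR_div_ge n d : (0 < d)%N -> INR n / INR d - 1 <= INR (n %/ d).
Proof.
move=> d0; have D := ltn_INR 0 d d0; rewrite /= in D.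
apply: (Rmult_le_reg_r (INR d)) => //.
rewrite Rmult_minus_distr_r /Rdiv Rmult_assoc Rinv_l; last lra.
have := leq_INR n ((n %/ d).+1 * d)%N (ltnW (ltn_ceil n d0)).
rewrite INRM S_INR; lra.
Qed.

Lemma geom_sum_le p n : (2 <= p)%N -> \sum_(1 <= k < n.+1) (/ INR p ^ k) <= / (INR p - 1).
Proof.
move=> p2; have P := leq_INR 2 p p2; rewrite /= in P.
suff -> : \sum_(1 <= k < n.+1) (/ INR p ^ k) = (1 - / INR p ^ n) / (INR p - 1).
  have : 0 < / INR p ^ n by apply: Rinv_0_lt_compat; apply: pow_lt; lra.
  have : 0 < / (INR p - 1) by apply: Rinv_0_lt_compat; lra.
  rewrite /Rdiv; nra.
elim: n => [|n IH]; first by rewrite big_geq //= Rinv_1; field; lra.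
rewrite big_nat_recr //= IH; field; split; [apply: pow_nonzero|]; lra.
Qed.

Lemma logn_fact_le p n : prime p -> INR (logn p n`!) <= INR n / (INR p - 1).
Proof.
move=> pp; have P := leq_INR 2 p (prime_gt1 pp); rewrite /= in P.
rewrite logn_fact // INR_sum.
apply: (Rle_trans _ (\sum_(1 <= k < n.+1) (INR n * / INR p ^ k))).
  apply: sumR_le => k _; rewrite -INRX; apply: INR_div_le.
  by rewrite expn_gt0 prime_gt0.
rewrite sumR_mull; apply: Rmult_le_compat_l; first exact: pos_INR.
exact: geom_sum_le (prime_gt1 pp).
Qed.

Lemma logn_fact_ge p n : prime p -> (p <= n)%N -> INR n / INR p - 1 <= INR (logn p n`!).
Proof.
move=> pp pn; apply: (Rle_trans _ _ _ (INR_div_ge n p (prime_gt0 pp))).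
apply: leq_INR; rewrite logn_fact // big_ltn; last by rewrite ltnS (leq_trans (prime_gt0 pp)).
by rewrite expn1 leq_addr.
Qed.

Definition mertens n := \sum_(0 <= p < n.+1 | prime p) (ln (INR p) / INR p).
Definition chebyshev n := \sum_(0 <= p < n.+1 | prime p) ln (INR p).

Lemma ln_fact_ge n : INR n * mertens n - chebyshev n <= ln (INR n`!).
Proof.
rewrite (ln_fact_decomp n n) // /mertens /chebyshev -sumR_mull.
have H : \sum_(0 <= p < n.+1 | prime p) (INR n * (ln (INR p) / INR p)) <=
   \sum_(0 <= p < n.+1 | prime p) (INR (logn p n`!) * ln (INR p) + ln (INR p)).
  rewrite big_nat_cond [X in _ <= X]big_nat_cond; apply: sumR_le => p /andP[/andP[_ pn] pp].
  have := logn_fact_ge p n pp pn; have := ln_INR_ge0 p.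
  have := ltn_INR 0 p (prime_gt0 pp); rewrite /= => p0 l0 H.
  have -> : INR n * (ln (INR p) / INR p) = (INR n / INR p) * ln (INR p) by field; lra.
  nra.
rewrite big_split /= in H; lra.
Qed.

Lemma ln_le_self x : 0 < x -> ln x <= x.
Proof. move=> x0; have := exp_ineq1_le (ln x); rewrite exp_ln //; lra. Qed.

(** Bounds the contribution of the higher prime powers.  The sum is dominated by a
    telescoping one, [8 / sqrt (n-1) - 8 / sqrt n], because
    [ln n <= 2 sqrt n]. *)
Lemma sum_ln_over_square n : (0 < n)%N ->
  \sum_(0 <= p < n.+1 | prime p) (ln (INR p) / (INR p * (INR p - 1))) <= 8 - 8 / sqrt (INR n).
Proof.
case: n => // n _; elim: n => [|n IH].
  rewrite big_mkcond big_nat_recr // big_nat1 /= sqrt_1; lra.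
rewrite big_mkcond big_nat_recr // -big_mkcond.
set a := sqrt (INR n.+1) in IH; set b := sqrt (INR n.+2).
have M1 := leq_INR 1 n.+1 isT. rewrite [INR 1]/= in M1.
have E : INR n.+2 = INR n.+1 + 1 by rewrite S_INR.
have a2 : a * a = INR n.+1 by apply: sqrt_sqrt; lra.
have b2 : b * b = INR n.+2 by apply: sqrt_sqrt; lra.
have a0 : 0 < a by apply: sqrt_lt_R0; lra.
have b0 : 0 < b by apply: sqrt_lt_R0; lra.
have ba : a <= b <= 2 * a by nra.
have key : ln (INR n.+2) / (INR n.+2 * (INR n.+2 - 1)) <= 8 / a - 8 / b.
  have -> : INR n.+2 - 1 = a * a by lra.
  rewrite -b2 ln_mult //.
  have L := ln_le_self b b0.
  apply: (Rle_trans _ (2 / (b * (a * a)))).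
    have -> : (ln b + ln b) / (b * b * (a * a)) = (2 * ln b) * / (b * b * (a * a)) by field; lra.
    have -> : 2 / (b * (a * a)) = (2 * b) * / (b * b * (a * a)) by field; lra.
    apply: Rmult_le_compat_r; last lra.
    by apply: Rlt_le; apply: Rinv_0_lt_compat; repeat apply: Rmult_lt_0_compat.
  apply: (Rle_trans _ (4 / (a * (b * b)))).
    have -> : 2 / (b * (a * a)) = (2 * b) * / (a * a * (b * b)) by field; lra.
    have -> : 4 / (a * (b * b)) = (4 * a) * / (a * a * (b * b)) by field; lra.
    apply: Rmult_le_compat_r; last lra.
    by apply: Rlt_le; apply: Rinv_0_lt_compat; repeat apply: Rmult_lt_0_compat.
  have -> : 8 / a - 8 / b = (8 * (b * b - a * a)) * / (a * b * (a + b)) by field; lra.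
  have -> : b * b - a * a = 1 by lra.
  rewrite Rmult_1_r.
  have -> : 4 / (a * (b * b)) = 8 * / (a * b * (b + b)) by field; lra.
  apply: Rmult_le_compat_l; first lra.
  apply: Rinv_le_contravar; first by repeat apply: Rmult_lt_0_compat; lra.
  by apply: Rmult_le_compat_l; [apply: Rmult_le_pos; lra | lra].
move: IH key; set x := \sum_(_ <= _ < _ | _) _; move=> IH key.
have P : 0 <= 8 / a - 8 / b.
  have : / b <= / a by apply: Rinv_le_contravar; lra.
  rewrite /Rdiv; lra.
move: IH key P; rewrite -/b; move: (8 / b) => y; move: (ln (INR n.+2) / _) => z IH key P.
by case: ifP => _ /=; lra.
Qed.

Lemma fact_ln_le n : ln (INR n`!) <= INR n * ln (INR n).
Proof.
elim: n => [|n IH]; first by rewrite ln_1 /=; lra.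
rewrite factS INRM ln_mult; [|exact: (ltn_INR 0 n.+1 isT)|exact: (ltn_INR 0 _ (fact_gt0 n))].
have N0 := pos_INR n.
have L : INR n * ln (INR n) <= INR n * ln (INR n.+1).
  case: n {IH} N0 => [|n] N0; first by rewrite /=; lra.
  apply: Rmult_le_compat_l => //; apply: ln_le; first exact: (ltn_INR 0 n.+1 isT).
  exact: leq_INR.
rewrite [in X in _ <= X * _]S_INR; lra.
Qed.

Lemma fact_ln_ge n : INR n * ln (INR n) - INR n <= ln (INR n`!).
Proof.
elim: n => [|n IH]; first by rewrite ln_1 /=; lra.
rewrite factS INRM ln_mult; [|exact: (ltn_INR 0 n.+1 isT)|exact: (ltn_INR 0 _ (fact_gt0 n))].
case: n IH => [|n] IH; first by rewrite /= ln_1; lra.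
have N1 := ltn_INR 0 n.+1 isT; rewrite [INR 0]/= in N1.
have E : INR n.+2 = INR n.+1 + 1 by rewrite S_INR.
have D : INR n.+1 * (ln (INR n.+2) - ln (INR n.+1)) <= 1.
  rewrite -ln_div //; last lra.
  have -> : INR n.+2 / INR n.+1 = 1 + / INR n.+1 by rewrite E; field; lra.
  apply: (Rle_trans _ (INR n.+1 * / INR n.+1)); last by rewrite Rinv_r; lra.
  apply: Rmult_le_compat_l; first lra.
  have := exp_ineq1_le (/ INR n.+1); have I : 0 < / INR n.+1 by apply: Rinv_0_lt_compat.
  move=> X; rewrite -[X in _ <= X]ln_exp; apply: ln_le; lra.
rewrite E in D *; nra.
Qed.

(** The primes between [m] and [2m] divide the central binomial coefficient, which
    is at most [2^(2m)]. *)
Lemma chebyshev_double m : chebyshev m.*2 <= chebyshev m + INR m.*2 * ln 2.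
Proof.
have F0 n : 0 < INR n`! by exact: (ltn_INR 0 _ (fact_gt0 n)).
have B : INR (m.*2)`! <= 2 ^ m.*2 * (INR m`! * INR m`!).
  have mm : (m <= m.*2)%N by rewrite -addnn leq_addr.
  have mK : (m.*2 - m)%N = m by rewrite -addnn addnK.
  rewrite -(bin_fact mm) mK INRM INRM -[2]/(INR 2) -INRX.
  apply: Rmult_le_compat_r; first by apply: Rmult_le_pos; exact: pos_INR.
  apply: leq_INR; rewrite -[2%N]/(1 + 1)%N expnDn.
  have mo : (m < m.*2.+1)%N by rewrite ltnS.
  rewrite (bigD1 (Ordinal mo)) //= !exp1n !muln1.
  exact: leq_addr.
have L : ln (INR (m.*2)`!) <= INR m.*2 * ln 2 + (ln (INR m`!) + ln (INR m`!)).
  rewrite -ln_mult // -ln_pow; last lra.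
  rewrite -ln_mult //; [|by apply: pow_lt; lra|exact: Rmult_lt_0_compat].
  exact: ln_le.
have mm : (m <= m.*2)%N by rewrite -addnn leq_addr.
have -> : chebyshev m.*2 = chebyshev m + \sum_(0 <= p < m.*2.+1 | prime p) (if (m < p)%N then ln (INR p) else 0).
  rewrite /chebyshev !(@big_cat_nat _ _ _ m.+1 0 m.*2.+1) //=; congr (_ + _).
  have -> : \sum_(0 <= p < m.+1 | prime p) (if (m < p)%N then ln (INR p) else 0) = 0.
    rewrite big_nat_cond big1 // => p /andP[/andP[_ pm] _].
    by rewrite ltnNge -ltnS pm.
  rewrite Rplus_0_l big_nat_cond [RHS]big_nat_cond; apply: eq_bigr => p /andP[/andP[mp _] _].
  by rewrite mp.
suff H : (ln (INR m`!) + ln (INR m`!)) + \sum_(0 <= p < m.*2.+1 | prime p) (if (m < p)%N then ln (INR p) else 0)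
   <= ln (INR (m.*2)`!) by lra.
rewrite !(@ln_fact_decomp m.*2) // -!big_split /=.
rewrite big_nat_cond [X in _ <= X]big_nat_cond; apply: sumR_le => p /andP[/andP[_ p2m] pp].
have l0 := ln_INR_ge0 p.
have V : (logn p m`! + logn p m`! + (m < p) <= logn p (m.*2)`!)%N.
  case: (ltnP m p) => mp.
    have -> : logn p m`! = 0%N.
      rewrite logn_fact // big_nat_cond big1 // => k /andP[/andP[k0 _] _].
      by rewrite divn_small // (leq_trans mp) // -{1}(expn1 p) leq_exp2l // prime_gt1.
    rewrite logn_fact // big_ltn; last by rewrite ltnS (leq_trans (prime_gt0 pp)).
    by rewrite expn1 (leq_trans _ (leq_addr _ _)) // divn_gt0 // prime_gt0.
  rewrite addn0 -lognM ?fact_gt0 //; apply: dvdn_leq_log => //; first exact: fact_gt0.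
  have mK : (m.*2 - m)%N = m by rewrite -addnn addnK.
  rewrite -(bin_fact mm) mK; exact: dvdn_mull.
have := leq_INR _ _ V; rewrite !INRD.
by case: (m < p)%N => /=; nra.
Qed.

Lemma INR_le_pow2 k : INR k <= 2 ^ k.
Proof. by rewrite -[2]/(INR 2) -INRX; apply: leq_INR; apply: ltnW; exact: ltn_expl. Qed.

Lemma chebyshev_le n : chebyshev n <= 4 * ln 2 * INR n.
Proof.
have l2 : 0 < ln 2 by rewrite -ln_1; apply: ln_increasing; lra.
elim/ltn_ind: n => n IH.
case: n IH => [|[|n]] IH.
- rewrite /chebyshev big_mkcond big_nat1 /=; lra.
- rewrite /chebyshev big_mkcond big_nat_recr // big_nat1 /=; lra.
- set N := n.+2; set m := N./2.
  have mN : (m < N)%N by rewrite /m /N; lia.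
  have H1 := IH m mN; have H2 := chebyshev_double m.
  have E := odd_double_half N; rewrite -/m in E.
  have E2 : INR m.*2 = 2 * INR m by rewrite -addnn INRD; lra.
  have m0 : 0 <= INR m * ln 2 by apply: Rmult_le_pos; [exact: pos_INR | lra].
  have {E} [-> | ->] : N = m.*2 \/ N = m.*2.+1.
    by rewrite -E; case: (odd N); [right | left].
  by rewrite E2 in H2 *; nra.
  rewrite {1}/chebyshev big_mkcond big_nat_recr // -big_mkcond.
  rewrite -/(chebyshev m.*2) S_INR.
  have L : ln (INR m.*2.+1) <= INR m.*2.+1 * ln 2.
    rewrite -ln_pow; last lra. apply: ln_le; last exact: INR_le_pow2.
    exact: (ltn_INR 0 m.*2.+1 isT).
  rewrite S_INR E2 in L *; rewrite E2 in H2.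
  move: L; move: (ln (_ + 1)) => z L.
  by move: (INR m) m0 H1 H2 L => im m0 H1 H2 L; case: ifP => _ /=; nra.
Qed.

(** Both bounds compare Stirling's estimate for [ln n!] with Legendre's formula. *)
Theorem mertens_bound n : (0 < n)%N -> ln (INR n) - 9 <= mertens n <= ln (INR n) + 4.
Proof.
move=> n0; have N0 := ltn_INR 0 n n0; rewrite [INR 0]/= in N0.
have l2 : ln 2 < 1 by rewrite -[X in _ < X]ln_exp; apply: ln_increasing; [lra|have := exp_ineq1 1; lra].
split.
- have H1 := fact_ln_ge n; have H2 := sum_ln_over_square n n0.
  have H3 : 0 < 8 / sqrt (INR n) by apply: Rdiv_lt_0_compat; [lra | exact: sqrt_lt_R0].
  have H4 : ln (INR n`!) <= INR n * (mertens n + \sum_(0 <= p < n.+1 | prime p) (ln (INR p) / (INR p * (INR p - 1)))).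
    rewrite (ln_fact_decomp n n) // /mertens -big_split -sumR_mull /=.
    apply: sumR_le => p pp.
    have P := leq_INR 2 p (prime_gt1 pp); rewrite [INR 2]/= in P.
    have -> : INR n * (ln (INR p) / INR p + ln (INR p) / (INR p * (INR p - 1))) = INR n / (INR p - 1) * ln (INR p).
      by field; lra.
    apply: Rmult_le_compat_r; [exact: ln_INR_ge0 | exact: logn_fact_le].
  apply: (Rmult_le_reg_l (INR n)) => //; nra.
- have H1 := ln_fact_ge n; have H2 := fact_ln_le n; have H3 := chebyshev_le n.
  apply: (Rmult_le_reg_l (INR n)) => //; nra.
Qed.

(** * Sums over primes slightly above G *)

Definition nat_floor (x : R) : nat := Z.to_nat (Int_part x).

Lemma nat_floorP x : 0 <= x -> INR (nat_floor x) <= x < INR (nat_floor x) + 1.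
Proof.
move=> x0; have [H1 H2] := base_Int_part x.
have P : (0 <= Int_part x)%Z.
  have : (-1 < Int_part x)%Z; last lia.
  by apply: lt_IZR; lra.
rewrite /nat_floor INR_IZR_INZ Z2Nat.id //; lra.
Qed.

Lemma ln_nat_floor y : 1 <= y -> ln y - 1 <= ln (INR (nat_floor y)) <= ln y.
Proof.
move=> y1; have [H1 H2] := nat_floorP y ltac:(lra).
have f1 : 1 <= INR (nat_floor y).
  suff : (0 < nat_floor y)%N by move=> h; exact: (leq_INR 1 _ h).
  by case: (nat_floor y) H1 H2 => //= H1 H2; lra.
split; last by apply: ln_le; lra.
have -> : ln y - 1 = ln (y * exp (- (1))) by rewrite ln_mult; [rewrite ln_exp; lra|lra|exact: exp_pos].
apply: ln_le; first by apply: Rmult_lt_0_compat; [lra|exact: exp_pos].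
have E : exp (- (1)) <= / 2.
  rewrite exp_Ropp; apply: Rinv_le_contravar; first lra.
  by have := exp_ineq1_le 1; lra.
have := exp_pos (- (1)); nra.
Qed.

Section Window.
Variables (G H : R).
Hypotheses (G1 : 1 < G) (H40 : 40 <= H).

(** The windows [(win i, win i.+1]] cut the primes above [G] into blocks on which
    [ln (p / G)] is known within [H]. *)
Definition win (i : nat) : nat := nat_floor (G * exp (INR i * H)).

Lemma win_arg i : 1 <= G * exp (INR i * H).
Proof.
have H0 : 0 <= INR i * H by apply: Rmult_le_pos; [exact: pos_INR | lra].
have := exp_ineq1_le (INR i * H); nra.
Qed.

Lemma win_le i : (win i <= win i.+1)%N.
Proof.
have [H1 H2] := nat_floorP _ (Rle_trans _ _ _ Rle_0_1 (win_arg i)).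
have [H3 H4] := nat_floorP _ (Rle_trans _ _ _ Rle_0_1 (win_arg i.+1)).
have L : exp (INR i * H) <= exp (INR i.+1 * H) by apply: exp_mono; rewrite S_INR; nra.
rewrite leqNgt; apply/negP => lt; have := leq_INR _ _ lt; rewrite S_INR /win.
by nra.
Qed.

Lemma win_log p i : (win i < p)%N -> INR i * H <= ln (INR p / G).
Proof.
move=> lt; have := leq_INR _ _ lt; rewrite S_INR => L.
have [H1 H2] := nat_floorP _ (Rle_trans _ _ _ Rle_0_1 (win_arg i)).
have X := exp_pos (INR i * H).
rewrite -[X in X <= _]ln_exp; apply: ln_le => //.
apply: (Rmult_le_reg_l G); first lra.
have -> : G * (INR p / G) = INR p by field; lra.
rewrite /win in L; lra.
Qed.

Lemma win_log_le p i : (0 < p)%N -> (p <= win i)%N -> ln (INR p / G) <= INR i * H.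
Proof.
move=> p0 le; have L := leq_INR _ _ le; have P := ltn_INR 0 p p0; rewrite [INR 0]/= in P.
have [H1 H2] := nat_floorP _ (Rle_trans _ _ _ Rle_0_1 (win_arg i)).
have X := exp_pos (INR i * H).
rewrite -[X in _ <= X]ln_exp; apply: ln_le; first by apply: Rdiv_lt_0_compat; lra.
apply: (Rmult_le_reg_l G); first lra.
have -> : G * (INR p / G) = INR p by field; lra.
rewrite /win in L; lra.
Qed.

Lemma win_mertens i : H - 20 <= \sum_((win i).+1 <= p < (win i.+1).+1 | prime p) (ln (INR p) / INR p) <= H + 20.
Proof.
have E : mertens (win i.+1) = mertens (win i) + \sum_((win i).+1 <= p < (win i.+1).+1 | prime p) (ln (INR p) / INR p).
  by rewrite /mertens (@big_cat_nat _ _ _ (win i).+1 0 (win i.+1).+1) // ltnS win_le.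
have W0 j : (0 < win j)%N.
  have [H1 H2] := nat_floorP _ (Rle_trans _ _ _ Rle_0_1 (win_arg j)).
  have A1 := win_arg j; rewrite /win; case: (nat_floor _) H1 H2 => //= H1 H2; lra.
have M1 := mertens_bound _ (W0 i); have M2 := mertens_bound _ (W0 i.+1).
have L1 := ln_nat_floor _ (win_arg i); have L2 := ln_nat_floor _ (win_arg i.+1).
have Z j : ln (G * exp (INR j * H)) = ln G + INR j * H.
  by rewrite ln_mult ?ln_exp //; [lra | exact: exp_pos].
have SI : INR i.+1 * H = INR i * H + H by rewrite S_INR; lra.
rewrite !Z in L1 L2; rewrite -!/(win _) in L1 L2; lra.
Qed.

Definition wsum i j := \sum_((win i).+1 <= p < (win j).+1 | prime p) / (INR p * ln (INR p / G)).

Lemma wsum_recr i k : wsum i (i + k.+1)%N = wsum i (i + k)%N + wsum (i + k)%N (i + k.+1)%N.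
Proof.
rewrite /wsum (@big_cat_nat _ _ _ (win (i + k)).+1) //; last by rewrite ltnS addnS win_le.
rewrite ltnS; elim: k => [|k IH]; first by rewrite addn0.
by rewrite addnS (leq_trans IH) // win_le.
Qed.

Lemma block_term p i eta : 0 <= eta -> (1 <= i)%N -> prime p -> (win i < p)%N -> (p <= win i.+1)%N ->
  INR i.+1 * H <= eta * ln G ->
  (ln (INR p) / INR p) * / ((1 + eta) * ln G * (INR i.+1 * H)) <= / (INR p * ln (INR p / G))
   <= (ln (INR p) / INR p) * / (ln G * (INR i * H)).
Proof.
move=> e0 i1 pp p1 p2 iH.
have P := ltn_INR 0 p (prime_gt0 pp); rewrite [INR 0]/= in P.
have L1 := win_log p i p1; have L2 := win_log_le p i.+1 (prime_gt0 pp) p2.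
have I1 := leq_INR 1 i i1; rewrite [INR 1]/= in I1.
have G0 : 0 < ln G by rewrite -ln_1; apply: ln_increasing; lra.
have E : ln (INR p) = ln G + ln (INR p / G) by rewrite ln_div //; lra.
set x := ln (INR p / G) in L1 L2 E *.
have iH0 : 0 < INR i * H by nra.
have I2 : INR i <= INR i.+1 by apply: leq_INR.
have lp : ln G <= ln (INR p) <= (1 + eta) * ln G by lra.
have x0 : 0 < x by lra.
have -> : / (INR p * x) = (ln (INR p) / INR p) * / (ln (INR p) * x) by field; lra.
have lp0 : 0 <= ln (INR p) / INR p by apply: Rdiv_le_0_compat; lra.
split; apply: Rmult_le_compat_l => //; apply: Rinv_le_contravar.
- by apply: Rmult_lt_0_compat; lra.
- by apply: Rmult_le_compat; lra.
- by apply: Rmult_lt_0_compat; lra.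
- by apply: Rmult_le_compat; lra.
Qed.

(** Within a block [ln p] is about [ln G] and [ln (p / G)] about [i * H], so the sum is
    Mertens' sum over the block, [H] up to 20, divided by [ln G * (i * H)]. *)
Lemma block_sum i eta : 0 <= eta -> (1 <= i)%N -> INR i.+1 * H <= eta * ln G ->
  (1 - 20 / H) / ((1 + eta) * ln G) * / INR i.+1 <= wsum i i.+1 <= (1 + 20 / H) / ln G * / INR i.
Proof.
move=> e0 i1 iH; have [M1 M2] := win_mertens i.
have I1 := leq_INR 1 i i1; rewrite [INR 1]/= in I1.
have I2 := leq_INR 1 i.+1 isT; rewrite [INR 1]/= in I2.
have G0 : 0 < ln G by rewrite -ln_1; apply: ln_increasing; lra.
have A1 : 0 < / ((1 + eta) * ln G * (INR i.+1 * H)).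
  by apply: Rinv_0_lt_compat; repeat apply: Rmult_lt_0_compat; lra.
have A2 : 0 < / (ln G * (INR i * H)).
  by apply: Rinv_0_lt_compat; repeat apply: Rmult_lt_0_compat; lra.
have -> : (1 - 20 / H) / ((1 + eta) * ln G) * / INR i.+1 = (H - 20) * / ((1 + eta) * ln G * (INR i.+1 * H)).
  by field; lra.
have -> : (1 + 20 / H) / ln G * / INR i = (H + 20) * / (ln G * (INR i * H)) by field; lra.
split.
- apply: (Rle_trans _ _ _ (Rmult_le_compat_r _ _ _ (Rlt_le _ _ A1) M1)).
  rewrite -sumR_mulr /wsum big_nat_cond [X in _ <= X]big_nat_cond; apply: sumR_le => p /andP[/andP[p1 p2] pp].
  by have [] := block_term p i eta e0 i1 pp p1 p2 iH.
- apply: (Rle_trans _ _ _ _ (Rmult_le_compat_r _ _ _ (Rlt_le _ _ A2) M2)).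
  rewrite -sumR_mulr /wsum big_nat_cond [X in _ <= X]big_nat_cond; apply: sumR_le => p /andP[/andP[p1 p2] pp].
  by have [] := block_term p i eta e0 i1 pp p1 p2 iH.
Qed.

Lemma ln_succ_le x : 0 < x -> ln (x + 1) - ln x <= / x.
Proof.
move=> x0; rewrite -ln_div //; last lra.
have -> : (x + 1) / x = 1 + / x by field; lra.
have I := Rinv_0_lt_compat _ x0.
rewrite -[X in _ <= X]ln_exp; apply: ln_le; first lra.
exact: exp_ineq1_le.
Qed.

Lemma ln_succ_ge x : 0 < x -> / (x + 1) <= ln (x + 1) - ln x.
Proof.
move=> x0; have -> : ln (x + 1) - ln x = - ln (x / (x + 1)) by rewrite ln_div; lra.
have -> : x / (x + 1) = 1 + - / (x + 1) by field; lra.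
have := exp_ineq1_le (- / (x + 1)) => Y.
have I : / (x + 1) < 1 by rewrite -Rinv_1; apply: Rinv_lt_contravar; lra.
have := ln_le (1 + - / (x + 1)) (exp (- / (x + 1))) ltac:(lra) Y.
rewrite ln_exp; lra.
Qed.

(** Summing over the blocks turns [sum 1/i] into a difference of logarithms. *)
Lemma wsum_bounds i k eta : 0 <= eta -> (2 <= i)%N -> INR (i + k) * H <= eta * ln G ->
  (1 - 20 / H) / ((1 + eta) * ln G) * (ln (INR (i + k) + 1) - ln (INR i + 1)) <= wsum i (i + k)
    <= (1 + 20 / H) / ln G * (ln (INR (i + k) - 1) - ln (INR i - 1)).
Proof.
move=> e0 i2; have I2 := leq_INR 2 i i2; rewrite [INR 2]/= in I2.
have G0 : 0 < ln G by rewrite -ln_1; apply: ln_increasing; lra.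
have C1 : 0 <= (1 - 20 / H) / ((1 + eta) * ln G).
  apply: Rdiv_le_0_compat; last by apply: Rmult_lt_0_compat; lra.
  have : 20 / H <= 1 by apply: (Rmult_le_reg_r H); [lra|rewrite /Rdiv Rmult_assoc Rinv_l; lra]. lra.
have C2 : 0 <= (1 + 20 / H) / ln G.
  apply: Rdiv_le_0_compat => //; have : 0 < 20 / H by apply: Rdiv_lt_0_compat; lra. lra.
elim: k => [|k IH] ikH.
  by rewrite addn0 /wsum big_geq //; lra.
rewrite addnS in ikH *; have ik := leq_INR i (i + k) (leq_addr _ _).
have ikH' : INR (i + k) * H <= eta * ln G by move: ikH; rewrite S_INR; nra.
have [B1 B2] := block_sum (i + k) eta e0 (leq_trans (ltnW i2) (leq_addr _ _)) ikH.
have [IH1 IH2] := IH ikH'.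
rewrite -addnS wsum_recr addnS.
have S1 := ln_succ_le (INR (i + k) + 1) ltac:(lra).
have S2 := ln_succ_ge (INR (i + k) - 1) ltac:(lra).
rewrite (_ : INR (i + k) - 1 + 1 = INR (i + k)) in S2; last lra.
rewrite S_INR in B1 *; rewrite (_ : INR (i + k) + 1 - 1 = INR (i + k)); last lra.
have D1 := Rmult_le_compat_l _ _ _ C1 S1.
have D2 := Rmult_le_compat_l _ _ _ C2 S2.
split; nra.
Qed.
End Window.

(** * The resonance inequality *)

Lemma cos_Zperiod x z : cos (x + 2 * PI * IZR z) = cos x.
Proof.
have P k y : cos (y + 2 * PI * INR k) = cos y.
  by rewrite -[RHS](cos_period y k); congr cos; lra.
case: (Z_le_dec 0 z) => z0.
- by rewrite -(Z2Nat.id z) // -INR_IZR_INZ P.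
- have E : IZR z = - INR (Z.to_nat (- z)) by rewrite INR_IZR_INZ Z2Nat.id; [rewrite opp_IZR; lra | lia].
  rewrite -[LHS](P (Z.to_nat (- z))) E; congr cos; lra.
Qed.

Lemma cos_ge_half y : Rabs y <= 1 -> 1 / 2 <= cos y.
Proof.
move=> H; have -> : cos y = cos (Rabs y).
  by rewrite /Rabs; case: Rcase_abs => // _; rewrite cos_neg.
have := Rabs_pos y; have P3 := PI2_3_2; have P4 := PI_4.
rewrite -cos_PI3 => y0; apply: cos_decr_1; lra.
Qed.

Section TrigSums.
Variables (I : finType) (a mu : I -> R).
Definition cos_sum v := \sum_(i : I) (a i * cos (v * mu i)).
Definition sin_sum v := \sum_(i : I) (a i * sin (v * mu i)).
(** The squared modulus of the trigonometric sum [sum a i * exp (- i v mu i)]. *)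
Definition sqnorm v := cos_sum v ^ 2 + sin_sum v ^ 2.

Lemma sqnorm_expand v : sqnorm v = \sum_(i : I) \sum_(j : I) (a i * a j * cos (v * (mu i - mu j))).
Proof.
rewrite /sqnorm -!Rsqr_pow2 /Rsqr /cos_sum /sin_sum !big_distrlr /= -big_split /=.
apply: eq_bigr => i _; rewrite -big_split /=; apply: eq_bigr => j _.
rewrite Rmult_minus_distr_l cos_minus; lra.
Qed.

Lemma sqnorm_opp v : sqnorm (- v) = sqnorm v.
Proof.
rewrite !sqnorm_expand; apply: eq_bigr => i _; apply: eq_bigr => j _.
by rewrite Ropp_mult_distr_l_reverse cos_neg.
Qed.

Lemma sqnorm_ge0 v : 0 <= sqnorm v.
Proof. by rewrite /sqnorm; apply: Rplus_le_le_0_compat; apply: pow2_ge_0. Qed.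

Lemma sqnorm_le v : (forall i, 0 <= a i) -> sqnorm v <= (\sum_(i : I) a i) ^ 2.
Proof.
move=> a0; rewrite sqnorm_expand -Rsqr_pow2 /Rsqr big_distrlr /=.
apply: sumR_le => i _; apply: sumR_le => j _.
have [_ C1] := COS_bound (v * (mu i - mu j)).
have := Rmult_le_pos _ _ (a0 i) (a0 j); nra.
Qed.
End TrigSums.

Lemma sum_pair (I J : finType) (F : I * J -> R) : \sum_(p : I * J) F p = \sum_(i : I) \sum_(j : J) F (i, j).
Proof. by rewrite pair_bigA /=; apply: eq_bigr => -[]. Qed.

Lemma sqnorm_prod (I J : finType) (a mu : I -> R) (b nu : J -> R) v :
  sqnorm (I * J)%type (fun p => a p.1 * b p.2) (fun p => mu p.1 + nu p.2) v = sqnorm I a mu v * sqnorm J b nu v.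
Proof.
rewrite /sqnorm.
have -> : cos_sum (I * J)%type (fun p => a p.1 * b p.2) (fun p => mu p.1 + nu p.2) v
   = cos_sum I a mu v * cos_sum J b nu v - sin_sum I a mu v * sin_sum J b nu v.
  suff -> : cos_sum I a mu v * cos_sum J b nu v = cos_sum (I * J)%type (fun p => a p.1 * b p.2) (fun p => mu p.1 + nu p.2) v
     + sin_sum I a mu v * sin_sum J b nu v by lra.
  rewrite /cos_sum /sin_sum !big_distrlr sum_pair /= -big_split /=.
  apply: eq_bigr => i _; rewrite -big_split /=; apply: eq_bigr => j _.
  rewrite Rmult_plus_distr_l cos_plus; lra.
have -> : sin_sum (I * J)%type (fun p => a p.1 * b p.2) (fun p => mu p.1 + nu p.2) v
   = sin_sum I a mu v * cos_sum J b nu v + cos_sum I a mu v * sin_sum J b nu v.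
  rewrite /cos_sum /sin_sum !big_distrlr sum_pair /= -big_split /=.
  apply: eq_bigr => i _; rewrite -big_split /=; apply: eq_bigr => j _.
  rewrite Rmult_plus_distr_l sin_plus; lra.
ring.
Qed.

Lemma sum_inj_le (I J : finType) (A : {set I}) (B : pred J) (h : I -> J) (g : J -> R) :
  {in A &, injective h} -> (forall i, i \in A -> B (h i)) -> (forall j, 0 <= g j) ->
  \sum_(i in A) g (h i) <= \sum_(j | B j) g j.
Proof.
move=> hI hB g0; rewrite -(big_imset g hI); apply: sumR_sub_le => // j.
by case/imsetP => i iA ->; apply: hB.
Qed.

Section Fejer.
Variable V : nat.

(** The Fejer kernel, kept as a double sum so that its nonnegativity is the
    nonnegativity of a squared modulus. *)
Definition fejer x := \sum_(v1 < V) \sum_(v2 < V) cos ((INR v1 - INR v2) * x).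

Lemma fejer_sqnorm x : fejer x = sqnorm 'I_V (fun _ => 1) (fun v => INR v) x.
Proof.
rewrite sqnorm_expand; apply: eq_bigr => i _; apply: eq_bigr => j _.
by rewrite !Rmult_1_l Rmult_comm.
Qed.

Lemma fejer_ge0 x : 0 <= fejer x.
Proof. rewrite fejer_sqnorm; exact: sqnorm_ge0. Qed.

Lemma fejer_lower x : (forall v, (v < V)%N -> 1 / 2 <= cos (INR v * x)) -> INR V ^ 2 / 4 <= fejer x.
Proof.
move=> H; rewrite fejer_sqnorm /sqnorm.
have C : INR V * (1 / 2) <= cos_sum 'I_V (fun _ => 1) (fun v => INR v) x.
  rewrite /cos_sum -{1}(card_ord V) -sumR_const; apply: sumR_le => i _.
  have := H i (ltn_ord i); rewrite (Rmult_comm x); lra.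
have := pos_INR V; have := pow2_ge_0 (sin_sum 'I_V (fun _ => 1) (fun v => INR v) x); nra.
Qed.
End Fejer.

Section Resonance.
Variables (V N : nat) (V_gt0 : (0 < V)%N).
Let W := (8 * V)%N.

(** Multiples of [2 PI / W] with [W = 8 V]: a frequency rounded to a bin is off by
    less than [1 / V] modulo [2 PI], so all [v < V] still see a cosine of at least
    1/2, as [2 PI / 8 < 1].  Only integer sampling points occur, so frequencies
    matter modulo [2 PI]. *)
Definition bin_freq (j : 'I_W) : R := 2 * PI * INR j / INR W.

Lemma W_pos : 0 < INR W.
Proof. by apply: (ltn_INR 0 W); rewrite muln_gt0. Qed.

Lemma bin_exists x : exists j : 'I_W, exists d z, 0 <= d < 1 /\ x = bin_freq j + 2 * PI * d / INR W + 2 * PI * IZR z.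
Proof.
have W0 := W_pos; have P0 := PI_RGT_0.
set y := INR W * x / (2 * PI); set k := Int_part y.
have W0n : (0 < W)%N by rewrite muln_gt0.
have Wz : (0 < Z.of_nat W)%Z by lia.
have [M1 M2] := Z.mod_pos_bound k _ Wz.
have jW : (Z.to_nat (k mod Z.of_nat W) < W)%N by lia.
exists (Ordinal jW), (y - IZR k), (k / Z.of_nat W)%Z; split.
  have [H1 H2] := base_Int_part y; rewrite -/k in H1 H2; lra.
have E : IZR k = INR W * IZR (k / Z.of_nat W) + INR (Z.to_nat (k mod Z.of_nat W)).
  by rewrite !INR_IZR_INZ Z2Nat.id // -mult_IZR -plus_IZR {1}(Z_div_mod_eq_full k (Z.of_nat W)).
rewrite /bin_freq /= E /y; field; lra.
Qed.

Lemma sum_cos_vanish v1 (i j : 'I_W) : i != j ->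
  \sum_(v2 < W) cos ((INR v1 - INR v2) * (bin_freq i - bin_freq j)) = 0.
Proof.
move=> ij; have W0 := W_pos; have P0 := PI_RGT_0.
set h := bin_freq i - bin_freq j.
have T n : 2 * sin (h / 2) * \sum_(v2 < n) cos ((INR v1 - INR v2) * h)
   = sin (INR v1 * h + h / 2) - sin (INR v1 * h + h / 2 - INR n * h).
  elim: n => [|n IH]; first by rewrite big_ord0 /= (_ : 0 * h = 0); [rewrite Rminus_0_r; lra | lra].
  rewrite big_ord_recr [LHS]/= Rmult_plus_distr_l IH S_INR.
  set y := INR v1 * h + h / 2 - INR n * h.
  have -> : INR v1 * h + h / 2 - (INR n + 1) * h = (INR v1 - INR n) * h - h / 2 by lra.
  have -> : y = (INR v1 - INR n) * h + h / 2 by rewrite /y; lra.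
  move: (sin (INR v1 * h + h / 2)) => s0; rewrite sin_plus sin_minus; lra.
have Wh : INR W * h = 2 * PI * IZR (Z.of_nat i - Z.of_nat j).
  rewrite minus_IZR -!INR_IZR_INZ /h /bin_freq; field; lra.
have S2 : sin (INR v1 * h + h / 2 - INR W * h) = sin (INR v1 * h + h / 2).
  rewrite -!cos_shift Wh -[RHS](cos_Zperiod _ (Z.of_nat i - Z.of_nat j)); congr cos; lra.
have S0 : sin (h / 2) <> 0.
  move=> /sin_eq_0_0 [k K].
  have : IZR (Z.of_nat i - Z.of_nat j) = INR W * IZR k.
    apply: (Rmult_eq_reg_l (2 * PI)); last lra.
    by rewrite -Wh -(Rmult_comm (IZR k)) (_ : h = 2 * (IZR k * PI)); lra.
  rewrite INR_IZR_INZ -mult_IZR => /eq_IZR K2.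
  have iW := ltn_ord i; have jW := ltn_ord j.
  have k0 : k = 0%Z by nia.
  move/eqP: ij; apply; apply: val_inj => /=; lia.
have := T W; rewrite S2 Rminus_diag => H.
by have [|] := Rmult_integral _ _ H => //; lra.
Qed.

(** Bin frequencies are orthogonal over a full period [W]. *)
Lemma mean_square r v1 : \sum_(v2 < W) sqnorm 'I_W r bin_freq (INR v1 - INR v2) = INR W * \sum_(j : 'I_W) (r j ^ 2).
Proof.
rewrite (eq_bigr _ (fun v2 _ => sqnorm_expand _ _ _ _)) exchange_big /= -sumR_mull.
apply: eq_bigr => i _; rewrite exchange_big /= (bigD1 i) //= [X in _ + X]big1 => [|j ji].
- rewrite Rplus_0_r (eq_bigr (fun _ => r i ^ 2)) => [|v _].
    by rewrite sumR_const card_ord.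
  rewrite (_ : _ * (bin_freq i - bin_freq i) = 0); last lra.
  by rewrite cos_0; lra.
- by rewrite sumR_mull sum_cos_vanish ?Rmult_0_r // eq_sym.
Qed.

Lemma count_near V0 v1 : \sum_(v2 < V) (if (v1 < v2 + V0)%N && (v2 < v1 + V0)%N then 1 else 0) <= 2 * INR V0.
Proof.
suff H n : (\big[addn/0]_(v2 < n) ((v1 < v2 + V0) && (v2 < v1 + V0)) <= minn n (v1 + V0) - (v1 - V0))%N.
  have -> : 2 * INR V0 = INR (2 * V0)%N by rewrite INRM.
  rewrite (eq_bigr (fun v2 : 'I_V => INR ((v1 < v2 + V0)%N && (v2 < v1 + V0)%N))) => [|i _]; last by case: ifP.
  rewrite -INR_sum; apply: leq_INR; apply: leq_trans (H V) _; lia.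
elim: n => [|n IH]; first by rewrite big_ord0.
rewrite big_ord_recr; move: IH; move: (bigop.body _ _ _) => s IH; case: andP => [[/= h1 h2]|_] /=; lia.
Qed.

(* [c], [l] are coefficients and frequencies of the Dirichlet polynomial, [f], [mu]
   those of the resonator with support [M].  A good pair [p] of resonator terms is
   an exact coincidence of frequencies with the terms [nu1 p] and [nu2 p] of the
   polynomial. *)
Variables (c l : 'I_N -> R) (E : finType) (M : pred E) (f mu : E -> R).
Variables (Good : pred (E * E)) (nu1 nu2 : E * E -> 'I_N).
Hypothesis c0 : forall n, 0 <= c n.
Hypothesis f0 : forall e, 0 <= f e.
Hypothesis GoodM : forall p, Good p -> M p.1 && M p.2.
Hypothesis Goodl : forall p, Good p -> l (nu1 p) + mu p.1 = l (nu2 p) + mu p.2.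
Hypothesis Good1 : forall p q, Good p -> Good q -> nu1 p = nu1 q -> nu2 p = nu2 q -> p.1 = q.1 -> p.2 = q.2.
Hypothesis Good2 : forall p q, Good p -> Good q -> nu1 p = nu1 q -> nu2 p = nu2 q -> p.2 = q.2 -> p.1 = q.1.

Lemma bins : exists bin : E -> 'I_W, forall e, exists d z, 0 <= d < 1 /\
  mu e = bin_freq (bin e) + 2 * PI * d / INR W + 2 * PI * IZR z.
Proof.
exact: (fin_all_exists (fun e => bin_exists (mu e))).
Qed.

(** Evaluates [J], the sum over [v1, v2 < V] of [|D r|^2] at [v1 - v2], where [r] has in
    each bin the square root of the sum of the [f e ^ 2] over that bin.  Upper bound:
    for differences below [V0] use the trivial bound for both factors, otherwise
    [X2] for [D] and the mean square of [r].  Lower bound: [J] is a sum of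
    nonnegative terms [a k * a k' * fejer]; the good pairs falling in given bins
    and with given [nu1], [nu2] form the graph of an injection, so by Cauchy-Schwarz
    their resonator weights sum to at most [r j * r j']. *)
Theorem resonance V0 X2 : 
  (forall v, (V0 <= v < V)%N -> sqnorm 'I_N c l (INR v) <= X2) -> 0 <= X2 ->
  \sum_(p | Good p) (f p.1 * f p.2 * (c (nu1 p) * c (nu2 p)))
   <= 4 * (\sum_(e | M e) (f e ^ 2)) *
     (2 * (INR V0 / INR V) * (\sum_(n : 'I_N) c n) ^ 2 * INR #|M| + 8 * X2).
Proof.
move=> HX X20; have [bin binP] := bins.
have V0' : 0 < INR V := ltn_INR 0 V V_gt0.
have P0 := PI_RGT_0; have W0 := W_pos.
have EW : INR W = 8 * INR V by rewrite INRM; congr (_ * _); rewrite /=; lra.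
set F := \sum_(e | M e) _; set D0 := \sum_(n : 'I_N) c n; set L := \sum_(p | Good p) _.
pose r j := sqrt (\sum_(e | M e && (bin e == j)) (f e ^ 2)).
have rr j : r j ^ 2 = \sum_(e | M e && (bin e == j)) (f e ^ 2).
  by rewrite /r -Rsqr_pow2 Rsqr_sqrt //; apply: sumR_ge0 => e _; apply: pow2_ge_0.
have r0 j : 0 <= r j by apply: sqrt_pos.
have sumrr : \sum_(j : 'I_W) (r j ^ 2) = F.
  by rewrite /F (partition_big bin xpredT) //; apply: eq_bigr => j _; rewrite rr.
have F0 : 0 <= F by apply: sumR_ge0 => e _; apply: pow2_ge_0.
have sumr : (\sum_(j : 'I_W) r j) ^ 2 <= INR #|M| * F.
  apply: (Rle_trans _ ((\sum_(e | M e) f e) ^ 2)).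
    apply: pow_incr; split; first by apply: sumR_ge0.
    rewrite (partition_big bin xpredT) //=; apply: sumR_le => j _.
    rewrite /r; apply: Rsqr_incr_0_var; last by apply: sumR_ge0.
    rewrite Rsqr_sqrt; last by apply: sumR_ge0 => e _; apply: pow2_ge_0.
    rewrite /Rsqr big_distrlr /=; apply: sumR_le => e He.
    rewrite (bigD1 e) //=.
    apply: (Rle_trans _ (f e * f e + 0)); first lra.
    by apply: Rplus_le_compat_l; apply: sumR_ge0 => i _; apply: Rmult_le_pos.
  have := sumR_CS E M (fun _ => 1) f; rewrite -/F.
  rewrite (eq_bigr f) => [|i _]; last lra.
  by rewrite sumR_const; lra.
pose K := ('I_N * 'I_W)%type.
pose a (k : K) := c k.1 * r k.2; pose ka (k : K) := l k.1 + bin_freq k.2.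
have a0 k : 0 <= a k by apply: Rmult_le_pos.
pose J := \sum_(v1 < V) \sum_(v2 < V) sqnorm K a ka (INR v1 - INR v2).
have JF : J = \sum_(k : K) \sum_(k' : K) (a k * a k' * fejer V (ka k - ka k')).
  rewrite /J (eq_bigr _ (fun v1 _ => eq_bigr _ (fun v2 _ => sqnorm_expand _ _ _ _))) /=.
  rewrite (eq_bigr _ (fun v1 _ => exchange_big _ _ _ _ _ _)) exchange_big /=; apply: eq_bigr => k _.
  rewrite (eq_bigr _ (fun v1 _ => exchange_big _ _ _ _ _ _)) exchange_big /=; apply: eq_bigr => k' _.
  rewrite /fejer -sumR_mull; apply: eq_bigr => v1 _; rewrite -sumR_mull; apply: eq_bigr => v2 _; lra.
have up : J <= INR V * (2 * INR V0 * (D0 ^ 2 * (INR #|M| * F)) + X2 * (INR W * F)).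
  have cst x : INR V * x = \sum_(v1 < V) x by rewrite sumR_const card_ord.
  rewrite /J cst; apply: sumR_le => v1 _.
  apply: (Rle_trans _ (\sum_(v2 < V) ((if (v1 < v2 + V0)%N && (v2 < v1 + V0)%N then 1 else 0) * (D0 ^ 2 * (INR #|M| * F))
      + X2 * sqnorm 'I_W r bin_freq (INR v1 - INR v2)))).
    apply: sumR_le => v2 _; rewrite sqnorm_prod.
    have R0 := sqnorm_ge0 'I_W r bin_freq (INR v1 - INR v2).
    have DD0 := sqnorm_ge0 'I_N c l (INR v1 - INR v2).
    case: ifP => near.
      have DD := sqnorm_le 'I_N c l (INR v1 - INR v2) c0; rewrite -/D0 in DD.
      have RR := sqnorm_le 'I_W r bin_freq (INR v1 - INR v2) r0.
      have Y := Rmult_le_compat _ _ _ _ DD0 R0 DD (Rle_trans _ _ _ RR sumr).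
      have Z := Rmult_le_pos _ _ X20 R0; rewrite Rmult_1_l.
      by apply: (Rle_trans _ _ _ Y); rewrite -[X in X <= _]Rplus_0_r; apply: Rplus_le_compat_l.
    rewrite Rmult_0_l Rplus_0_l; apply: Rmult_le_compat_r => //.
    case: (leqP v2 v1) => le.
      rewrite (_ : INR v1 - INR v2 = INR (v1 - v2)%N); last by rewrite minus_INR //; apply/leP.
      apply: HX; have := ltn_ord v1; move: near; lia.
    rewrite (_ : INR v1 - INR v2 = - INR (v2 - v1)%N); last by rewrite minus_INR; [lra|apply/leP; exact: ltnW].
    rewrite sqnorm_opp; apply: HX; have := ltn_ord v2; move: near; lia.
  rewrite big_split /= sumR_mulr sumR_mull.
  have A1 : 0 <= D0 ^ 2 * (INR #|M| * F).
    by apply: Rmult_le_pos; [exact: pow2_ge_0 | apply: Rmult_le_pos => //; exact: pos_INR].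
  have A2 := Rmult_le_compat_r _ _ _ A1 (count_near V0 v1).
  have A3 : \sum_(v2 < V) sqnorm 'I_W r bin_freq (INR v1 - INR v2) <= INR W * F.
    rewrite -sumrr -(mean_square r v1) -!(big_mkord xpredT (fun v2 => sqnorm 'I_W r bin_freq (INR v1 - INR v2))).
    rewrite [X in _ <= X](@big_cat_nat _ _ _ V) //=; last by rewrite /W; lia.
    rewrite -[X in X <= _]Rplus_0_r; apply: Rplus_le_compat_l.
    by apply: sumR_ge0 => i _; exact: sqnorm_ge0.
  have A4 := Rmult_le_compat_l _ _ _ X20 A3.
  by apply: Rplus_le_compat.
have low : INR V ^ 2 / 4 * L <= J.
  rewrite JF pair_bigA /= /L.
  rewrite (partition_big (fun p => ((nu1 p, bin p.1), (nu2 p, bin p.2))) xpredT) //= -sumR_mull.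
  apply: sumR_le => -[[n j] [n' j']] _ /=.
  set A := [set p | Good p && (((nu1 p, bin p.1), (nu2 p, bin p.2)) == ((n, j), (n', j')))].
  rewrite (eq_bigl (fun p => p \in A)) => [|p]; last by rewrite inE.
  have AP p : p \in A -> [/\ Good p, nu1 p = n, bin p.1 = j, nu2 p = n' & bin p.2 = j'].
    by rewrite inE => /andP[Gp /eqP[]].
  have [E0|[p0 p0A]] := set_0Vmem A.
    rewrite E0 big_set0 Rmult_0_r; apply: Rmult_le_pos; last exact: fejer_ge0.
    exact: Rmult_le_pos.
  rewrite (eq_bigr (fun p => f p.1 * f p.2 * (c n * c n'))) => [|p /AP[_ -> _ -> _] //].
  rewrite sumR_mulr /a /=.
  have FL : INR V ^ 2 / 4 <= fejer V (ka (n, j) - ka (n', j')).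
    apply: fejer_lower => v vV; rewrite /ka /=.
    have [Gp E1 E2 E3 E4] := AP _ p0A; have := Goodl _ Gp; rewrite E1 E3 => EL.
    have [d [z [d01 Ed]]] := binP p0.1; have [d' [z' [d01' Ed']]] := binP p0.2.
    rewrite E2 in Ed; rewrite E4 in Ed'.
    have -> : INR v * (l n + bin_freq j - (l n' + bin_freq j'))
      = INR v * (2 * PI * (d' - d) / INR W) + 2 * PI * IZR (Z.of_nat v * (z' - z)).
      rewrite mult_IZR minus_IZR -INR_IZR_INZ.
      have -> : l n + bin_freq j - (l n' + bin_freq j') = 2 * PI * (d' - d) / INR W + 2 * PI * (IZR z' - IZR z).
        have -> : 2 * PI * (d' - d) / INR W = 2 * PI * d' / INR W - 2 * PI * d / INR W by field; lra.
        lra.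
      lra.
    rewrite cos_Zperiod; apply: cos_ge_half.
    have v0 := pos_INR v; have vV' := ltn_INR _ _ vV.
    have -> : INR v * (2 * PI * (d' - d) / INR W) = (d' - d) * (2 * PI * INR v / INR W) by field; lra.
    rewrite Rabs_mult.
    have B1 : Rabs (d' - d) <= 1 by apply: Rabs_le; lra.
    have B2 : Rabs (2 * PI * INR v / INR W) <= 1.
      rewrite Rabs_pos_eq; last by apply: Rdiv_le_0_compat => //; have := Rmult_le_pos _ _ (Rlt_le _ _ P0) v0; lra.
      apply: (Rmult_le_reg_r (INR W)) => //; rewrite /Rdiv Rmult_assoc Rinv_l; last lra.
      rewrite EW; have := PI_4; nra.
    have := Rabs_pos (d' - d); have := Rabs_pos (2 * PI * INR v / INR W); nra.
  have S : \sum_(p in A) (f p.1 * f p.2) <= r j * r j'.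
  { apply: Rsqr_incr_0_var; last exact: Rmult_le_pos.
    rewrite !Rsqr_pow2 Rpow_mult_distr !rr.
    apply: (Rle_trans _ _ _ (sumR_CS _ (fun p => p \in A) (fun p => f p.1) (fun p => f p.2))).
    apply: Rmult_le_compat; try (by apply: sumR_ge0 => p _; apply: pow2_ge_0).
    - apply: (sum_inj_le _ _ A _ fst (fun e => f e ^ 2)) => [p q pA qA /= e1|p pA|e].
      + have [Gp E1 E2 E3 E4] := AP _ pA; have [Gq E1' E2' E3' E4'] := AP _ qA.
        have e2 : p.2 = q.2 by apply: Good1 => //; congruence.
        by move: e1 e2; case: p {pA Gp E1 E2 E3 E4} => ? ?; case: q {qA Gq E1' E2' E3' E4'} => ? ? /= -> ->.
      + have [Gp E1 E2 E3 E4] := AP _ pA; have /andP[M1 M2] := GoodM _ Gp.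
        by rewrite M1 E2 eqxx.
      + exact: pow2_ge_0.
    - apply: (sum_inj_le _ _ A _ snd (fun e => f e ^ 2)) => [p q pA qA /= e1|p pA|e].
      + have [Gp E1 E2 E3 E4] := AP _ pA; have [Gq E1' E2' E3' E4'] := AP _ qA.
        have e2 : p.1 = q.1 by apply: Good2 => //; congruence.
        by move: e1 e2; case: p {pA Gp E1 E2 E3 E4} => ? ?; case: q {qA Gq E1' E2' E3' E4'} => ? ? /= -> ->.
      + have [Gp E1 E2 E3 E4] := AP _ pA; have /andP[M1 M2] := GoodM _ Gp.
        by rewrite M2 E4 eqxx.
      + exact: pow2_ge_0. }
  have cc : 0 <= c n * c n' by apply: Rmult_le_pos.
  have V4 : 0 <= INR V ^ 2 / 4 by have := pow2_ge_0 (INR V); lra.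
  have S' := Rmult_le_compat_r _ _ _ cc S.
  have rc : 0 <= c n * r j * (c n' * r j') by apply: Rmult_le_pos; apply: Rmult_le_pos.
  apply: (Rle_trans _ (INR V ^ 2 / 4 * (r j * r j' * (c n * c n')))); first exact: Rmult_le_compat_l.
  have := Rmult_le_compat_l _ _ _ rc FL; lra.
apply: (Rmult_le_reg_l (INR V ^ 2 / 4)); first by have := pow_lt _ 2 V0'; lra.
apply: (Rle_trans _ _ _ low); apply: (Rle_trans _ _ _ up); apply: Req_le.
rewrite EW; field; lra.
Qed.
End Resonance.

(** * The gcd sum restricted to a residue class *)

Definition Rleb (x y : R) : bool := if Rle_dec x y then true else false.
Lemma RlebP x y : reflect (x <= y) (Rleb x y).
Proof. by rewrite /Rleb; case: Rle_dec => h; constructor. Qed.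

Section GcdSum.
Variables (T : finType) (pr : T -> nat) (q : nat) (g w : T -> R).
Hypothesis pr_prime : forall t, prime (pr t).
Hypothesis q_gt0 : (0 < q)%N.
Hypothesis g0 : forall t, 0 <= g t.

(* exponent vectors; 1 is the centre, from which a prime can move up or down *)
Notation E := {ffun T -> 'I_3}.

Lemma tensor1 (G : T -> 'I_3 -> R) : \sum_(e : E) \prod_(t : T) G t (e t) = \prod_(t : T) \sum_(i : 'I_3) G t i.
Proof. by rewrite bigA_distr_bigA. Qed.

Lemma tensor2 (G : T -> 'I_3 -> 'I_3 -> R) :
  \sum_(p : E * E) \prod_(t : T) G t (p.1 t) (p.2 t) = \prod_(t : T) \sum_(i : 'I_3) \sum_(j : 'I_3) G t i j.
Proof.
rewrite sum_pair /= -(tensor1 (fun t i => \sum_(j : 'I_3) G t i j)).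
by apply: eq_bigr => e _; rewrite (tensor1 (fun t j => G t (e t) j)).
Qed.

Lemma sum3 (F : 'I_3 -> R) : \sum_(i : 'I_3) F i = F (inord 0) + F (inord 1) + F (inord 2).
Proof.
rewrite !big_ord_recl big_ord0 Rplus_0_r -Rplus_assoc.
by congr (F _ + F _ + F _); apply: val_inj; rewrite /= inordK.
Qed.

Definition intval (e : E) : nat := \big[muln/1%N]_(t : T) (pr t ^ e t)%N.
(** The numerator of [intval e' / intval e] in lowest terms. *)
Definition quo (e e' : E) : nat := \big[muln/1%N]_(t : T) (pr t ^ (e' t - e t))%N.
Definition amp (e : E) : R := \prod_(t : T) (if (e t == 1 :> nat)%N then 1 else g t).
Definition prime_rsqrt t := / sqrt (INR (pr t)).
Definition exp_dist (i j : 'I_3) : nat := ((i - j) + (j - i))%N.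
(** [1 / sqrt (quo e e' * quo e' e)], see [kern_quo], written as a product over primes
    so that sums against it factor. *)
Definition kern (e e' : E) : R := \prod_(t : T) (prime_rsqrt t ^ exp_dist (e t) (e' t)).
Definition total : R := \prod_(t : T) (1 + 2 * g t ^ 2).

Lemma prime_rsqrt_range t : 0 < prime_rsqrt t <= 1.
Proof.
have P := leq_INR 2 _ (prime_gt1 (pr_prime t)); rewrite [INR 2]/= in P.
rewrite /prime_rsqrt; split; first by apply: Rinv_0_lt_compat; apply: sqrt_lt_R0; lra.
rewrite -Rinv_1; apply: Rinv_le_contravar; first lra.
by rewrite -sqrt_1; apply: sqrt_le_1; lra.
Qed.

Lemma intval_quo e e' : (intval e * quo e e' = intval e' * quo e' e)%N.
Proof.
rewrite /intval /quo -!big_split /=; apply: eq_bigr => t _.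
by rewrite -!expnD -!maxnE maxnC.
Qed.

Lemma quo_gt0 e e' : (0 < quo e e')%N.
Proof. by rewrite /quo; apply: prodn_gt0 => t; rewrite expn_gt0 prime_gt0. Qed.

Lemma intval_gt0 e : (0 < intval e)%N.
Proof. by rewrite /intval; apply: prodn_gt0 => t; rewrite expn_gt0 prime_gt0. Qed.

Lemma coprime_prod (k : T -> nat) : (forall t, coprime (pr t) q) ->
  coprime (\big[muln/1%N]_(t : T) (pr t ^ k t)%N) q.
Proof.
move=> cop; elim/big_ind: _ => [|x y Hx Hy|t _]; rewrite ?coprime1n ?coprimeMl ?Hx //.
exact: coprimeXl.
Qed.

Lemma kern_quo e e' : kern e e' = / sqrt (INR (quo e e' * quo e' e)).
Proof.
have -> : (quo e e' * quo e' e)%N = \big[muln/1%N]_(t : T) (pr t ^ exp_dist (e t) (e' t))%N.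
  rewrite /quo -big_split /=; apply: eq_bigr => t _; rewrite -expnD /exp_dist; congr (_ ^ _)%N; exact: addnC.
suff : 0 < INR (\big[muln/1%N]_(t : T) (pr t ^ exp_dist (e t) (e' t))%N) /\
   kern e e' = / sqrt (INR (\big[muln/1%N]_(t : T) (pr t ^ exp_dist (e t) (e' t))%N)) by case.
rewrite /kern; elim/big_rec2: _ => [|t x y _ [y0 ->]] /=; first by rewrite sqrt_1 Rinv_1; lra.
have P : 0 < INR (pr t) := ltn_INR 0 _ (prime_gt0 (pr_prime t)).
rewrite INRM INRX; split; first by apply: Rmult_lt_0_compat => //; exact: pow_lt.
rewrite sqrt_mult; [|by apply: pow_le; lra|lra].
rewrite Rinv_mult; congr (_ * _); rewrite /prime_rsqrt pow_inv; congr (/ _).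
elim: (exp_dist _ _) => [|k IH] /=; first by rewrite sqrt_1.
by rewrite sqrt_mult ?IH //; [lra | apply: pow_le; lra].
Qed.

Lemma kern_ge0 e e' : 0 <= kern e e'.
Proof. by apply: prodR_ge0 => t _; apply: pow_le; have := prime_rsqrt_range t; lra. Qed.

Lemma kern_sym e e' : kern e e' = kern e' e.
Proof. by apply: eq_bigr => t _; rewrite /exp_dist addnC. Qed.

Lemma amp_ge0 e : 0 <= amp e.
Proof. by apply: prodR_ge0 => t _; case: ifP => _; [lra | exact: g0]. Qed.

(** A Cholesky factor of the 3 x 3 matrix [prime_rsqrt t ^ |i - j|], which shows that
    the kernel is positive semidefinite. *)
Definition chol t (c i : 'I_3) : R := if (c <= i)%N then prime_rsqrt t ^ (i - c) else 0.
Definition cholw t (c : 'I_3) : R := if (c == 0 :> nat)%N then 1 else 1 - prime_rsqrt t ^ 2.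

Lemma kern_chol1 t i j : prime_rsqrt t ^ exp_dist i j = \sum_(c : 'I_3) (cholw t c * (chol t c i * chol t c j)).
Proof.
rewrite sum3 /cholw /chol /exp_dist !inordK //.
case: i => [[|[|[|]]] hi] //; case: j => [[|[|[|]]] hj] //=; ring.
Qed.

Lemma kern_chol e e' : kern e e' = \sum_(d : E) ((\prod_(t : T) cholw t (d t)) *
  ((\prod_(t : T) chol t (d t) (e t)) * (\prod_(t : T) chol t (d t) (e' t)))).
Proof.
rewrite /kern (eq_bigr _ (fun t _ => kern_chol1 t (e t) (e' t))).
rewrite -(tensor1 (fun t c => cholw t c * (chol t c (e t) * chol t c (e' t)))).
by apply: eq_bigr => d _; rewrite !big_split.
Qed.

(** For a positive semidefinite kernel the diagonal blocks of a partition into [q]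
    classes carry at least [1/q] of the quadratic form: apply Cauchy-Schwarz to the
    sum over classes in each Cholesky direction. *)
Lemma class_sum (cl : E -> 'I_q) (F : E -> R) :
  \sum_(p : E * E) (F p.1 * F p.2 * kern p.1 p.2) <=
  INR q * \sum_(p : E * E | cl p.1 == cl p.2) (F p.1 * F p.2 * kern p.1 p.2).
Proof.
pose Wd d := \prod_(t : T) cholw t (d t); pose Ph (d e : E) := \prod_(t : T) chol t (d t) (e t).
have Wd0 d : 0 <= Wd d.
  apply: prodR_ge0 => t _; rewrite /cholw; case: ifP => _; first lra.
  have := prime_rsqrt_range t; nra.
have -> : \sum_(p : E * E) (F p.1 * F p.2 * kern p.1 p.2) = \sum_(d : E) (Wd d * (\sum_(e : E) (F e * Ph d e)) ^ 2).
  rewrite sum_pair /=.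
  transitivity (\sum_(e : E) \sum_(e' : E) \sum_(d : E) (Wd d * ((F e * Ph d e) * (F e' * Ph d e')))).
    apply: eq_bigr => e _; apply: eq_bigr => e' _; rewrite kern_chol -sumR_mull.
    by apply: eq_bigr => d _; rewrite /Wd /Ph; ring.
  rewrite (eq_bigr _ (fun e _ => exchange_big _ _ _ _ _ _)) exchange_big /=; apply: eq_bigr => d _.
  rewrite Rmult_1_r big_distrlr /= -sumR_mull; apply: eq_bigr => e _; by rewrite -sumR_mull.
have -> : \sum_(p : E * E | cl p.1 == cl p.2) (F p.1 * F p.2 * kern p.1 p.2) =
   \sum_(d : E) (Wd d * \sum_(r : 'I_q) (\sum_(e | cl e == r) (F e * Ph d e)) ^ 2).
  rewrite big_mkcond sum_pair /=.
  transitivity (\sum_(e : E) \sum_(e' : E) \sum_(d : E) (if cl e == cl e' then Wd d * ((F e * Ph d e) * (F e' * Ph d e')) else 0)).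
    apply: eq_bigr => e _; apply: eq_bigr => e' _; case: ifP => _; last by rewrite big1.
    rewrite kern_chol -sumR_mull; by apply: eq_bigr => d _; rewrite /Wd /Ph; ring.
  rewrite (eq_bigr _ (fun e _ => exchange_big _ _ _ _ _ _)) exchange_big /=; apply: eq_bigr => d _.
  transitivity (Wd d * \sum_(e : E) \sum_(e' | cl e' == cl e) ((F e * Ph d e) * (F e' * Ph d e'))).
    rewrite -sumR_mull; apply: eq_bigr => e _; rewrite -big_mkcond /= -sumR_mull.
    by apply: eq_bigl => e'; rewrite eq_sym.
  congr (_ * _); rewrite (partition_big cl xpredT) //; apply: eq_bigr => r _.
  rewrite Rmult_1_r big_distrlr; apply: eq_bigr => e /eqP <-.
  by [].
rewrite -sumR_mull; apply: sumR_le => d _.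
have := sumR_CS 'I_q xpredT (fun _ => 1) (fun r => \sum_(e | cl e == r) (F e * Ph d e)).
rewrite (eq_bigr (fun r => \sum_(e | cl e == r) (F e * Ph d e))) => [|r _]; last by rewrite Rmult_1_l.
rewrite sumR_const card_ord pow1 Rmult_1_r.
rewrite [X in X ^ 2 <= _ -> _](_ : _ = \sum_(e : E) (F e * Ph d e)); last first.
  by rewrite [RHS](partition_big cl xpredT).
move=> H; have H0 := Rmult_le_compat_l _ _ _ (Wd0 d) H; by rewrite -Rmult_assoc (Rmult_comm (INR q)) Rmult_assoc.
Qed.

Definition amp1 t (i : 'I_3) : R := if (i == 1 :> nat)%N then 1 else g t.
Definition term (p : E * E) : R := amp p.1 * amp p.2 * kern p.1 p.2.

Lemma term_ge0 p : 0 <= term p.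
Proof. by apply: Rmult_le_pos; [apply: Rmult_le_pos; exact: amp_ge0 | exact: kern_ge0]. Qed.

Lemma term_prod p : term p = \prod_(t : T) (amp1 t (p.1 t) * amp1 t (p.2 t) * prime_rsqrt t ^ exp_dist (p.1 t) (p.2 t)).
Proof. by rewrite /term /amp /kern !big_split. Qed.

Lemma total_gt0 : 0 < total.
Proof. apply: prodR_gt0 => t _; have := g0 t; nra. Qed.

Lemma total_exp (u : T -> R) :
  \prod_(t : T) ((1 + 2 * g t ^ 2) * exp (u t)) = total * exp (\sum_(t : T) u t).
Proof. by rewrite big_split /= prodR_exp. Qed.

Lemma sum33 t (h : 'I_3 -> 'I_3 -> R) :
  \sum_(i : 'I_3) \sum_(j : 'I_3) (amp1 t i * amp1 t j * prime_rsqrt t ^ exp_dist i j * h i j) =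
  h (inord 1) (inord 1) + g t * prime_rsqrt t * (h (inord 0) (inord 1) + h (inord 1) (inord 0) + h (inord 1) (inord 2) + h (inord 2) (inord 1))
  + g t ^ 2 * (h (inord 0) (inord 0) + h (inord 2) (inord 2)) + g t ^ 2 * prime_rsqrt t ^ 2 * (h (inord 0) (inord 2) + h (inord 2) (inord 0)).
Proof.
rewrite !sum3 /amp1 /exp_dist !inordK //=; ring.
Qed.

(** The Euler factor is [1 + 2 g^2 + 4 g / sqrt p + ...]: the four neighbouring pairs of
    exponents (0,1), (1,0), (1,2), (2,1) give the 4 in the exponent. *)
Lemma total_lower eta : 0 <= eta -> (forall t, 2 * g t ^ 2 + 4 * (g t * prime_rsqrt t) <= eta) ->
  total * exp (4 * (1 - eta) * \sum_(t : T) (g t * prime_rsqrt t)) <= \sum_(p : E * E) term p.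
Proof.
move=> eta0 small.
rewrite (eq_bigr _ (fun p _ => term_prod p)) (tensor2 (fun t i j => amp1 t i * amp1 t j * prime_rsqrt t ^ exp_dist i j)).
rewrite -sumR_mull -total_exp; apply: prodR_le => t _.
have s01 := prime_rsqrt_range t; have gt0 := g0 t; have gs0 : 0 <= g t * prime_rsqrt t by apply: Rmult_le_pos; lra.
have g2 := pow2_ge_0 (g t); have D1 : 0 < 1 + 2 * g t ^ 2 by lra.
split; first by apply: Rmult_le_pos; [lra | left; exact: exp_pos].
have -> : \sum_(i : 'I_3) \sum_(j : 'I_3) (amp1 t i * amp1 t j * prime_rsqrt t ^ exp_dist i j) =
   1 + g t * prime_rsqrt t * 4 + g t ^ 2 * 2 + g t ^ 2 * prime_rsqrt t ^ 2 * 2.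
  transitivity (\sum_(i : 'I_3) \sum_(j : 'I_3) (amp1 t i * amp1 t j * prime_rsqrt t ^ exp_dist i j * 1)).
    by apply: eq_bigr => i _; apply: eq_bigr => j _; rewrite Rmult_1_r.
  by rewrite (sum33 t (fun _ _ => 1)); ring.
set z := g t * prime_rsqrt t in small gs0 *; have sm := small t; rewrite -/z in sm.
have D2 : 0 < 1 + 2 * g t ^ 2 + 4 * z by lra.
(* the inequality 1 + x >= exp (x / (1 + x)) with x = 4 z / (1 + 2 g^2) *)
have X : exp (4 * (1 - eta) * z) <= (1 + 2 * g t ^ 2 + 4 * z) / (1 + 2 * g t ^ 2).
  apply: (Rle_trans _ (exp (4 * z / (1 + 2 * g t ^ 2 + 4 * z)))).
    apply: exp_mono; apply: (Rmult_le_reg_r (1 + 2 * g t ^ 2 + 4 * z)) => //.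
    rewrite /Rdiv (Rmult_assoc (4 * z)) Rinv_l; last lra.
    have -> : 4 * (1 - eta) * z * (1 + 2 * g t ^ 2 + 4 * z) = 4 * z * ((1 - eta) * (1 + 2 * g t ^ 2 + 4 * z)) by ring.
    apply: Rmult_le_compat_l; first lra.
    have : (1 - eta) * (1 + 2 * g t ^ 2 + 4 * z) <= (1 - eta) * (1 + eta) \/ 1 - eta <= 0.
      by case: (Rle_lt_dec (1 - eta) 0) => h; [right | left; apply: Rmult_le_compat_l; lra].
    case; nra.
  have Y := exp_ineq1_le (- (4 * z / (1 + 2 * g t ^ 2 + 4 * z))).
  rewrite exp_Ropp in Y.
  have E1 : 1 + - (4 * z / (1 + 2 * g t ^ 2 + 4 * z)) = / ((1 + 2 * g t ^ 2 + 4 * z) / (1 + 2 * g t ^ 2)) by field; lra.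
  rewrite E1 in Y.
  rewrite -(Rinv_inv (exp _)) -[X in _ <= X]Rinv_inv; apply: Rinv_le_contravar => //.
  by apply: Rinv_0_lt_compat; apply: Rdiv_lt_0_compat.
apply: (Rle_trans _ ((1 + 2 * g t ^ 2) * ((1 + 2 * g t ^ 2 + 4 * z) / (1 + 2 * g t ^ 2)))).
  by apply: Rmult_le_compat_l; lra.
have -> : (1 + 2 * g t ^ 2) * ((1 + 2 * g t ^ 2 + 4 * z) / (1 + 2 * g t ^ 2)) = 1 + 2 * g t ^ 2 + 4 * z by field; lra.
have := pow2_ge_0 (prime_rsqrt t); nra.
Qed.

(** Rankin's trick: the indicator of [P] is majorized by a multiplicative weight, and
    the weighted sum is again an Euler product. *)
Lemma rankin (P : pred (E * E)) (h : T -> 'I_3 -> 'I_3 -> R) (A : R) (u : T -> R) :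
  (forall t i j, 0 <= h t i j) -> 0 <= A ->
  (forall p, P p -> 1 <= A * \prod_(t : T) h t (p.1 t) (p.2 t)) ->
  (forall t, \sum_(i : 'I_3) \sum_(j : 'I_3) (amp1 t i * amp1 t j * prime_rsqrt t ^ exp_dist i j * h t i j) <= (1 + 2 * g t ^ 2) * (1 + u t)) ->
  \sum_(p | P p) term p <= total * (A * exp (\sum_(t : T) u t)).
Proof.
move=> h0 A0 hP hu.
have H0 (p : E * E) : 0 <= \prod_(t : T) h t (p.1 t) (p.2 t) by apply: prodR_ge0.
apply: (Rle_trans _ (\sum_(p : E * E) (A * (term p * \prod_(t : T) h t (p.1 t) (p.2 t))))).
  apply: (Rle_trans _ (\sum_(p | P p) (A * (term p * \prod_(t : T) h t (p.1 t) (p.2 t))))).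
    apply: sumR_le => p Pp; have -> : A * (term p * \prod_(t : T) h t (p.1 t) (p.2 t)) = term p * (A * \prod_(t : T) h t (p.1 t) (p.2 t)) by ring.
    rewrite -[X in X <= _]Rmult_1_r; apply: Rmult_le_compat_l; [exact: term_ge0 | exact: hP].
  apply: sumR_sub_le => // p _; apply: Rmult_le_pos => //; apply: Rmult_le_pos => //; exact: term_ge0.
rewrite sumR_mull.
have -> : total * (A * exp (\sum_(t : T) u t)) = A * (total * exp (\sum_(t : T) u t)) by ring.
apply: Rmult_le_compat_l => //.
rewrite (eq_bigr (fun p : E * E => \prod_(t : T) (amp1 t (p.1 t) * amp1 t (p.2 t) * prime_rsqrt t ^ exp_dist (p.1 t) (p.2 t) * h t (p.1 t) (p.2 t)))); last first.
  by move=> p _; rewrite term_prod -big_split.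
rewrite (tensor2 (fun t i j => amp1 t i * amp1 t j * prime_rsqrt t ^ exp_dist i j * h t i j)) -total_exp.
apply: prodR_le => t _; split.
  apply: sumR_ge0 => i _; apply: sumR_ge0 => j _; apply: Rmult_le_pos => //.
  apply: Rmult_le_pos; last by apply: pow_le; have := prime_rsqrt_range t; lra.
  by apply: Rmult_le_pos; rewrite /amp1; case: ifP => _; (lra || exact: g0).
apply: (Rle_trans _ _ _ (hu t)); apply: Rmult_le_compat_l; last exact: exp_ineq1_le.
have := pow2_ge_0 (g t); lra.
Qed.

Definition load (e : E) : R := \sum_(t : T) (if (e t == 1 :> nat)%N then 0 else w t).
Definition light (B : R) (e : E) : bool := Rleb (load e) B.

Hypothesis w0 : forall t, 0 <= w t.
Hypothesis g1 : forall t, g t <= 1.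

(** Rankin's trick with weight [exp (B - load e)].  The sum of the [exp (- w t)] will be
    of lower order, so that the support of the resonator has size about [exp B]. *)
Lemma card_light B : INR #|light B| <= exp (B + 2 * \sum_(t : T) exp (- w t)).
Proof.
rewrite -[INR _]Rmult_1_r -sumR_const exp_plus.
apply: (Rle_trans _ (\sum_(e : E) (exp B * exp (- load e)))).
  apply: (Rle_trans _ (\sum_(e | light B e) (exp B * exp (- load e)))).
    apply: sumR_le => e /RlebP le; rewrite -exp_plus -exp_0; apply: exp_mono; lra.
  by apply: sumR_sub_le => // e _; apply: Rmult_le_pos; left; exact: exp_pos.
rewrite sumR_mull; apply: Rmult_le_compat_l; first by left; exact: exp_pos.
rewrite (eq_bigr (fun e : E => \prod_(t : T) exp (if (e t == 1 :> nat)%N then 0 else - w t))); last first.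
  move=> e _; rewrite prodR_exp; congr exp; rewrite /load.
  have -> : - \sum_(t : T) (if (e t == 1 :> nat)%N then 0 else w t) = (- 1) * \sum_(t : T) (if (e t == 1 :> nat)%N then 0 else w t) by lra.
  by rewrite -sumR_mull; apply: eq_bigr => t _; case: ifP => _; lra.
rewrite (tensor1 (fun t i => exp (if (i == 1 :> nat)%N then 0 else - w t))) -sumR_mull -prodR_exp.
apply: prodR_le => t _; rewrite sum3 !inordK //= exp_0.
have X := exp_pos (- w t); split; first lra.
have := exp_ineq1_le (2 * exp (- w t)); lra.
Qed.

Lemma exp_le_quad x : 0 <= x <= 1 / 2 -> exp x <= 1 + x + 2 * x ^ 2.
Proof.
move=> [x0 x1]; have Y := exp_ineq1_le (- x); rewrite exp_Ropp in Y.
have Xp := exp_pos x.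
have Z : (1 - x) * exp x <= 1.
  have := Rmult_le_compat_r _ _ _ (Rlt_le _ _ Xp) Y; rewrite Rinv_l; lra.
apply: (Rmult_le_reg_l (1 - x)); first lra.
apply: (Rle_trans _ _ _ Z).
have -> : (1 - x) * (1 + x + 2 * x ^ 2) = 1 + x ^ 2 * (1 - 2 * x) by ring.
have := pow2_ge_0 x; nra.
Qed.

(** The weights [amp e ^ 2] make the load concentrate near the sum of
    [2 g t ^ 2 * w t]; a [B] slightly above it leaves a negligible tail. *)
Lemma rankin_load B d eta : 0 <= eta <= 1 / 2 -> 0 <= d -> (forall t, d * w t <= eta) ->
  \sum_(p : E * E | ~~ light B p.1) term p <=
  total * exp (d * (1 + 2 * eta) * \sum_(t : T) (2 * g t ^ 2 * w t) + 10 * \sum_(t : T) (g t * prime_rsqrt t) - d * B).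
Proof.
move=> [eta0 eta1] d0 dw.
pose u t := d * (1 + 2 * eta) * (2 * g t ^ 2 * w t) + 10 * (g t * prime_rsqrt t).
have -> : exp (d * (1 + 2 * eta) * \sum_(t : T) (2 * g t ^ 2 * w t) + 10 * \sum_(t : T) (g t * prime_rsqrt t) - d * B)
   = exp (- (d * B)) * exp (\sum_(t : T) u t).
  by rewrite /u big_split /= !sumR_mull -exp_plus; congr exp; ring.
pose b t := exp (d * w t).
apply: (rankin _ (fun t i j => if (i == 1 :> nat)%N then 1 else b t)).
- by move=> t i j; case: ifP => _; [lra | left; exact: exp_pos].
- by left; exact: exp_pos.
- move=> p /RlebP/Rnot_le_lt lt.
  have -> : \prod_(t : T) (if (p.1 t == 1 :> nat)%N then 1 else b t) = exp (d * load p.1).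
    rewrite /load -sumR_mull -prodR_exp; apply: eq_bigr => t _.
    by case: ifP => _; rewrite /b ?Rmult_0_r ?exp_0.
  rewrite -exp_plus -exp_0; apply: exp_mono; nra.
- move=> t; rewrite (sum33 t (fun i j => if (i == 1 :> nat)%N then 1 else b t)) !inordK //=.
  have s01 := prime_rsqrt_range t; have gt0 := g0 t; have gt1 := g1 t.
  have x0 : 0 <= d * w t by apply: Rmult_le_pos.
  have x1 := dw t.
  have b1 : 1 <= b t by rewrite /b -exp_0; apply: exp_mono.
  have b2 : b t <= 1 + (1 + 2 * eta) * (d * w t).
    apply: (Rle_trans _ _ _ (exp_le_quad (d * w t) _)); nra.
  have b3 : b t <= 2 by nra.
  have y0 : 0 <= (1 + 2 * eta) * (d * w t) by apply: Rmult_le_pos; lra.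
  have gs0 : 0 <= g t * prime_rsqrt t by apply: Rmult_le_pos; lra.
  have gs1 : g t * prime_rsqrt t <= 1 by nra.
  have F1 : g t * prime_rsqrt t * b t <= g t * prime_rsqrt t * 2 by apply: Rmult_le_compat_l.
  have F2 : g t * prime_rsqrt t * (g t * prime_rsqrt t) * b t <= g t * prime_rsqrt t * 2.
    by apply: Rmult_le_compat => //; [apply: Rmult_le_pos | lra | nra].
  have F3 : g t * g t * b t <= g t * g t * (1 + (1 + 2 * eta) * (d * w t)) by apply: Rmult_le_compat_l; nra.
  have u0 : 0 <= u t.
    rewrite /u; have : 0 <= (1 + 2 * eta) * (d * w t) * (2 * g t ^ 2); last by nra.
    by apply: Rmult_le_pos => //; have := pow2_ge_0 (g t); lra.
  apply: (Rle_trans _ (1 + 2 * (g t * g t) + u t)).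
    rewrite /u; lra.
  have := Rmult_le_pos _ _ (pow2_ge_0 (g t)) u0; lra.
Qed.

Lemma sum_swap (P : pred E) :
  \sum_(p : E * E | P p.2) term p = \sum_(p : E * E | P p.1) term p.
Proof.
rewrite big_mkcond [RHS]big_mkcond !sum_pair exchange_big /=.
by apply: eq_bigr => e _; apply: eq_bigr => e' _; rewrite /term /= kern_sym (Rmult_comm (amp e)).
Qed.

Definition close (Y : R) (p : E * E) : bool := Rleb (ln (INR (quo p.1 p.2 * quo p.2 p.1))) Y.

Lemma ln_quo e e' : ln (INR (quo e e' * quo e' e)) = \sum_(t : T) (INR (exp_dist (e t) (e' t)) * ln (INR (pr t))).
Proof.
have -> : (quo e e' * quo e' e)%N = \big[muln/1%N]_(t : T) (pr t ^ exp_dist (e t) (e' t))%N.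
  rewrite /quo -big_split /=; apply: eq_bigr => t _; rewrite -expnD /exp_dist; congr (_ ^ _)%N; exact: addnC.
rewrite ln_prodn => [|t _]; last by rewrite expn_gt0 prime_gt0.
by apply: eq_bigr => t _; rewrite INRX ln_pow //; exact: (ltn_INR 0 _ (prime_gt0 (pr_prime t))).
Qed.

Lemma rankin_close Y d : 0 <= d -> (forall t, d * ln (INR (pr t)) <= 1 / 2) ->
  \sum_(p : E * E | ~~ close Y p) term p <= total * exp (16 * \sum_(t : T) (g t * prime_rsqrt t) - d * Y).
Proof.
move=> d0 dp.
pose u t := 16 * (g t * prime_rsqrt t).
have -> : exp (16 * \sum_(t : T) (g t * prime_rsqrt t) - d * Y) = exp (- (d * Y)) * exp (\sum_(t : T) u t).
  by rewrite /u sumR_mull -exp_plus; congr exp; ring.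
pose b t := exp (d * ln (INR (pr t))).
apply: (rankin _ (fun t i j => b t ^ exp_dist i j)).
- by move=> t i j; apply: pow_le; left; exact: exp_pos.
- by left; exact: exp_pos.
- move=> p /RlebP/Rnot_le_lt lt.
  have -> : \prod_(t : T) (b t ^ exp_dist (p.1 t) (p.2 t)) = exp (d * ln (INR (quo p.1 p.2 * quo p.2 p.1))).
    rewrite ln_quo -sumR_mull -prodR_exp; apply: eq_bigr => t _.
    rewrite /b; elim: (exp_dist _ _) => [|k IH]; first by rewrite /= Rmult_0_l Rmult_0_r exp_0.
    by rewrite -tech_pow_Rmult IH S_INR -exp_plus; congr exp; ring.
  rewrite -exp_plus -exp_0; apply: exp_mono; nra.
- move=> t; rewrite (sum33 t (fun i j => b t ^ exp_dist i j)) /exp_dist !inordK //=.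
  have s01 := prime_rsqrt_range t; have gt0 := g0 t; have gt1 := g1 t.
  have x0 : 0 <= d * ln (INR (pr t)) by apply: Rmult_le_pos => //; exact: ln_INR_ge0.
  have b1 : 1 <= b t by rewrite /b -exp_0; apply: exp_mono.
  have b2 : b t <= 2.
    have x1 := dp t; apply: (Rle_trans _ _ _ (exp_le_quad (d * ln (INR (pr t))) _)) => //; nra.
  have gs0 : 0 <= g t * prime_rsqrt t by apply: Rmult_le_pos; lra.
  have gs1 : g t * prime_rsqrt t <= 1 by nra.
  have F1 : g t * prime_rsqrt t * b t <= g t * prime_rsqrt t * 2 by apply: Rmult_le_compat_l.
  have F2 : g t * prime_rsqrt t * (g t * prime_rsqrt t) * (b t * b t) <= g t * prime_rsqrt t * 4.
    by apply: Rmult_le_compat => //; [apply: Rmult_le_pos | nra | nra | nra].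
  have u0 : 0 <= u t by rewrite /u; lra.
  apply: (Rle_trans _ (1 + 2 * (g t * g t) + u t)).
    rewrite /u; lra.
  have := Rmult_le_pos _ _ (pow2_ge_0 (g t)) u0; lra.
Qed.

Definition good (cl : E -> 'I_q) (B Y : R) (p : E * E) : bool :=
  [&& light B p.1, light B p.2, cl p.1 == cl p.2 & close Y p].

Theorem gcd_sum_lower (cl : E -> 'I_q) B Y eta d d' :
  0 <= eta <= 1 / 2 -> (forall t, 2 * g t ^ 2 + 4 * (g t * prime_rsqrt t) <= eta) ->
  0 <= d -> (forall t, d * w t <= eta) -> 0 <= d' -> (forall t, d' * ln (INR (pr t)) <= 1 / 2) ->
  total * (/ INR q * exp (4 * (1 - eta) * \sum_(t : T) (g t * prime_rsqrt t))
    - 2 * exp (d * (1 + 2 * eta) * \sum_(t : T) (2 * g t ^ 2 * w t) + 10 * \sum_(t : T) (g t * prime_rsqrt t) - d * B)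
    - exp (16 * \sum_(t : T) (g t * prime_rsqrt t) - d' * Y))
  <= \sum_(p : E * E | good cl B Y p) term p.
Proof.
move=> Heta small d0 dw d0' dp.
have H1 := rankin_load B d eta Heta d0 dw.
have H2 := rankin_close Y d' d0' dp.
have H3 := total_lower eta (proj1 Heta) small.
have H4 : \sum_(p : E * E) term p <= INR q * \sum_(p : E * E | cl p.1 == cl p.2) term p := class_sum cl amp.
have H5 : \sum_(p : E * E | cl p.1 == cl p.2) term p <=
   \sum_(p : E * E | good cl B Y p) term p + (\sum_(p : E * E | ~~ light B p.1) term p +
   \sum_(p : E * E | ~~ light B p.2) term p + \sum_(p : E * E | ~~ close Y p) term p).
  rewrite big_mkcond [X in _ <= X + _]big_mkcond [X in _ <= _ + (X + _ + _)]big_mkcond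
    [X in _ <= _ + (_ + X + _)]big_mkcond [X in _ <= _ + (_ + _ + X)]big_mkcond -!big_split /=.
  apply: sumR_le => p _; have := term_ge0 p; rewrite /good.
  by case: (light B p.1); case: (light B p.2); case: (close Y p); case: (cl p.1 == cl p.2) => /=; lra.
rewrite (sum_swap (fun e => ~~ light B e)) in H5.
have Q0 : 0 < INR q by exact: (ltn_INR 0 q).
have H6 : / INR q * (total * exp (4 * (1 - eta) * \sum_(t : T) (g t * prime_rsqrt t))) <= \sum_(p : E * E | cl p.1 == cl p.2) term p.
  apply: (Rmult_le_reg_l (INR q)) => //; rewrite -Rmult_assoc Rinv_r; last lra.
  rewrite Rmult_1_l; exact: Rle_trans H3 H4.
move: H1 H2 H5 H6; set S0 := \sum_(p | good _ _ _ _) _; set S1 := \sum_(p | cl p.1 == _) _.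
set S2 := \sum_(p | ~~ light _ _) _; set S3 := \sum_(p | ~~ close _ _) _.
set x1 := exp _; set x2 := exp _; set x3 := exp _; move: S0 S1 S2 S3 x1 x2 x3 => *; lra.
Qed.
End GcdSum.

(** * Coincidences of the Hurwitz frequencies *)

Section Coincidences.
Variables (a q N' : nat) (th : R) (Q : nat).
Let N := N'.+1.
Let alpha := INR a / INR q.
Definition freq (n : 'I_N) : R := ln (INR n + alpha).
Definition coef (n : 'I_N) : R := Rpower (INR n + alpha) (- (1 / 2)) * cos (th * freq n) ^ Q.

Lemma csum_fst (F : nat -> C) n : fst (csum F n) = \sum_(i < n) fst (F i).
Proof. elim: n => [|n IH]; first by rewrite big_ord0. by rewrite big_ord_recr /= -IH. Qed.
Lemma csum_snd (F : nat -> C) n : snd (csum F n) = \sum_(i < n) snd (F i).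
Proof. elim: n => [|n IH]; first by rewrite big_ord0. by rewrite big_ord_recr /= -IH. Qed.

Lemma sqnorm_Cmod t : sqnorm 'I_N coef freq t =
  (Cmod (csum (fun n => Cmult (RtoC (cos (th * ln (INR n + alpha)) ^ Q)) (twist (- (1 / 2)) (ln (INR n + alpha)) t)) N)) ^ 2.
Proof.
rewrite /Cmod -Rsqr_pow2 Rsqr_sqrt; last by apply: Rplus_le_le_0_compat; apply: pow2_ge_0.
rewrite csum_fst csum_snd /sqnorm /cos_sum /sin_sum; congr (_ + _).
- congr (_ ^ 2); apply: eq_bigr => n _; rewrite /coef /freq /Rpower /twist /cexp /=.
  have -> : - (1 / 2) * ln (INR n + alpha) - - t * 0 = - (1 / 2) * ln (INR n + alpha) by ring.
  have -> : - (1 / 2) * 0 + - t * ln (INR n + alpha) = - (t * ln (INR n + alpha)) by ring.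
  by rewrite cos_neg; ring.
- set S := \sum_(i < N) snd _.
  suff -> : S = (- 1) * \sum_(n : 'I_N) (coef n * sin (t * freq n)).
    by rewrite Rpow_mult_distr (_ : (- 1) ^ 2 = 1) ?Rmult_1_l //; ring.
  rewrite /S -sumR_mull; apply: eq_bigr => n _; rewrite /coef /freq /Rpower /twist /cexp /=.
  have -> : - (1 / 2) * ln (INR n + alpha) - - t * 0 = - (1 / 2) * ln (INR n + alpha) by ring.
  have -> : - (1 / 2) * 0 + - t * ln (INR n + alpha) = - (t * ln (INR n + alpha)) by ring.
  by rewrite sin_neg; ring.
Qed.

Variables (T : finType) (pr : T -> nat) (g w : T -> R).
Hypothesis pr_prime : forall t, prime (pr t).
Hypothesis pr_inj : injective pr.
Hypothesis pr_cop : forall t, coprime (pr t) q.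
Hypothesis aq : (0 < a < q)%N.
Hypothesis g0 : forall t, 0 <= g t.
Hypothesis g1 : forall t, g t <= 1.
Hypothesis w0 : forall t, 0 <= w t.
Notation E := {ffun T -> 'I_3}.

Lemma q_gt0 : (0 < q)%N. Proof. by case/andP: aq => /leq_trans h /ltnW /h. Qed.

Lemma logn_intval (e : E) t0 : logn (pr t0) (intval T pr e) = e t0.
Proof.
suff [_ ->] : (0 < intval T pr e)%N /\ logn (pr t0) (intval T pr e) = \big[addn/0%N]_(t : T) (if t == t0 then nat_of_ord (e t) else 0%N).
  by rewrite -big_mkcond big_pred1_eq.
rewrite /intval; elim/big_rec2: _ => [|t x y _ [y0 E1]]; first by rewrite logn1.
have pt : (0 < pr t ^ e t)%N by rewrite expn_gt0 prime_gt0.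
split; first by rewrite muln_gt0 pt.
rewrite lognM // lognX logn_prime // E1 /=; congr (_ + _)%N.
case: (t =P t0) => [->|ne]; first by rewrite eqxx muln1.
by rewrite (_ : (pr t0 == pr t) = false) ?muln0 //; apply/eqP => /pr_inj e0; apply: ne.
Qed.

Lemma intval_inj (e e' : E) : intval T pr e = intval T pr e' -> e = e'.
Proof.
by move=> H; apply/ffunP => t; apply: val_inj => /=; rewrite -!logn_intval H.
Qed.

Definition residue (e : E) : 'I_q := Ordinal (ltn_pmod (intval T pr e) q_gt0).

(** The multiplier below [q] that moves [x] into the residue class of [a]. *)
Definition jmul (x : nat) : nat := ((egcdn x q).1 * a) %% q.

Lemma jmul_mod x : (0 < x)%N -> coprime x q -> (jmul x * x = a %[mod q])%N.
Proof.
move=> x0 cop; rewrite /jmul modnMml.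
case: (egcdnP q x0) => u v; rewrite (eqP cop) => H _ /=.
by rewrite -mulnA (mulnC a) mulnA H mulnDl mul1n -mulnA (mulnC q) mulnA modnMDl.
Qed.

Lemma jmul_lt x : (jmul x < q)%N. Proof. by rewrite ltn_pmod // q_gt0. Qed.

Lemma jmul_gt0 x : (0 < x)%N -> coprime x q -> (0 < jmul x)%N.
Proof.
move=> x0 cop; rewrite lt0n; apply/eqP => j0; have := jmul_mod x x0 cop.
rewrite j0 mul0n mod0n; case/andP: aq => a0 aq'; rewrite modn_small // => a00.
by rewrite -a00 in a0.
Qed.

(** The integers [intval e] and [intval e'] are prime to [q] and congruent, hence so are
    the numerator and the denominator of their ratio. *)
Lemma quo_class (e e' : E) : residue e = residue e' -> (quo T pr e e' = quo T pr e' e %[mod q])%N.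
Proof.
move=> /(congr1 val) /= H.
have cop : coprime q (intval T pr e) by rewrite coprime_sym; apply: coprime_prod.
have K : (intval T pr e * quo T pr e e' == intval T pr e * quo T pr e' e %[mod q])%N.
  by rewrite intval_quo -modnMml -H modnMml.
move: (quo T pr e e') (quo T pr e' e) K => x y K; apply/eqP.
wlog le : x y K / (y <= x)%N.
  by move=> W; case: (leqP y x) => [|/ltnW] h; [exact: W | rewrite eq_sym; apply: W; rewrite // eq_sym].
move: K; rewrite !eqn_mod_dvd ?leq_mul // -mulnBr Gauss_dvdr //.
Qed.

Definition lifted_quo (p : E * E) (x : nat) : nat := (jmul (quo T pr p.1 p.2) * x)%N.
(** If [k = q n + a] then [k / q = n + alpha], so a lifted numerator [k] is, up to the
    factor [q], the base of the [n]-th term of the Hurwitz series. *)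
Definition nu1 (p : E * E) : 'I_N := inord (lifted_quo p (quo T pr p.1 p.2) %/ q).
Definition nu2 (p : E * E) : 'I_N := inord (lifted_quo p (quo T pr p.2 p.1) %/ q).

Variables (B Y kap eta d d' : R).
Hypothesis N_big : INR q * exp Y <= INR N.
Hypothesis kap0 : 0 <= kap.
Hypothesis kapP : forall l, - ln (INR q) <= l <= Y -> kap <= cos (th * l) ^ Q.
Hypothesis cos0 : forall n : 'I_N, 0 <= cos (th * freq n).

Let good := good T pr q w residue B Y.

Lemma aq_R : 0 < INR a /\ INR a < INR q.
Proof. case/andP: aq => a0 aq'; split; [exact: (ltn_INR 0 a) | exact: ltn_INR]. Qed.

Lemma quo_le (e e' : E) : ln (INR (quo T pr e e' * quo T pr e' e)) <= Y -> INR (quo T pr e e') <= exp Y.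
Proof.
move=> H; have x0 := leq_INR 1 _ (quo_gt0 T pr pr_prime e e'); have y0 := leq_INR 1 _ (quo_gt0 T pr pr_prime e' e).
rewrite [INR 1]/= in x0 y0; rewrite INRM in H.
have L : ln (INR (quo T pr e e')) <= Y.
  apply: Rle_trans H; apply: ln_le; nra.
rewrite -[X in X <= _]exp_ln; last lra.
exact: exp_mono.
Qed.

Lemma good_point p x : good p -> x = quo T pr p.1 p.2 \/ x = quo T pr p.2 p.1 ->
  [/\ (lifted_quo p x %/ q < N)%N, INR (lifted_quo p x %/ q) + alpha = INR (lifted_quo p x) / INR q, (0 < lifted_quo p x)%N,
    INR (lifted_quo p x) / INR q <= INR x & - ln (INR q) <= ln (INR (lifted_quo p x) / INR q) <= Y].
Proof.
case/and4P => _ _ /eqP cl /RlebP cY Hx.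
have [a0 aq'] := aq_R.
have xy : (x = quo T pr p.1 p.2 %[mod q])%N.
  by case: Hx => -> //; rewrite (quo_class _ _ cl).
have x0 : (0 < x)%N by case: Hx => ->; exact: quo_gt0.
have xY : INR x <= exp Y.
  by case: Hx => ->; apply: quo_le => //; rewrite mulnC.
have cop : coprime (quo T pr p.1 p.2) q by apply: coprime_prod.
have j0 := jmul_gt0 _ (quo_gt0 T pr pr_prime p.1 p.2) cop.
have kmod : (lifted_quo p x %% q = a)%N.
  rewrite /lifted_quo -modnMmr xy modnMmr jmul_mod ?quo_gt0 //.
  by case/andP: aq => _ h; rewrite modn_small.
have k0 : (0 < lifted_quo p x)%N by rewrite muln_gt0 j0.
have kx : INR (lifted_quo p x) / INR q <= INR x.
  apply: (Rmult_le_reg_r (INR q)); first lra.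
  rewrite /Rdiv Rmult_assoc Rinv_l; last lra.
  rewrite Rmult_1_r -INRM; apply: leq_INR; rewrite /lifted_quo mulnC leq_mul2l (ltnW (jmul_lt _)) orbT //.
have k1 := leq_INR 1 _ k0; rewrite [INR 1]/= in k1.
have kq0 : 0 < INR (lifted_quo p x) / INR q by apply: Rdiv_lt_0_compat; lra.
split => //.
- suff H : INR (lifted_quo p x %/ q) < INR N by rewrite ltnNge; apply/negP => /leq_INR; lra.
  have := INR_div_le (lifted_quo p x) q q_gt0.
  have x1 := exp_pos Y.
  have q1 : 1 < INR q by case/andP: aq => h1 h2; have := leq_INR 1 _ h1; rewrite [INR 1]/=; lra.
  nra.
- rewrite {2}(divn_eq (lifted_quo p x) q) kmod INRD INRM /alpha; field; lra.
- split.
  + rewrite -[X in X <= _]Rplus_0_l -ln_1 -[ln 1 + _]/(ln 1 - ln (INR q)) -ln_div; [|lra|lra].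
    apply: ln_le; first by apply: Rdiv_lt_0_compat; lra.
    by apply: Rmult_le_compat_r; [left; apply: Rinv_0_lt_compat; lra | lra].
  + rewrite -[X in _ <= X]ln_exp; apply: ln_le => //; lra.
Qed.

Lemma nu_freq p : good p ->
  freq (nu1 p) = ln (INR (lifted_quo p (quo T pr p.1 p.2)) / INR q) /\ freq (nu2 p) = ln (INR (lifted_quo p (quo T pr p.2 p.1)) / INR q).
Proof.
move=> G; have [n1 E1 _ _ _] := good_point p _ G (or_introl erefl); have [n2 E2 _ _ _] := good_point p _ G (or_intror erefl).
by rewrite /freq /nu1 /nu2 !inordK // E1 E2.
Qed.

Lemma coef_lower (n : 'I_N) (k x : nat) : INR n + alpha = INR k / INR q -> (0 < k)%N ->
  INR k / INR q <= INR x -> - ln (INR q) <= ln (INR k / INR q) <= Y ->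
  kap * / sqrt (INR x) <= coef n.
Proof.
move=> E1 k0 kx kY; rewrite /coef /freq E1 Rmult_comm.
have [a0 aq'] := aq_R; have k1 := leq_INR 1 _ k0; rewrite [INR 1]/= in k1.
have kq0 : 0 < INR k / INR q by apply: Rdiv_lt_0_compat; lra.
have -> : - (1 / 2) = - / 2 by field.
rewrite Rpower_Ropp Rpower_sqrt //.
apply: Rmult_le_compat => //; first by left; apply: Rinv_0_lt_compat; apply: sqrt_lt_R0; lra.
- apply: Rinv_le_contravar; first exact: sqrt_lt_R0.
  by apply: sqrt_le_1; lra.
- exact: kapP.
Qed.

(** Combines [resonance] and [gcd_sum_lower]: on a good pair the product of the two
    coefficients is at least [kap ^ 2 * kern], since [k / q] is at most the numerator
    it came from.  The factor [total] occurs on both sides and cancels. *)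
Theorem resonance_hurwitz V0 V X2 : (0 < V)%N ->
  (forall v, (V0 <= v < V)%N -> sqnorm 'I_N coef freq (INR v) <= X2) -> 0 <= X2 ->
  0 <= eta <= 1 / 2 -> (forall t, 2 * g t ^ 2 + 4 * (g t * prime_rsqrt T pr t) <= eta) ->
  0 <= d -> (forall t, d * w t <= eta) -> 0 <= d' -> (forall t, d' * ln (INR (pr t)) <= 1 / 2) ->
  kap ^ 2 * (/ INR q * exp (4 * (1 - eta) * \sum_(t : T) (g t * prime_rsqrt T pr t))
    - 2 * exp (d * (1 + 2 * eta) * \sum_(t : T) (2 * g t ^ 2 * w t) + 10 * \sum_(t : T) (g t * prime_rsqrt T pr t) - d * B)
    - exp (16 * \sum_(t : T) (g t * prime_rsqrt T pr t) - d' * Y))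
  <= 4 * (2 * (INR V0 / INR V) * (\sum_(n : 'I_N) coef n) ^ 2 * exp (B + 2 * \sum_(t : T) exp (- w t)) + 8 * X2).
Proof.
move=> V_gt0 HX X20 Heta small d0 dw d0' dp.
have [aa0 aq'] := aq_R.
have tot0 := total_gt0 T g g0.
have coef0 n : 0 <= coef n.
  by apply: Rmult_le_pos; [left; exact: exp_pos | apply: pow_le].
have L := gcd_sum_lower T pr q g w pr_prime q_gt0 g0 w0 g1 residue B Y eta d d' Heta small d0 dw d0' dp.
set Z := (X in kap ^ 2 * X); rewrite -/Z in L.
have R := resonance V N V_gt0 coef freq E (light T w B) (amp T g) (fun e => ln (INR (intval T pr e))) good nu1 nu2.
have kern_le p : good p -> kap ^ 2 * kern T pr p.1 p.2 <= coef (nu1 p) * coef (nu2 p).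
{ move=> G.
  have [n1 E1 k1 x1 l1] := good_point p _ G (or_introl erefl); have [n2 E2 k2 x2 l2] := good_point p _ G (or_intror erefl).
  rewrite kern_quo // INRM sqrt_mult; [|exact: pos_INR|exact: pos_INR].
  rewrite Rinv_mult.
  have -> : kap ^ 2 * (/ sqrt (INR (quo T pr p.1 p.2)) * / sqrt (INR (quo T pr p.2 p.1)))
    = (kap * / sqrt (INR (quo T pr p.1 p.2))) * (kap * / sqrt (INR (quo T pr p.2 p.1))) by ring.
  have sp x : (0 < x)%N -> 0 <= kap * / sqrt (INR x).
    move=> x0; apply: Rmult_le_pos => //; left; apply: Rinv_0_lt_compat; apply: sqrt_lt_R0; exact: (ltn_INR 0 x).
  apply: Rmult_le_compat.
  - exact: sp (quo_gt0 T pr pr_prime _ _).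
  - exact: sp (quo_gt0 T pr pr_prime _ _).
  - by apply: (coef_lower _ (lifted_quo p (quo T pr p.1 p.2))); rewrite /nu1 ?inordK.
  - by apply: (coef_lower _ (lifted_quo p (quo T pr p.2 p.1))); rewrite /nu2 ?inordK. }
have freq_good p : good p -> freq (nu1 p) + ln (INR (intval T pr p.1)) = freq (nu2 p) + ln (INR (intval T pr p.2)).
  move=> G; have [-> ->] := nu_freq p G.
  have [_ _ k1 _ _] := good_point p _ G (or_introl erefl); have [_ _ k2 _ _] := good_point p _ G (or_intror erefl).
  have K1 := ltn_INR 0 _ k1; have K2 := ltn_INR 0 _ k2; rewrite [INR 0]/= in K1 K2.
  have I1 := ltn_INR 0 _ (intval_gt0 T pr pr_prime p.1); have I2 := ltn_INR 0 _ (intval_gt0 T pr pr_prime p.2).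
  rewrite [INR 0]/= in I1 I2.
  rewrite !ln_div //; [|lra|lra].
  suff : ln (INR (lifted_quo p (quo T pr p.1 p.2))) + ln (INR (intval T pr p.1)) =
    ln (INR (lifted_quo p (quo T pr p.2 p.1))) + ln (INR (intval T pr p.2)) by lra.
  rewrite -!ln_mult // -!INRM; congr (ln (INR _)).
  by rewrite /lifted_quo -!mulnA; congr (_ * _)%N; rewrite ![(quo _ _ _ _ * _)%N]mulnC intval_quo.
have mu_inj e e' : ln (INR (intval T pr e)) = ln (INR (intval T pr e')) -> e = e'.
  move=> H; apply: intval_inj; apply: INR_eq; apply: ln_inv => //; exact: (ltn_INR 0 _ (intval_gt0 T pr pr_prime _)).
have GM p : good p -> light T w B p.1 && light T w B p.2 by move=> /and4P[-> ->].
have G1 p p' : good p -> good p' -> nu1 p = nu1 p' -> nu2 p = nu2 p' -> p.1 = p'.1 -> p.2 = p'.2.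
  by move=> G G' e1 e2 e3; apply: mu_inj; have := freq_good p G; have := freq_good p' G'; rewrite e1 e2 e3; lra.
have G2 p p' : good p -> good p' -> nu1 p = nu1 p' -> nu2 p = nu2 p' -> p.2 = p'.2 -> p.1 = p'.1.
  by move=> G G' e1 e2 e3; apply: mu_inj; have := freq_good p G; have := freq_good p' G'; rewrite e1 e2 e3; lra.
have {}R := R coef0 (amp_ge0 T g g0) GM freq_good G1 G2 V0 X2 HX X20.
have HR : \sum_(p | good p) (amp T g p.1 * amp T g p.2 * (coef (nu1 p) * coef (nu2 p))) <=
   4 * total T g * (2 * (INR V0 / INR V) * (\sum_(n : 'I_N) coef n) ^ 2 * exp (B + 2 * \sum_(t : T) exp (- w t)) + 8 * X2).
{ apply: (Rle_trans _ _ _ R).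
  have V1 : 0 < INR V := ltn_INR 0 V V_gt0.
  have V00 : 0 <= INR V0 / INR V by apply: Rdiv_le_0_compat => //; exact: pos_INR.
  have D2 := pow2_ge_0 (\sum_(n : 'I_N) coef n).
  apply: Rmult_le_compat.
  - by apply: Rmult_le_pos; [lra | apply: sumR_ge0 => e _; exact: pow2_ge_0].
  - apply: Rplus_le_le_0_compat; last lra.
    by apply: Rmult_le_pos; [apply: Rmult_le_pos => //; lra | exact: pos_INR].
  - apply: Rmult_le_compat_l; first lra.
    apply: (Rle_trans _ (\sum_(e : E) (amp T g e ^ 2))).
      by apply: sumR_sub_le => // e _; exact: pow2_ge_0.
    right; rewrite /total (eq_bigr (fun e : E => \prod_(t : T) (if (e t == 1 :> nat)%N then 1 else g t ^ 2))); last first.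
      move=> e _; rewrite /amp -Rsqr_pow2 /Rsqr -big_split /=; apply: eq_bigr => t _; case: ifP => _; ring.
    rewrite (tensor1 T (fun t i => if (i == 1 :> nat)%N then 1 else g t ^ 2)); apply: eq_bigr => t _.
    by rewrite sum3 !inordK //=; ring.
  - apply: Rplus_le_compat_r; apply: Rmult_le_compat_l; first by apply: Rmult_le_pos => //; lra.
    exact: card_light. }
have LR : kap ^ 2 * \sum_(p : E * E | good p) term T pr g p <=
   \sum_(p | good p) (amp T g p.1 * amp T g p.2 * (coef (nu1 p) * coef (nu2 p))).
  rewrite -sumR_mull; apply: sumR_le => p G.
  rewrite /term; set A := amp T g p.1 * amp T g p.2.
  have -> : kap ^ 2 * (A * kern T pr p.1 p.2) = A * (kap ^ 2 * kern T pr p.1 p.2) by ring.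
  by apply: Rmult_le_compat_l; [apply: Rmult_le_pos; exact: amp_ge0 | exact: kern_le].
have kap2 := pow2_ge_0 kap.
apply: (Rmult_le_reg_l (total T g)) => //.
have LL := Rmult_le_compat_l _ _ _ kap2 L; rewrite -/good in LL.
have -> : total T g * (kap ^ 2 * Z) = kap ^ 2 * (total T g * Z) by ring.
apply: (Rle_trans _ _ _ LL); apply: (Rle_trans _ _ _ LR); apply: (Rle_trans _ _ _ HR).
by right; ring.
Qed.
End Coincidences.

(** * The family of primes *)

Lemma div_mulK x y : y <> 0 -> x / y * y = x.
Proof. by move=> y0; field. Qed.
Lemma mul_divK x y : y <> 0 -> y * (x / y) = x.
Proof. by move=> y0; field. Qed.

(** The main application has [z = log_2 T], so that [exp z = log T] and
    [ln z = log_3 T]. *)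
Definition for_large (P : R -> Prop) : Prop := exists Z, forall z, Z <= z -> P z.

Lemma for_large_and P Q : for_large P -> for_large Q -> for_large (fun z => P z /\ Q z).
Proof.
move=> [Z H] [Z' H']; exists (Rmax Z Z') => z Hz.
by split; [apply: H; have := Rmax_l Z Z' | apply: H'; have := Rmax_r Z Z']; lra.
Qed.

Lemma for_large_imp (P Q : R -> Prop) : (forall z, P z -> Q z) -> for_large P -> for_large Q.
Proof. by move=> PQ [Z H]; exists Z => z Hz; apply: PQ; apply: H. Qed.

Lemma for_large_ge C : for_large (fun z => C <= z).
Proof. by exists C. Qed.

Lemma for_large_comp (P : R -> Prop) (h : R -> R) : (forall C, for_large (fun z => C <= h z)) -> for_large P -> for_large (fun z => P (h z)).
Proof. by move=> Hh [Z H]; have [Z' H'] := Hh Z; exists Z' => z /H' /H. Qed.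

Lemma for_large_exp r : 0 < r -> forall C, for_large (fun z => C <= exp (r * z)).
Proof.
move=> r0 C; exists (C / r) => z Hz.
have := exp_ineq1_le (r * z).
have := Rmult_le_compat_l r _ _ (Rlt_le _ _ r0) Hz.
have -> : r * (C / r) = C by field; lra.
lra.
Qed.

Lemma for_large_ln C : for_large (fun z => C <= ln z).
Proof.
exists (exp C) => z Hz; rewrite -[X in X <= _]ln_exp; apply: ln_le => //; exact: exp_pos.
Qed.

Lemma exp_INR_mul j y : exp (INR j * y) = exp y ^ j.
Proof.
elim: j => [|j IH]; first by rewrite /= Rmult_0_l exp_0.
by rewrite -tech_pow_Rmult -IH S_INR -exp_plus; congr exp; ring.
Qed.

Lemma for_large_pow_exp (k : nat) C r : 0 < r -> for_large (fun z => C * z ^ k <= exp (r * z)).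
Proof.
move=> r0; set m := INR k.+1.
have m0 : 0 < m := ltn_INR 0 k.+1 isT.
have rm : 0 < r / m by apply: Rdiv_lt_0_compat.
exists (Rmax 1 (Rabs C / (r / m) ^ k.+1)) => z Hz.
have z1 : 1 <= z by have := Rmax_l 1 (Rabs C / (r / m) ^ k.+1); lra.
have z2 : Rabs C / (r / m) ^ k.+1 <= z by have := Rmax_r 1 (Rabs C / (r / m) ^ k.+1); lra.
have -> : exp (r * z) = exp (r / m * z) ^ k.+1.
  have -> : r * z = INR k.+1 * (r / m * z) by rewrite -/m; field; lra.
  by rewrite exp_INR_mul.
have P1 : 0 < (r / m) ^ k.+1 by apply: pow_lt.
have zk : 0 < z ^ k by apply: pow_lt; lra.
apply: (Rle_trans _ ((r / m * z) ^ k.+1)); last first.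
  apply: pow_incr; split; first by apply: Rmult_le_pos; lra.
  have := exp_ineq1_le (r / m * z); lra.
rewrite Rpow_mult_distr -[z ^ k.+1]tech_pow_Rmult -Rmult_assoc; apply: Rmult_le_compat_r; first lra.
have := Rmult_le_compat_r _ _ _ (Rlt_le _ _ P1) z2.
rewrite ?div_mulK ?mul_divK; try lra.
have := Rle_abs C; lra.
Qed.

Lemma ln_le_lin r : 0 < r -> forall K, for_large (fun z => K + ln z <= r * z).
Proof.
move=> r0 K; have [Z HZ] := for_large_pow_exp 1 (exp K) r r0.
exists (Rmax 1 Z) => z Hz.
have z1 := Rmax_l 1 Z; have z2 := Rmax_r 1 Z.
have := HZ z ltac:(lra); rewrite pow_1 => H.
have E1 := exp_pos K.
have : ln (exp K * z) <= ln (exp (r * z)) by apply: ln_le => //; apply: Rmult_lt_0_compat; lra.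
by rewrite ln_mult ?ln_exp //; lra.
Qed.

Definition res_scale (g0 z : R) : R := g0 * exp z * z / ln z.

(** The blocks run from a constant index [i0], which keeps [ln (p / G)] above [X0], to
    [eta * ln G / H].  Their sum is [ln (i1 / i0) / ln G], about [ln z / z], since [ln G] is
    [z] to first order. *)
Lemma prime_family (eta g0 X0 : R) (q : nat) : 0 < eta <= 1 / 2 -> 0 < g0 -> for_large (fun z =>
  let G := res_scale g0 z in let lam := ln G in
  [/\ 1 < z, 1 < ln z, z <= lam <= (1 + eta) * z, g0 * exp z <= G & 0 < G] /\
  exists (T : finType) (pr : T -> nat), [/\ injective pr,
   (forall t, prime (pr t)), (forall t, (q < pr t)%N), (forall t, X0 <= ln (INR (pr t) / G) <= eta * lam)
   & (1 - eta) ^ 2 / (1 + eta) ^ 2 * (ln z / z) <= \sum_(t : T) / (INR (pr t) * ln (INR (pr t) / G)) <= (1 + eta) ^ 2 * (ln z / z)]).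
Proof.
move=> [eta0 eta1] g00.
set H := 40 / eta.
have H40 : 40 <= H.
  rewrite /H; apply: (Rmult_le_reg_r eta) => //; rewrite ?div_mulK ?mul_divK; lra.
have H20 : 20 / H = eta / 2 by rewrite /H; field; lra.
pose i0 := (nat_floor (Rabs X0)).+3.
have i02 : (2 <= i0)%N by [].
have i0X : X0 <= INR i0 * H.
  have [_ F1] := nat_floorP (Rabs X0) (Rabs_pos _); have := Rle_abs X0; have := pos_INR (nat_floor (Rabs X0)).
  rewrite /i0 !S_INR; nra.
have I0 := leq_INR 2 i0 i02; rewrite [INR 2]/= in I0.
have lnln : forall K, for_large (fun z => K + ln (ln z) <= ln z).
  by move=> K; apply: (for_large_imp _ _ _ (for_large_comp _ ln for_large_ln (ln_le_lin 1 Rlt_0_1 K))) => z; rewrite Rmult_1_l.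
have e3 := lnln (Rabs (ln g0)).
have e4 := ln_le_lin eta eta0 (Rabs (ln g0)).
have e5 := for_large_ge (Rmax 2 ((INR i0 + 1) * H / eta)).
have e6 := for_large_ln (Rmax 2 ((ln (H / eta) + ln (INR i0 + 1)) / eta)).
have e7 : for_large (fun z => (INR q + 1) / g0 <= exp (1 * z)) := for_large_exp 1 Rlt_0_1 _.
apply: for_large_imp (for_large_and _ _ (for_large_and _ _ e3 e4) (for_large_and _ _ (for_large_and _ _ e5 e6) e7)) => z [[{}e3 {}e4] [[{}e5 {}e6] {}e7]].
have z2 : 2 <= z by apply: Rle_trans e5; exact: Rmax_l.
have z3 : (INR i0 + 1) * H / eta <= z by apply: Rle_trans e5; exact: Rmax_r.
have u2 : 2 <= ln z by apply: Rle_trans e6; exact: Rmax_l.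
have u3 : (ln (H / eta) + ln (INR i0 + 1)) / eta <= ln z by apply: Rle_trans e6; exact: Rmax_r.
clear e5 e6; rewrite Rmult_1_l in e7.
set u := ln z in e3 e4 u2 u3 *; cbv zeta.
set G := res_scale g0 z; set lam := ln G.
have ez := exp_pos z.
have G0 : 0 < G by apply: Rdiv_lt_0_compat; [repeat apply: Rmult_lt_0_compat; lra | rewrite -/u; lra].
have uz : u <= z by apply: ln_le_self; lra.
have Gge : g0 * exp z <= G.
  rewrite /G /res_scale -/u; apply: (Rmult_le_reg_r u); first lra.
  rewrite ?div_mulK ?mul_divK; try lra.
  by rewrite Rmult_assoc (Rmult_assoc g0); apply: Rmult_le_compat_l; [lra|apply: Rmult_le_compat_l; lra].
have lamE : lam = ln g0 + z + u - ln u.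
  rewrite /lam /G /res_scale -/u ln_div; [|by repeat apply: Rmult_lt_0_compat; lra|lra].
  rewrite ln_mult; [|exact: Rmult_lt_0_compat|lra].
  rewrite ln_mult // ln_exp -/u; lra.
have A1 := Rle_abs (ln g0); have A2 := Rle_abs (- ln g0); rewrite Rabs_Ropp in A2.
have lu0 : 0 <= ln u by rewrite -ln_1; apply: ln_le; lra.
have lamz : z <= lam <= (1 + eta) * z by rewrite lamE; lra.
have Gq : INR q + 1 <= G.
  apply: Rle_trans Gge; have := Rmult_le_compat_l _ _ _ (Rlt_le _ _ g00) e7.
  by rewrite (_ : g0 * ((INR q + 1) / g0) = INR q + 1) //; field; lra.
have G1 : 1 < G.
  have P : 0 < lam by lra.
  by rewrite -(exp_ln G) // -exp_0; apply: exp_increasing.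
split; first by split => //; lra.
have H0 : 0 < H by lra.
pose i1 := nat_floor (eta * lam / H).
have Y0 : INR i0 + 1 <= eta * lam / H.
  apply: (Rmult_le_reg_r (H / eta)); first exact: Rdiv_lt_0_compat.
  rewrite (_ : eta * lam / H * (H / eta) = lam); last by field; lra.
  apply: (Rle_trans _ ((INR i0 + 1) * H / eta)); last lra.
  right; field; lra.
have [J1 J2] := nat_floorP (eta * lam / H) ltac:(lra); rewrite -/i1 in J1 J2.
have i01 : (i0 <= i1)%N.
  by rewrite leqNgt; apply/negP => /leq_INR; rewrite S_INR; lra.
pose s := [seq p <- index_iota (win G H i0).+1 (win G H i1).+1 | prime p].
have us : uniq s by rewrite filter_uniq // iota_uniq.
have i1H : INR i1 * H <= eta * lam.
  have := Rmult_le_compat_r _ _ _ (Rlt_le _ _ H0) J1.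
  by rewrite (_ : eta * lam / H * H = eta * lam) //; field; lra.
have mems p : p \in s -> [/\ prime p, (win G H i0 < p)%N & (p <= win G H i1)%N].
  by rewrite mem_filter mem_index_iota ltnS => /and3P[].
exists 'I_(size s), (tnth (in_tuple s)); split.
- by apply/tuple_uniqP.
- by move=> t; have [] := mems _ (mem_tnth t (in_tuple s)).
- move=> t; have [pp p1 p2] := mems _ (mem_tnth t (in_tuple s)).
  have L := win_log G H G1 H40 _ _ p1.
  set p := tnth _ _ in pp p1 p2 L *.
  have p0 : 0 < INR p := ltn_INR 0 p (prime_gt0 pp).
  have L0 : 0 <= ln (INR p / G) by apply: Rle_trans L; apply: Rmult_le_pos; lra.
  have pG : G <= INR p.
    apply: Rnot_lt_le => lt; have : ln (INR p / G) < 0; last lra.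
    rewrite -ln_1; apply: ln_increasing; first exact: Rdiv_lt_0_compat.
    apply: (Rmult_lt_reg_r G) => //; rewrite ?div_mulK ?mul_divK; lra.
  by rewrite ltnNge; apply/negP => /leq_INR; lra.
- move=> t; have [pp p1 p2] := mems _ (mem_tnth t (in_tuple s)).
  have L := win_log G H G1 H40 _ _ p1.
  have L2 := win_log_le G H G1 H40 _ _ (prime_gt0 pp) p2.
  by split; [apply: Rle_trans L; exact: i0X | apply: (Rle_trans _ _ _ L2); exact: i1H].
- have -> : \sum_(t < size s) / (INR (tnth (in_tuple s) t) * ln (INR (tnth (in_tuple s) t) / G)) = wsum G H i0 i1.
    rewrite /wsum -big_filter -/s.
    by rewrite (big_tnth _ _ s).
  have K := wsum_bounds G H G1 H40 i0 (i1 - i0) eta (Rlt_le _ _ eta0) i02.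
  rewrite subnKC // in K; have [K1 K2] := K i1H.
  rewrite H20 -/lam in K1 K2.
  have I1 := leq_INR _ _ i01.
  have l1 : 0 <= ln (INR i0 - 1) by rewrite -ln_1; apply: ln_le; lra.
  have l2 : ln (INR i1 - 1) <= ln lam.
    apply: ln_le; first lra.
    have : eta * lam / H <= lam; last lra.
    apply: (Rmult_le_reg_r H) => //; rewrite ?div_mulK ?mul_divK; try lra.
    nra.
  have l3 : ln lam <= (1 + eta) * u.
    apply: (Rle_trans _ (ln ((1 + eta) * z))); first by apply: ln_le; lra.
    rewrite ln_mult; [|lra|lra]; rewrite -/u.
    have : ln (1 + eta) <= eta; last nra.
    rewrite -[X in _ <= X]ln_exp; apply: ln_le; first lra; exact: exp_ineq1_le.
  have l4 : u - ln (H / eta) <= ln (INR i1 + 1).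
    apply: (Rle_trans _ (ln (eta * lam / H))); last by apply: ln_le; lra.
    have -> : eta * lam / H = lam / (H / eta) by field; lra.
    have HE : 0 < H / eta by apply: Rdiv_lt_0_compat.
    rewrite (ln_div lam); [|lra|lra].
    have ul : u <= ln lam by apply: ln_le; lra.
    lra.
  have l5 : (1 - eta) * u <= ln (INR i1 + 1) - ln (INR i0 + 1).
    have := Rmult_le_compat_l _ _ _ (Rlt_le _ _ eta0) u3.
    rewrite (_ : eta * ((ln (H / eta) + ln (INR i0 + 1)) / eta) = ln (H / eta) + ln (INR i0 + 1)); last by field; lra.
    lra.
  have iz : 0 < / z by apply: Rinv_0_lt_compat; lra.
  have ilam : / lam <= / z by apply: Rinv_le_contravar; lra.
  split.
  + apply: Rle_trans K1.
    have -> : (1 - eta) ^ 2 / (1 + eta) ^ 2 * (u / z) = ((1 - eta) / ((1 + eta) * ((1 + eta) * z))) * ((1 - eta) * u) by field; lra.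
    apply: Rmult_le_compat; try lra.
    * by apply: Rdiv_le_0_compat; [lra | repeat apply: Rmult_lt_0_compat; lra].
    * by apply: Rmult_le_pos; lra.
    * apply: Rmult_le_compat; try lra.
        by left; apply: Rinv_0_lt_compat; repeat apply: Rmult_lt_0_compat; lra.
      apply: Rinv_le_contravar; first by apply: Rmult_lt_0_compat; lra.
      by apply: Rmult_le_compat_l; lra.
  + apply: (Rle_trans _ _ _ K2).
    have -> : (1 + eta) ^ 2 * (u / z) = ((1 + eta) * / z) * ((1 + eta) * u) by field; lra.
    apply: Rmult_le_compat.
    * by apply: Rdiv_le_0_compat; lra.
    * have i01l : ln (INR i0 - 1) <= ln (INR i1 - 1) by apply: ln_le; lra.
      lra.
    * apply: Rmult_le_compat; try lra.
      by left; apply: Rinv_0_lt_compat; lra.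
    * lra.
Qed.

(** * Choice of the smoothing parameters *)

Lemma cos_bounds x : -1 <= x <= 1 -> 1 - x ^ 2 / 2 <= cos x <= 1 - x ^ 2 / 3.
Proof.
move=> [h1 h2]; have [C1 C2] := pre_cos_bound x 0 ltac:(lra) ltac:(lra).
have E1 : cos_approx x (2 * 0 + 1) = 1 - x ^ 2 / 2.
  by rewrite /cos_approx /cos_term /=; field.
have E2 : cos_approx x (2 * (0 + 1)) = 1 - x ^ 2 / 2 + x ^ 4 / 24.
  by rewrite /cos_approx /cos_term /=; field.
rewrite E1 in C1; rewrite E2 in C2; split => //.
have x2 : 0 <= x ^ 2 <= 1 by nra.
have x4 : x ^ 4 <= x ^ 2 by rewrite (_ : x ^ 4 = x ^ 2 * x ^ 2); [nra | ring].
lra.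
Qed.

Lemma cos_exp_bounds x : -1 <= x <= 1 -> exp (- x ^ 2) <= cos x <= exp (- (x ^ 2 / 3)).
Proof.
move=> hx; have [C1 C2] := cos_bounds x hx; split; last first.
  apply: (Rle_trans _ _ _ C2); have := exp_ineq1_le (- (x ^ 2 / 3)); lra.
apply: Rle_trans C1; have x2 : 0 <= x ^ 2 <= 1 by nra.
have Y := exp_ineq1_le (x ^ 2); rewrite exp_Ropp.
have Xp := exp_pos (x ^ 2).
apply: (Rmult_le_reg_r (exp (x ^ 2))) => //; rewrite Rinv_l; last lra.
apply: (Rle_trans _ ((1 - x ^ 2 / 2) * (1 + x ^ 2))); first nra.
by apply: Rmult_le_compat_l; lra.
Qed.

Lemma sum_inv_le n : \sum_(i < n.+1) / INR i.+1 <= 1 + ln (INR n.+1).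
Proof.
elim: n => [|n IH]; first by rewrite big_ord_recr big_ord0 /= ln_1; lra.
rewrite big_ord_recr.
have n0 : 0 < INR n.+1 := ltn_INR 0 n.+1 isT.
have Ls := ln_succ_ge (INR n.+1) n0; rewrite -S_INR in Ls.
apply: (Rle_trans _ (1 + ln (INR n.+1) + / INR n.+2)); first exact: Rplus_le_compat_r.
lra.
Qed.

Section Smooth.
Variables (a q : nat) (b eps : R).
Hypothesis aq : (0 < a < q)%N.
Hypothesis eps_range : 0 < eps <= b / 2.
Hypothesis b1 : b <= 1.
(* with [l = log T], the step [th l] keeps every [th l * ln (n + alpha)] in [-1, 1],
   where the cosine is positive; the 7 in [Q1] is just above 27/4, where the
   discriminant in [cos_decay] becomes negative *)
Let Q1 := 7 / eps.
Let th l := / (6 * l).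
Let Q l := (nat_floor (Q1 * l)).+2.
Let N' l := (nat_floor (exp (5 * l))).+1.
Let alpha := INR a / INR q.

Lemma alpha_range : 0 < alpha < 1 /\ 1 < INR q /\ / INR q <= alpha.
Proof.
case/andP: aq => a0 aq'; have A0 := leq_INR 1 a a0; have A1 := ltn_INR a q aq'; rewrite [INR 1]/= in A0.
have q0 : 0 < / INR q by apply: Rinv_0_lt_compat; lra.
rewrite /alpha; split; last first.
  by split; [lra|]; rewrite -[X in X <= _]Rmult_1_l; apply: Rmult_le_compat_r; lra.
split; first by apply: Rdiv_lt_0_compat; lra.
apply: (Rmult_lt_reg_r (INR q)); first lra.
by rewrite div_mulK; lra.
Qed.

Lemma Q1_ge : 14 <= Q1.
Proof.
rewrite /Q1; apply: (Rmult_le_reg_r eps); first lra.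
rewrite div_mulK; lra.
Qed.

Definition large l := [/\ 1 <= l, 5 <= exp l, Q1 + 3 <= exp (b * l), 32 <= exp (l / 4) & 
  [/\ (12 * Q1 + 3) * l <= exp (b / 2 * l), (INR q + 7) * l <= exp (eps * l), ln (INR q) <= l & INR q <= exp l]].

Lemma large_ev : for_large large.
Proof.
have b0 : 0 < b by lra.
have e1 := for_large_ge 1. have e2 := for_large_exp 1 Rlt_0_1 5; have e3 := for_large_exp b b0 (Q1 + 3).
have e4 := for_large_exp (/ 4) ltac:(lra) 32.
have e5 := for_large_pow_exp 1 (12 * Q1 + 3) (b / 2) ltac:(lra).
have e6 := for_large_pow_exp 1 (INR q + 7) eps ltac:(lra).
have e7 := for_large_ge (ln (INR q)); have e8 := for_large_exp 1 Rlt_0_1 (INR q).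
apply: for_large_imp (for_large_and _ _ (for_large_and _ _ (for_large_and _ _ e1 e2) (for_large_and _ _ e3 e4)) (for_large_and _ _ (for_large_and _ _ e5 e6) (for_large_and _ _ e7 e8))).
move=> l; rewrite !pow_1 !Rmult_1_l => -[[[H1 H2] [H3 H4]] [[H5 H6] [H7 H8]]].
by split => //; rewrite /Rdiv Rmult_comm.
Qed.

Variable l : R.
Hypothesis Hl : large l.
Let L := ln (INR (N' l).+1 + alpha).

Lemma N_ge : exp (5 * l) <= INR (N' l).+1 - 1.
Proof.
have [F1 F2] := nat_floorP _ (Rlt_le _ _ (exp_pos (5 * l))).
by rewrite /N' !S_INR; lra.
Qed.

Lemma L_le : 0 <= L <= 6 * l.
Proof.
have [l1 l5 _ _ _] := Hl; have [al _] := alpha_range.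
have [F1 F2] := nat_floorP _ (Rlt_le _ _ (exp_pos (5 * l))).
have F0 := pos_INR (nat_floor (exp (5 * l))).
rewrite /L /N' !S_INR; split; first by rewrite -ln_1; apply: ln_le; lra.
rewrite -[X in _ <= X]ln_exp; apply: ln_le; first lra.
have -> : exp (6 * l) = exp (5 * l) * exp l by rewrite -exp_plus; congr exp; ring.
have E5 : 1 <= exp (5 * l) by have := exp_ineq1_le (5 * l); lra.
nra.
Qed.

Lemma th_range x : - ln (INR q) <= x <= 6 * l -> -1 <= th l * x <= 1.
Proof.
have [l1 _ _ _ [_ _ ql _]] := Hl => Hx; rewrite /th.
have i0 : 0 < / (6 * l) by apply: Rinv_0_lt_compat; lra.
have E : / (6 * l) * (6 * l) = 1 by apply: Rinv_l; lra.
by nra.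
Qed.

Lemma freq_range (n : 'I_(N' l).+1) : - ln (INR q) <= freq a q (N' l) n <= 6 * l.
Proof.
have [al [q1 qa]] := alpha_range; have [L0 L6] := L_le.
rewrite /freq -/alpha; have n0 := pos_INR n; split.
  rewrite -ln_Rinv; last lra.
  by apply: ln_le; [apply: Rinv_0_lt_compat | ]; lra.
apply: Rle_trans L6; apply: ln_le; first lra.
have := leq_INR n _ (ltnW (ltn_ord n)); lra.
Qed.

Lemma cos_nonneg x : - ln (INR q) <= x <= 6 * l -> 0 <= cos (th l * x).
Proof. move=> /th_range H; have [C1 _] := cos_bounds _ H; nra. Qed.

Lemma Qth : INR (Q l) * th l <= Q1.
Proof.
have [l1 _ _ _ _] := Hl; have Q14 := Q1_ge.
have [F1 F2] := nat_floorP (Q1 * l) ltac:(nra).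
rewrite /th /Q !S_INR; apply: (Rmult_le_reg_r (6 * l)); first lra.
rewrite Rmult_assoc Rinv_l; last lra.
nra.
Qed.

Lemma Q_ge : Q1 * l <= INR (Q l - 1).
Proof.
have [l1 _ _ _ _] := Hl; have Q14 := Q1_ge.
have [F1 F2] := nat_floorP (Q1 * l) ltac:(nra).
by rewrite /Q subn1 /= -/(INR (nat_floor (Q1 * l)).+1) S_INR; lra.
Qed.

Lemma exp_pow x n : exp x ^ n = exp (INR n * x).
Proof. by rewrite exp_INR_mul. Qed.

(** The Gaussian decay of the smoothing factor beats the growth [exp (x / 2)] up to
    [exp (eps * l)], because [x / 2] is at most [eps * l + 7 x^2 / (108 eps l)]. *)
Lemma cos_decay x : 0 <= x <= L -> exp (x / 2) * cos (th l * x) ^ (Q l - 1) <= exp (eps * l).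
Proof.
move=> [x0 xL]; have [l1 _ _ _ [_ _ ql _]] := Hl; have [L0 L6] := L_le; have Q14 := Q1_ge.
have [al [q1 _]] := alpha_range.
have lq : 0 <= ln (INR q) by exact: ln_INR_ge0.
have xr : - ln (INR q) <= x <= 6 * l by lra.
have [_ C2] := cos_exp_bounds _ (th_range x xr).
apply: (Rle_trans _ (exp (x / 2) * exp (- ((th l * x) ^ 2 / 3)) ^ (Q l - 1))).
  apply: Rmult_le_compat_l; first by left; exact: exp_pos.
  by apply: pow_incr; split => //; exact: cos_nonneg.
rewrite exp_pow -exp_plus; apply: exp_mono.
have Qg := Q_ge.
have sq0 : 0 <= (th l * x) ^ 2 / 3 by have := pow2_ge_0 (th l * x); lra.
have := Rmult_le_compat_r _ _ _ sq0 Qg.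
have -> : Q1 * l * ((th l * x) ^ 2 / 3) = 7 / (108 * eps * l) * x ^ 2 by rewrite /Q1 /th; field; lra.
move=> H; suff : x / 2 - eps * l <= 7 / (108 * eps * l) * x ^ 2 by lra.
(* AM-GM: the discriminant 1/4 - 28/108 is negative *)
have el : 0 < eps * l by nra.
apply: (Rmult_le_reg_r (108 * (eps * l))); first lra.
have -> : 7 / (108 * eps * l) * x ^ 2 * (108 * (eps * l)) = 7 * x ^ 2 by field; lra.
have := pow2_ge_0 (7 * x - 27 * (eps * l)); nra.
Qed.

(** The reduced fractions used by the resonator have logarithm at most a [Y] of order
    [sqrt l] up to powers of [ln l], so the exponent on the left is a power of [ln l]
    and the smoothing costs only a lower order term. *)
Lemma kappa Y : 0 <= Y <= l -> forall x, - ln (INR q) <= x <= Y ->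
  exp (- (Q1 / l * (Y + ln (INR q)) ^ 2)) <= cos (th l * x) ^ Q l.
Proof.
move=> [Y0 Yl] x Hx; have [l1 _ _ _ [_ _ ql _]] := Hl; have Q14 := Q1_ge.
have lq : 0 <= ln (INR q) by exact: ln_INR_ge0.
have xr : - ln (INR q) <= x <= 6 * l by lra.
have [C1 _] := cos_exp_bounds _ (th_range x xr).
apply: (Rle_trans _ (exp (- (th l * x) ^ 2) ^ Q l)); last first.
  by apply: pow_incr; split => //; left; exact: exp_pos.
rewrite exp_pow; apply: exp_mono.
have [F1 F2] := nat_floorP (Q1 * l) ltac:(nra).
have x2 : x ^ 2 <= (Y + ln (INR q)) ^ 2 by nra.
have Q2 : INR (Q l) <= 36 * (Q1 * l) by rewrite /Q !S_INR; nra.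
have t0 : 0 <= (th l) ^ 2 := pow2_ge_0 _.
have -> : Q1 / l * (Y + ln (INR q)) ^ 2 = (36 * (Q1 * l)) * ((th l) ^ 2 * (Y + ln (INR q)) ^ 2).
  by rewrite /th; field; lra.
rewrite Rpow_mult_distr.
have P := Rmult_le_compat _ _ _ _ (pos_INR (Q l)) (Rmult_le_pos _ _ t0 (pow2_ge_0 x)) Q2 (Rmult_le_compat_l _ _ _ t0 x2).
lra.
Qed.

(** By [cos_decay] the [n]-th coefficient is at most [exp (eps l) / n]. *)
Lemma coef_sum : \sum_(n : 'I_(N' l).+1) coef a q (N' l) (th l) (Q l) n <= exp (2 * eps * l).
Proof.
have [l1 _ _ _ [_ e6 ql _]] := Hl; have [[al0 al1] [q1 qa]] := alpha_range; have [L0 L6] := L_le.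
have lq : 0 <= ln (INR q) by exact: ln_INR_ge0.
have E1 := exp_pos (eps * l).
rewrite big_ord_recl.
have c0 : coef a q (N' l) (th l) (Q l) ord0 <= INR q.
  rewrite /coef -/alpha (_ : INR (nat_of_ord ord0) + alpha = alpha); last by rewrite /=; lra.
  have C1 : cos (th l * freq a q (N' l) ord0) ^ Q l <= 1.
    rewrite -(pow1 (Q l)); apply: pow_incr; split; first by apply: cos_nonneg; exact: freq_range.
    by have [] := COS_bound (th l * freq a q (N' l) ord0).
  have R1 : Rpower alpha (- (1 / 2)) <= INR q.
    apply: (Rle_trans _ (Rpower (/ INR q) (- (1 / 2)))).
      by apply: Rpower_le_base => //; [apply: Rinv_0_lt_compat|]; lra.
    rewrite Rpower_Ropp -Rpower_Ropp /Rpower ln_Rinv; last lra.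
    rewrite -{2}(exp_ln (INR q)); last lra.
    by apply: exp_mono; lra.
  have := exp_pos (- (1 / 2) * ln alpha); rewrite -/(Rpower alpha (- (1 / 2))) => R0.
  have C0 : 0 <= cos (th l * freq a q (N' l) ord0) ^ Q l by apply: pow_le; apply: cos_nonneg; exact: freq_range.
  nra.
have cn (n : 'I_(N' l)) : coef a q (N' l) (th l) (Q l) (lift ord0 n) <= exp (eps * l) * / INR n.+1.
  have n1 := leq_INR 1 n.+1 isT; rewrite [INR 1]/= in n1.
  rewrite /coef /freq -/alpha lift0; set x := ln _.
  have x0 : 0 <= x by rewrite /x -ln_1; apply: ln_le; lra.
  have xL : x <= L.
    apply: ln_le; first lra.
    by have := leq_INR n.+1 (N' l).+1 (leq_trans (ltn_ord n) (leqnSn _)); lra.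
  have cc : 0 <= cos (th l * x) by apply: cos_nonneg; lra.
  have D := cos_decay x (conj x0 xL).
  have -> : Rpower (INR n.+1 + alpha) (- (1 / 2)) = exp (x / 2) * exp (- x).
    by rewrite /Rpower -/x -exp_plus; congr exp; field.
  have QE : Q l = (Q l - 1).+1 by rewrite /Q; lia.
  rewrite {1}QE -tech_pow_Rmult.
  have [_ c1] := COS_bound (th l * x).
  have cp : 0 <= cos (th l * x) ^ (Q l - 1) by exact: pow_le.
  have I1 : exp (- x) <= / INR n.+1.
    rewrite exp_Ropp; apply: Rinv_le_contravar; first lra.
    by rewrite /x exp_ln; lra.
  have -> : exp (x / 2) * exp (- x) * (cos (th l * x) * cos (th l * x) ^ (Q l - 1))
    = (exp (x / 2) * cos (th l * x) ^ (Q l - 1)) * (cos (th l * x) * exp (- x)) by ring.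
  have P0 := Rmult_le_pos _ _ (Rlt_le _ _ (exp_pos (x / 2))) cp.
  have P1 := exp_pos (- x).
  apply: Rmult_le_compat => //; nra.
apply: (Rle_trans _ (INR q + exp (eps * l) * (1 + 6 * l))).
  apply: Rplus_le_compat => //.
  apply: (Rle_trans _ _ _ (sumR_le _ _ _ _ _ (fun n _ => cn n))).
  rewrite sumR_mull; apply: Rmult_le_compat_l; first lra.
  apply: (Rle_trans _ _ _ (sum_inv_le _)); apply: Rplus_le_compat_l.
  apply: Rle_trans L6; apply: ln_le; first exact: (ltn_INR 0 (N' l) isT).
  by have := leq_INR _ _ (leqnSn (N' l)); rewrite /N'; lra.
have -> : exp (2 * eps * l) = exp (eps * l) * exp (eps * l) by rewrite -exp_plus; congr exp; ring.
have E2 : 1 <= exp (eps * l) by have := exp_ineq1_le (eps * l); nra.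
apply: (Rle_trans _ (exp (eps * l) * ((INR q + 7) * l))); last by apply: Rmult_le_compat_l; lra.
have A1 : exp (eps * l) * 1 <= exp (eps * l) * l by apply: Rmult_le_compat_l; lra.
have A2 : INR q * 1 <= INR q * (exp (eps * l) * l) by apply: Rmult_le_compat_l; lra.
lra.
Qed.

Lemma N_big Y : 0 <= Y <= l -> INR q * exp Y <= INR (N' l).+1.
Proof.
move=> [Y0 Yl]; have [l1 _ _ _ [_ _ _ qe]] := Hl; have Ng := N_ge.
have E1 : exp Y <= exp l by apply: exp_mono.
have E2 : exp l * exp l <= exp (5 * l) by rewrite -exp_plus; apply: exp_mono; lra.
have := exp_pos Y; have := pos_INR q; have := Rmult_le_compat _ _ _ _ (pos_INR q) (Rlt_le _ _ (exp_pos Y)) qe E1; lra.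
Qed.

Lemma tail_rate_small : 32 * exp l * tail_rate alpha (N' l).+1 <= 1.
Proof.
have [l1 _ _ e4 _] := Hl; have [[al0 al1] _] := alpha_range; have Ng := N_ge.
have X := exp_pos (5 * l).
have T1 : tail_rate alpha (N' l).+1 <= exp (- (5 / 4 * l)).
  rewrite /tail_rate; apply: (Rle_trans _ (Rpower (exp (5 * l)) (- / 4))).
    by apply: Rpower_le_base; lra.
  by rewrite /Rpower ln_exp; apply: exp_mono; lra.
apply: (Rle_trans _ (exp (l / 4) * exp l * exp (- (5 / 4 * l)))).
  have P1 := exp_pos l; have P2 := tail_rate_pos alpha (N' l).+1.
  apply: Rmult_le_compat => //; [nra | lra | by apply: Rmult_le_compat_r; lra].
by right; rewrite -!exp_plus -exp_0; congr exp; field.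
Qed.

Theorem smoothed_bound zeta X v : is_hurwitz_zeta alpha zeta ->
  (forall u, exp (b * l) <= u <= exp l -> Cmod (zeta ((1 / 2)%R, u)) <= X) ->
  2 * exp (b * l) <= v <= exp l / 2 ->
  sqnorm 'I_(N' l).+1 (coef a q (N' l) (th l) (Q l)) (freq a q (N' l)) v <= (X + 2) ^ 2.
Proof.
move=> hz HX [v1 v2]; have [l1 e2 e3 e4 [e5 _ ql _]] := Hl; have [[al0 al1] [q1 qa]] := alpha_range.
have [L0 L6] := L_le; have qth := Qth; have Q14 := Q1_ge.
have lq : 0 <= ln (INR q) by exact: ln_INR_ge0.
have th0 : 0 <= th l by left; apply: Rinv_0_lt_compat; lra.
have b0 : 0 < b by lra.
have bl : b * l <= l by nra.
have bexp := exp_mono _ _ bl.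
rewrite sqnorm_Cmod; apply: pow_incr; split; first exact: Cmod_ge_0.
have S := short_poly_bound alpha zeta (th l) (Q l) (N' l).+1 v X (exp (eps * l)) al0 hz th0.
have Q0' : (1 <= Q l)%coq_nat by apply/leP.
have N0' : (1 <= (N' l).+1)%coq_nat by apply/leP.
have {}S := S Q0' N0'; rewrite -/L in S; cbv zeta in S.
apply: Rle_trans.
{ apply: S.
  - by move=> x Hx; apply: cos_nonneg; rewrite -/L in Hx; lra.
  - exact: cos_decay.
  - lra.
  - move=> u Hu; apply: HX; lra. }
have T1 : 16 * (v + INR (Q l) * th l + 1) * tail_rate alpha (N' l).+1 <= 1.
  apply: Rle_trans tail_rate_small; apply: Rmult_le_compat_r; first by left; exact: tail_rate_pos.
  lra.
have P1 : (2 * (INR (Q l) * th l) * L * exp (eps * l) + exp (eps * l) + 2) / (v - INR (Q l) * th l) <= 1.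
  have d0 : exp (b * l) <= v - INR (Q l) * th l by lra.
  apply: (Rmult_le_reg_r (v - INR (Q l) * th l)); first by have := exp_pos (b * l); lra.
  rewrite div_mulK; last by have := exp_pos (b * l); lra.
  rewrite Rmult_1_l; apply: Rle_trans d0.
  have E1 : 1 <= exp (eps * l) by have := exp_ineq1_le (eps * l); nra.
  have Q0 : 0 <= INR (Q l) * th l by apply: Rmult_le_pos => //; exact: pos_INR.
  have A1 : (INR (Q l) * th l) * L <= Q1 * (6 * l) by apply: Rmult_le_compat.
  apply: (Rle_trans _ ((12 * Q1 + 3) * l * exp (eps * l))).
    have := Rmult_le_compat_r _ _ _ (Rlt_le _ _ (exp_pos (eps * l))) A1; nra.
  apply: (Rle_trans _ (exp (b / 2 * l) * exp (eps * l))).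
    by apply: Rmult_le_compat_r => //; left; exact: exp_pos.
  rewrite -exp_plus; apply: exp_mono; nra.
lra.
Qed.
End Smooth.

(** * Optimizing the resonator *)

Section Optimization.
Variables (a q N' : nat) (th : R) (Q : nat) (T : finType) (pr : T -> nat) (G eta X0 : R).
Hypothesis aq : (0 < a < q)%N.
Hypothesis pr_prime : forall t, prime (pr t).
Hypothesis pr_inj : injective pr.
Hypothesis pr_q : forall t, (q < pr t)%N.
Hypothesis eta_range : 0 < eta <= 1 / 2.
Hypothesis G0 : 0 < G.
Let lam := ln G.
Hypothesis lam1 : 1 <= lam.
Hypothesis X0P : forall x, X0 <= x -> [/\ 1 <= x, 2 * ln x <= eta * x, 2 / eta <= x & 6 / eta <= exp (x / 2)].
Let x t := ln (INR (pr t) / G).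
Hypothesis xP : forall t, X0 <= x t <= eta * lam.
Let S := \sum_(t : T) / (INR (pr t) * ln (INR (pr t) / G)).
Hypothesis G_big : 10 * lam <= eta ^ 2 * sqrt G.

(* stationary for the gain [g / sqrt p] against the leading part [g^2 * ln (p / G)] of
   the entropy *)
Let g t := sqrt G / (sqrt (INR (pr t)) * x t).
(* equal to [- ln (g t ^ 2)], the cost of an event of probability [g t ^ 2] *)
Let w t := x t + 2 * ln (x t).

Lemma p_gt0 t : 0 < INR (pr t). Proof. exact: (ltn_INR 0 _ (prime_gt0 (pr_prime t))). Qed.

Lemma sqp t : sqrt (INR (pr t)) * sqrt (INR (pr t)) = INR (pr t).
Proof. by apply: sqrt_sqrt; have := p_gt0 t; lra. Qed.
Lemma sqG : sqrt G * sqrt G = G. Proof. by apply: sqrt_sqrt; lra. Qed.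
Lemma sqp_gt0 t : 0 < sqrt (INR (pr t)). Proof. by apply: sqrt_lt_R0; exact: p_gt0. Qed.
Lemma sqG_gt0 : 0 < sqrt G. Proof. exact: sqrt_lt_R0. Qed.

Lemma g_small t : 0 <= g t <= eta / 6.
Proof.
have [x1 x2 x3 x4] := X0P _ (proj1 (xP t)).
have P := p_gt0 t; have s1 := sqp_gt0 t; have s2 := sqG_gt0.
split; first by left; apply: Rdiv_lt_0_compat => //; apply: Rmult_lt_0_compat; lra.
have E1 : exp (x t / 2) = sqrt (INR (pr t)) / sqrt G.
  rewrite -sqrt_div_alt // -(exp_ln (INR (pr t) / G)); last exact: Rdiv_lt_0_compat.
  rewrite -/(x t); apply: Rsqr_inj; [by left; exact: exp_pos | exact: sqrt_pos|].
  rewrite Rsqr_sqrt; last by left; exact: exp_pos.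
  by rewrite /Rsqr -exp_plus; congr exp; field.
have X := exp_pos (x t / 2).
have -> : g t = / exp (x t / 2) * / x t by rewrite /g E1; field; lra.
apply: (Rle_trans _ (/ exp (x t / 2) * 1)).
  apply: Rmult_le_compat_l; first by left; exact: Rinv_0_lt_compat.
  by rewrite -Rinv_1; apply: Rinv_le_contravar; lra.
rewrite Rmult_1_r (_ : eta / 6 = / (6 / eta)); last by field; lra.
by apply: Rinv_le_contravar => //; apply: Rdiv_lt_0_compat; lra.
Qed.

Lemma g_sq t : g t * prime_rsqrt T pr t = sqrt G * / (INR (pr t) * x t).
Proof.
have [x1 _ _ _] := X0P _ (proj1 (xP t)); have s1 := sqp_gt0 t.
rewrite /g /prime_rsqrt -(sqp t); rewrite sqrt_square; last lra.
by field; lra.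
Qed.

Lemma g2 t : g t ^ 2 = G * / (INR (pr t) * x t) * / x t.
Proof.
have [x1 _ _ _] := X0P _ (proj1 (xP t)); have s1 := sqp_gt0 t.
transitivity (sqrt G * sqrt G * / (sqrt (INR (pr t)) * sqrt (INR (pr t)) * x t) * / x t).
  by rewrite /g; field; lra.
by rewrite sqG sqp.
Qed.

Lemma term_pos t : 0 < / (INR (pr t) * x t).
Proof.
have [x1 _ _ _] := X0P _ (proj1 (xP t)); have P := p_gt0 t.
by apply: Rinv_0_lt_compat; apply: Rmult_lt_0_compat; lra.
Qed.

Lemma S_ge0 : 0 <= S.
Proof. by apply: sumR_ge0 => t _; left; exact: term_pos. Qed.

Lemma sum_gs : \sum_(t : T) (g t * prime_rsqrt T pr t) = sqrt G * S.
Proof. by rewrite /S -sumR_mull; apply: eq_bigr => t _; exact: g_sq. Qed.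

Lemma w_range t : 0 <= w t <= (1 + eta) * x t.
Proof.
have [x1 x2 _ _] := X0P _ (proj1 (xP t)).
have : 0 <= ln (x t) by rewrite -ln_1; apply: ln_le; lra.
rewrite /w; lra.
Qed.

Lemma sum_entropy : \sum_(t : T) (2 * g t ^ 2 * w t) <= 2 * (1 + eta) * (G * S).
Proof.
rewrite /S -!sumR_mull; apply: sumR_le => t _.
have [x1 _ _ _] := X0P _ (proj1 (xP t)); have [w0 w1] := w_range t; have P := term_pos t.
rewrite -/(x t) g2.
have -> : 2 * (1 + eta) * (G * / (INR (pr t) * x t)) = 2 * (G * / (INR (pr t) * x t) * / x t) * ((1 + eta) * x t).
  by field; split; [lra | have := p_gt0 t; lra].
apply: Rmult_le_compat_l => //; apply: Rmult_le_pos; first lra.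
apply: Rmult_le_pos; first by apply: Rmult_le_pos; lra.
by left; apply: Rinv_0_lt_compat; lra.
Qed.

Lemma sum_exp_w : \sum_(t : T) exp (- w t) <= eta / 2 * (G * S).
Proof.
rewrite /S -!sumR_mull; apply: sumR_le => t _.
have [x1 _ x3 _] := X0P _ (proj1 (xP t)); have P := term_pos t; have p0 := p_gt0 t.
rewrite -/(x t).
have -> : exp (- w t) = (G * / (INR (pr t) * x t)) * / x t.
  have -> : - w t = - x t + - (ln (x t) + ln (x t)) by rewrite /w; ring.
  rewrite exp_plus !exp_Ropp exp_plus exp_ln; last lra.
  rewrite {1}/x exp_ln; last exact: Rdiv_lt_0_compat.
  by field; lra.
rewrite Rmult_comm; apply: Rmult_le_compat_r; first by apply: Rmult_le_pos; lra.
rewrite (_ : eta / 2 = / (2 / eta)); last by field; lra.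
by apply: Rinv_le_contravar => //; apply: Rdiv_lt_0_compat; lra.
Qed.

Variable kap : R.
(* large enough for the tail of [rankin_close] with exponent [1 / (4 lam)] *)
Let Y := 64 * lam * (sqrt G * S).
Hypothesis NY : INR q * exp Y <= INR N'.+1.
Hypothesis kap0 : 0 <= kap.
Hypothesis kapP : forall l, - ln (INR q) <= l <= Y -> kap <= cos (th * l) ^ Q.
Hypothesis cos0 : forall n : 'I_N'.+1, 0 <= cos (th * freq a q N' n).

(** With [B] slightly above [2 * G * S] both error terms of [resonance_hurwitz] are at
    most 1 each, and three of them are subtracted from the main term. *)
Theorem resonance_prime_family V0 V X2 : (0 < V)%N ->
  (forall v, (V0 <= v < V)%N -> sqnorm 'I_N'.+1 (coef a q N' th Q) (freq a q N') (INR v) <= X2) -> 0 <= X2 ->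
  kap ^ 2 * (/ INR q * exp (4 * (1 - eta) * (sqrt G * S)) - 3)
  <= 4 * (2 * (INR V0 / INR V) * (\sum_(n : 'I_N'.+1) coef a q N' th Q n) ^ 2 * exp ((2 + 10 * eta) * (G * S)) + 8 * X2).
Proof.
move=> V_gt0 HX X20; have [e0 e1] := eta_range.
have S0 := S_ge0; have s2 := sqG_gt0.
have R0 : 0 <= sqrt G * S by apply: Rmult_le_pos; lra.
have GS0 : 0 <= G * S by apply: Rmult_le_pos; lra.
pose B := 2 * (1 + 2 * eta) * (1 + eta) * (G * S) + eta * (G * S).
pose d := eta / lam; pose d' := / (4 * lam).
have d0 : 0 < d by apply: Rdiv_lt_0_compat; lra.
have d0' : 0 < d' by apply: Rinv_0_lt_compat; lra.
have cop t : coprime (pr t) q.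
  rewrite prime_coprime //; apply/negP => /dvdn_leq; case/andP: aq => h1 h2.
  by move=> /(_ (leq_trans h1 (ltnW h2))); rewrite leqNgt pr_q.
have K := resonance_hurwitz a q N' th Q T pr g w pr_prime pr_inj cop aq (fun t => proj1 (g_small t)) _ (fun t => proj1 (w_range t))
  B Y kap eta d d' NY kap0 kapP cos0 V0 V X2 V_gt0 HX X20.
have g1 t : g t <= 1 by have := g_small t; lra.
have sm t : 2 * g t ^ 2 + 4 * (g t * prime_rsqrt T pr t) <= eta.
  have [h1 h2] := g_small t; have [s0 s1] := prime_rsqrt_range T pr pr_prime t.
  have : g t ^ 2 <= g t by nra.
  have : g t * prime_rsqrt T pr t <= g t by nra.
  lra.
have dw t : d * w t <= eta.
  have [w0 w1] := w_range t; have [_ x2] := xP t.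
  have A1 : (1 + eta) * x t <= (1 + eta) * (eta * lam) by apply: Rmult_le_compat_l; lra.
  have A2 : (1 + eta) * eta * lam <= 1 * lam by apply: Rmult_le_compat_r; [lra | nra].
  have W : w t <= lam by lra.
  have := Rmult_le_compat_l _ _ _ (Rlt_le _ _ d0) W.
  by rewrite {2}/d div_mulK; lra.
have dp t : d' * ln (INR (pr t)) <= 1 / 2.
  have [_ x2] := xP t; have P := p_gt0 t.
  have E : ln (INR (pr t)) = lam + x t by rewrite /x ln_div //; rewrite /lam; lra.
  have W : ln (INR (pr t)) <= 2 * lam by rewrite E; have A1 : eta * lam <= 1 * lam; [apply: Rmult_le_compat_r | ]; lra.
  have := Rmult_le_compat_l _ _ _ (Rlt_le _ _ d0') W.
  by rewrite (_ : d' * (2 * lam) = 1 / 2) //; rewrite /d'; field; lra.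
have {}K := K g1 (conj (Rlt_le _ _ e0) e1) sm (Rlt_le _ _ d0) dw (Rlt_le _ _ d0') dp.
rewrite sum_gs in K.
have U1 : exp (d * (1 + 2 * eta) * \sum_(t : T) (2 * g t ^ 2 * w t) + 10 * (sqrt G * S) - d * B) <= 1.
  rewrite -[X in _ <= X]exp_0; apply: exp_mono.
  have D1 : 0 <= d * (1 + 2 * eta) by apply: Rmult_le_pos; lra.
  have W := Rmult_le_compat_l _ _ _ D1 sum_entropy.
  have -> : d * B = d * (1 + 2 * eta) * (2 * (1 + eta) * (G * S)) + eta * d * (sqrt G * sqrt G) * S.
    by rewrite /B sqG; ring.
  suff : 10 * (sqrt G * S) <= eta * d * (sqrt G * sqrt G) * S by lra.
  have -> : eta * d * (sqrt G * sqrt G) * S = (eta ^ 2 * sqrt G / lam) * (sqrt G * S) by rewrite /d; field; lra.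
  apply: Rmult_le_compat_r => //; apply: (Rmult_le_reg_r lam); first lra.
  by rewrite div_mulK; lra.
have U2 : exp (16 * (sqrt G * S) - d' * Y) <= 1.
  rewrite -[X in _ <= X]exp_0; apply: exp_mono; rewrite /d' /Y; right; field; lra.
have U3 : exp (B + 2 * \sum_(t : T) exp (- w t)) <= exp ((2 + 10 * eta) * (G * S)).
  apply: exp_mono; have W := sum_exp_w; rewrite /B.
  suff : (2 * (1 + 2 * eta) * (1 + eta) + eta + eta) * (G * S) <= (2 + 10 * eta) * (G * S) by lra.
  apply: Rmult_le_compat_r => //; nra.
have kap2 := pow2_ge_0 kap.
apply: (Rle_trans _ _ _ (Rle_trans _ _ _ _ K)).
- by apply: Rmult_le_compat_l => //; lra.
- apply: Rmult_le_compat_l; first lra; apply: Rplus_le_compat_r; apply: Rmult_le_compat_l => //.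
  apply: Rmult_le_pos; last exact: pow2_ge_0.
  apply: Rmult_le_pos; first lra; apply: Rdiv_le_0_compat; first exact: pos_INR.
  exact: (ltn_INR 0 V V_gt0).
Qed.
End Optimization.

(** The exponent [sqrt (log T log_3 T / log_2 T)]. *)
Definition Psi (z : R) : R := sqrt (exp z * ln z / z).

Lemma X0_exists eta : 0 < eta <= 1 / 2 -> exists X0, forall x, X0 <= x ->
  [/\ 1 <= x, 2 * ln x <= eta * x, 2 / eta <= x & 6 / eta <= exp (x / 2)].
Proof.
move=> [e0 _].
have H1 := ln_le_lin (eta / 2) ltac:(lra) 0.
have H2 := for_large_exp (/ 2) ltac:(lra) (6 / eta).
have [Z HZ] := for_large_and _ _ (for_large_and _ _ (for_large_ge 1) (for_large_ge (2 / eta))) (for_large_and _ _ H1 H2).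
exists Z => x /HZ[[h1 h2] [h3 h4]]; split=> //; first lra.
by rewrite (_ : x / 2 = / 2 * x); [exact: h4 | field].
Qed.

Lemma eta_bounds e : 0 < e <= 1 / 2 ->
  (1 + e) ^ 2 <= 3 /\ (1 - 5 * e) * (1 + e) ^ 2 <= (1 - e) ^ 3 /\ (2 + 10 * e) * (1 + e) ^ 2 <= 2 + 62 * e.
Proof. by move=> [? ?]; split; [nra | split; nra]. Qed.

Lemma square_bounds x : 1 <= x -> 1 <= x ^ 2 /\ (x + 2) ^ 2 <= 9 * x ^ 2.
Proof. by move=> ?; split; nra. Qed.

Lemma mul_ge1 x y : 1 <= x -> 1 <= y -> 1 <= x * y.
Proof. by move=> ? ?; nra. Qed.

Lemma exp_ge1 x : 0 <= x -> 1 <= exp x.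
Proof. by move=> ?; have := exp_ineq1_le x; lra. Qed.

Section Final.
Variables (a q : nat) (b c : R) (zeta : C -> C).
Hypothesis aq : (0 < a < q)%N.
Hypothesis b_range : 0 < b <= 1.
Hypothesis c_pos : 0 < c.
Hypothesis cb : c ^ 2 / 2 < 1 - b.
Hypothesis hz : is_hurwitz_zeta (INR a / INR q) zeta.

(** The parameter [g0] is chosen with [c^2 / 4 < g0] and [2 * g0 < 1 - b].  The first makes
    the gain [exp (4 sqrt g0 * Psi)] exceed [X^2 = exp (2 c Psi)], the second keeps the
    support of the resonator below [T^(1 - b)]; [eta] and [eps] absorb the losses. *)
Theorem large_value : for_large (fun z => exists2 u, exp (b * exp z) <= u <= exp (exp z) &
   exp (c * Psi z) <= Cmod (zeta ((1 / 2)%R, u))).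
Proof.
have [b0 b1] := b_range.
pose g0 := (c ^ 2 / 4 + (1 - b) / 2) / 2.
have c2 : 0 < c ^ 2 by apply: pow_lt.
have g00 : 0 < g0 by rewrite /g0; lra.
have gap2 : 0 < 1 - b - 2 * g0 by rewrite /g0; lra.
have sg0 : 0 < sqrt g0 by exact: sqrt_lt_R0.
have gap1 : 0 < 4 * sqrt g0 - 2 * c.
  have : c / 2 < sqrt g0; last lra.
  rewrite -(sqrt_square (c / 2)); last lra.
  by apply: sqrt_lt_1; [nra | lra | rewrite /g0; lra].
pose eta := Rmin (1 / 2) (Rmin ((4 * sqrt g0 - 2 * c) / (20 * sqrt g0 + 3)) ((1 - b - 2 * g0) / (124 * g0))).
have Heta : 0 < eta <= 1 / 2.
  split; last exact: Rmin_l.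
  by repeat apply: Rmin_glb_lt; try (apply: Rdiv_lt_0_compat); lra.
have eta1 : 2 * c + 3 * eta <= 4 * sqrt g0 * (1 - 5 * eta).
  have H1 : eta <= (4 * sqrt g0 - 2 * c) / (20 * sqrt g0 + 3).
    apply: Rle_trans (Rmin_r _ _) _; exact: Rmin_l.
  have := Rmult_le_compat_r (20 * sqrt g0 + 3) _ _ ltac:(lra) H1.
  rewrite div_mulK; lra.
have eta2 : 124 * eta * g0 <= 1 - b - 2 * g0.
  have H1 : eta <= (1 - b - 2 * g0) / (124 * g0).
    apply: Rle_trans (Rmin_r _ _) _; exact: Rmin_r.
  have := Rmult_le_compat_r (124 * g0) _ _ ltac:(lra) H1.
  rewrite div_mulK; lra.
pose eps := Rmin ((1 - b - 2 * g0) / 10) (b / 2).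
have Heps : 0 < eps <= b / 2 by split; [apply: Rmin_glb_lt; lra | exact: Rmin_r].
have eps1 : 10 * eps <= 1 - b - 2 * g0 by have := Rmin_l ((1 - b - 2 * g0) / 10) (b / 2); rewrite -/eps; lra.
have [e0 e1] := Heta; have [ep0 ep1] := Heps.
have [X0 X0P] := X0_exists eta Heta.
pose Q1 := 7 / eps; pose K := 384 * sqrt g0 + ln (INR q).
have pf := prime_family eta g0 X0 q Heta g00.
have expinf : forall C, for_large (fun z => C <= exp z).
  move=> C; apply: for_large_imp (for_large_exp 1 Rlt_0_1 C) => z; by rewrite Rmult_1_l.
have lg := for_large_comp _ exp expinf (large_ev q b eps Heps).
have l24 := for_large_comp _ exp expinf (for_large_exp eps ep0 24).
have f1 := for_large_pow_exp 1 (20 / (eta ^ 2 * sqrt g0)) (/ 2) ltac:(lra).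
have f2 := for_large_pow_exp 1 (384 * sqrt g0) (/ 2) ltac:(lra).
have f3 := for_large_pow_exp 2 (2 * Q1 * K ^ 2 / eta) (/ 4) ltac:(lra).
have f4 := for_large_pow_exp 1 1 (/ 2) ltac:(lra).
have f5 := for_large_exp (/ 4) ltac:(lra) (ln (300 * INR q) / (2 * eta)).
apply: for_large_imp (for_large_and _ _ pf (for_large_and _ _ (for_large_and _ _ lg l24) (for_large_and _ _ (for_large_and _ _ f1 f2) (for_large_and _ _ f3 (for_large_and _ _ f4 f5))))).
move=> z [] /= [[z1 u1 lamz Gge G0] [T [pr [pr_inj pr_prime pr_q xP [SL SU]]]]].
move=> [[{}lg {}l24] [[{}f1 {}f2] [{}f3 [{}f4 {}f5]]]].
have [z1' ez0] : 0 < z /\ 0 < exp z by split; [lra | exact: exp_pos].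
set u := ln z in u1 SL SU; set G := res_scale g0 z in G0 Gge lamz xP SL SU.
set S := \sum_(t : T) _ in SL SU.
have P2 : Psi z ^ 2 = exp z * (u / z).
  rewrite /Psi -/u -Rsqr_pow2 Rsqr_sqrt; first by rewrite /Rdiv Rmult_assoc.
  by apply: Rdiv_le_0_compat => //; apply: Rmult_le_pos; lra.
have uz : u <= z by exact: ln_le_self.
have uz1 : u / z <= 1 by apply: (Rmult_le_reg_r z) => //; rewrite div_mulK; lra.
have uz0 : 0 < u / z by apply: Rdiv_lt_0_compat; lra.
have Psi0 : 0 <= Psi z by exact: sqrt_pos.
have PsiU : Psi z <= exp (/ 2 * z).
  apply: Rsqr_incr_0_var; last by left; exact: exp_pos.
  rewrite Rsqr_pow2 P2 /Rsqr -exp_plus (_ : / 2 * z + / 2 * z = z); last lra.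
  by rewrite -[X in _ <= X]Rmult_1_r; apply: Rmult_le_compat_l; lra.
rewrite !Rmult_1_r in f1 f2 f4; rewrite Rmult_1_l in f4.
have PsiL : exp (/ 4 * z) <= Psi z.
  apply: Rsqr_incr_0_var => //.
  rewrite [X in _ <= X]Rsqr_pow2 P2 /Rsqr -exp_plus (_ : / 4 * z + / 4 * z = / 2 * z); last lra.
  have X2 := exp_pos (/ 2 * z).
  have zi : / exp (/ 2 * z) <= / z by apply: Rinv_le_contravar.
  have uzi : / z <= u / z by rewrite -[X in X <= _]Rmult_1_l; apply: Rmult_le_compat_r; [left; exact: Rinv_0_lt_compat | lra].
  apply: (Rle_trans _ (exp z * / exp (/ 2 * z))); last by apply: Rmult_le_compat_l; lra.
  by right; rewrite -exp_Ropp -exp_plus; congr exp; lra.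
have e4 : 1 <= exp (/ 4 * z) by have := exp_ineq1_le (/ 4 * z); lra.
have GP : sqrt G * (u / z) = sqrt g0 * Psi z.
  apply: Rsqr_inj; [by apply: Rmult_le_pos; [exact: sqrt_pos | lra] | by apply: Rmult_le_pos; lra |].
  rewrite !Rsqr_mult !Rsqr_sqrt; [ | by rewrite -/u; apply: Rdiv_le_0_compat => //; apply: Rmult_le_pos; lra | lra | lra].
  rewrite -/u /G /res_scale -/u /Rsqr; field; lra.
have sG0 : 0 < sqrt G by exact: sqrt_lt_R0.
have RU : sqrt G * S <= 3 * sqrt g0 * Psi z.
  apply: (Rle_trans _ (sqrt G * ((1 + eta) ^ 2 * (u / z)))); first by apply: Rmult_le_compat_l; lra.
  have -> : sqrt G * ((1 + eta) ^ 2 * (u / z)) = (1 + eta) ^ 2 * (sqrt g0 * Psi z) by rewrite -GP; ring.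
  rewrite Rmult_assoc; apply: Rmult_le_compat_r; [by apply: Rmult_le_pos; lra | exact: (proj1 (eta_bounds eta Heta))].
have RL : (2 * c + 3 * eta) * Psi z <= 4 * (1 - eta) * (sqrt G * S).
  have A1 : sqrt G * ((1 - eta) ^ 2 / (1 + eta) ^ 2 * (u / z)) <= sqrt G * S by apply: Rmult_le_compat_l; [lra | exact: SL].
  have E1 : sqrt G * ((1 - eta) ^ 2 / (1 + eta) ^ 2 * (u / z)) = (1 - eta) ^ 2 / (1 + eta) ^ 2 * (sqrt g0 * Psi z).
    by rewrite -GP; ring.
  have A2 : 4 * (1 - eta) * ((1 - eta) ^ 2 / (1 + eta) ^ 2 * (sqrt g0 * Psi z)) <= 4 * (1 - eta) * (sqrt G * S).
    by rewrite -E1; apply: Rmult_le_compat_l; lra.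
  apply: Rle_trans A2.
  have -> : 4 * (1 - eta) * ((1 - eta) ^ 2 / (1 + eta) ^ 2 * (sqrt g0 * Psi z)) =
     4 * sqrt g0 * ((1 - eta) ^ 3 / (1 + eta) ^ 2) * Psi z by field; lra.
  apply: Rmult_le_compat_r => //; apply: (Rle_trans _ _ _ eta1); apply: Rmult_le_compat_l; first lra.
  apply: (Rmult_le_reg_r ((1 + eta) ^ 2)); first by apply: pow_lt; lra.
  rewrite div_mulK; last by have := pow_lt (1 + eta) 2; lra.
  by have [_ []] := eta_bounds eta Heta.
have GSU : G * S <= (1 + eta) ^ 2 * (g0 * exp z).
  apply: (Rle_trans _ (G * ((1 + eta) ^ 2 * (u / z)))); first by apply: Rmult_le_compat_l; lra.
  by right; rewrite /G /res_scale -/u; field; lra.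
have R0 : 0 <= sqrt G * S.
  apply: Rmult_le_pos; first lra; apply: Rle_trans SL.
  by apply: Rmult_le_pos; [apply: Rdiv_le_0_compat; [exact: pow2_ge_0 | have := pow_lt (1 + eta) 2; lra] | lra].
pose l := exp z; pose Y := 64 * ln G * (sqrt G * S).
have q1 : 1 < INR q by have [_ []] := alpha_range a q b eps aq Heps b1.
have lq0 : 0 <= ln (INR q) by exact: ln_INR_ge0.
have lamU : ln G <= 2 * z by have := Rmult_le_compat_r z (1 + eta) 2 ltac:(lra) ltac:(lra); lra.
have Y0 : 0 <= Y by apply: Rmult_le_pos => //; lra.
have YU : Y <= 384 * sqrt g0 * z * Psi z.
  have A1 := Rmult_le_compat _ _ _ _ (_ : 0 <= ln G) R0 lamU RU.
  rewrite /Y; have := A1 ltac:(lra); lra.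
have Yl : Y <= l.
  apply: (Rle_trans _ _ _ YU).
  have -> : l = exp (/ 2 * z) * exp (/ 2 * z) by rewrite /l -exp_plus; congr exp; lra.
  apply: Rmult_le_compat => //; by apply: Rmult_le_pos; lra.
have l1 : 1 <= l by case: lg.
pose kap := exp (- (Q1 / l * (Y + ln (INR q)) ^ 2)).
have Q10 : 0 < Q1 by apply: Rdiv_lt_0_compat; lra.
have kexp : 2 * (Q1 / l * (Y + ln (INR q)) ^ 2) <= eta * Psi z.
  have YK : Y + ln (INR q) <= K * z * Psi z.
    have zP : 1 <= z * Psi z by apply: mul_ge1; lra.
    have := Rmult_le_compat_l _ _ _ lq0 zP; rewrite /K; lra.
  have YK2 : (Y + ln (INR q)) ^ 2 <= (K * z * Psi z) ^ 2 by apply: pow_incr; lra.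
  apply: (Rle_trans _ (2 * (Q1 / l * (K * z * Psi z) ^ 2))).
    apply: Rmult_le_compat_l; first lra; apply: Rmult_le_compat_l => //.
    by apply: Rdiv_le_0_compat; lra.
  have -> : 2 * (Q1 / l * (K * z * Psi z) ^ 2) = (2 * Q1 * K ^ 2 / eta * z ^ 2) * (eta * (u / z)).
    by rewrite Rpow_mult_distr P2 /l; field; lra.
  have F0 : 0 <= 2 * Q1 * K ^ 2 / eta * z ^ 2.
    apply: Rmult_le_pos; last exact: pow2_ge_0.
    by apply: Rdiv_le_0_compat => //; apply: Rmult_le_pos; [lra | exact: pow2_ge_0].
  apply: (Rle_trans _ (2 * Q1 * K ^ 2 / eta * z ^ 2 * eta)).
    by apply: Rmult_le_compat_l => //; have := Rmult_le_compat_l eta _ _ (Rlt_le _ _ e0) uz1; lra.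
  rewrite Rmult_comm; apply: Rmult_le_compat_l; lra.
have kap1 : exp (- (eta * Psi z)) <= kap ^ 2 <= 1.
  have -> : kap ^ 2 = exp (- (2 * (Q1 / l * (Y + ln (INR q)) ^ 2))).
    by rewrite /kap exp_pow; congr exp; rewrite /=; ring.
  split; first by apply: exp_mono; lra.
  rewrite -exp_0; apply: exp_mono.
  have : 0 <= Q1 / l * (Y + ln (INR q)) ^ 2; last lra.
  by apply: Rmult_le_pos; [apply: Rdiv_le_0_compat; lra | exact: pow2_ge_0].
apply: NNPP => none.
have small v : exp (b * l) <= v <= exp l -> Cmod (zeta ((1 / 2)%R, v)) <= exp (c * Psi z).
  by move=> Hv; apply: Rnot_lt_le => lt; apply: none; exists v => //; lra.
pose X := exp (c * Psi z).
have X1 : 1 <= X by apply: exp_ge1; apply: Rmult_le_pos; lra.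
pose V := nat_floor (exp l / 2); pose V0 := (nat_floor (2 * exp (b * l))).+1.
have el := exp_pos l; have ebl := exp_pos (b * l).
have el5 : 5 <= exp l by case: lg.
have [V1 V2] := nat_floorP (exp l / 2) ltac:(lra); rewrite -/V in V1 V2.
have [W1 W2] := nat_floorP (2 * exp (b * l)) ltac:(lra).
have VV : exp l / 4 <= INR V by lra.
have Vn : (0 < V)%N by rewrite lt0n; apply/eqP => V00; rewrite V00 /= in VV; lra.
have YY := conj Y0 Yl.
have sG : sqrt g0 * exp (/ 2 * z) <= sqrt G.
  have <- : sqrt (exp z) = exp (/ 2 * z).
    rewrite -(sqrt_square (exp (/ 2 * z))); last by left; exact: exp_pos.
    by rewrite -exp_plus; congr (sqrt (exp _)); lra.
  by rewrite -sqrt_mult_alt; [exact: sqrt_le_1_alt | lra].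
have lam1 : 1 <= ln G by lra.
have Gbig : 10 * ln G <= eta ^ 2 * sqrt G.
  have et2 : 0 < eta ^ 2 by apply: pow_lt.
  have E1 : 20 / (eta * eta * sqrt g0) * z * (eta ^ 2 * sqrt g0) = 20 * z by field; lra.
  have A1 := Rmult_le_compat_r (eta ^ 2 * sqrt g0) _ _ (Rlt_le _ _ (Rmult_lt_0_compat _ _ et2 sg0)) f1.
  have A2 := Rmult_le_compat_l (eta ^ 2) _ _ (Rlt_le _ _ et2) sG.
  rewrite E1 in A1.
  lra.
have D := resonance_prime_family a q (nat_floor (exp (5 * l))).+1 (/ (6 * l)) (nat_floor (Q1 * l)).+2 T pr G eta X0 aq pr_prime pr_inj pr_q Heta G0
  lam1 X0P xP Gbig kap (N_big q b eps Heps b1 l lg Y YY) (Rlt_le _ _ (exp_pos _)) (kappa q b eps Heps b1 l lg Y YY)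
  (fun n => cos_nonneg q b eps Heps b1 l lg _ (freq_range a q b eps aq Heps b1 l lg n)) V0 V ((X + 2) ^ 2) Vn.
have HX v : (V0 <= v < V)%N -> sqnorm 'I_(nat_floor (exp (5 * l))).+2 (coef a q (nat_floor (exp (5 * l))).+1 (/ (6 * l)) (nat_floor (Q1 * l)).+2)
   (freq a q (nat_floor (exp (5 * l))).+1) (INR v) <= (X + 2) ^ 2.
  case/andP => h1 h2; apply: (smoothed_bound a q b eps aq Heps b1 l lg zeta X (INR v) hz small).
  have := leq_INR _ _ h1; have := ltn_INR _ _ h2; rewrite /V0 S_INR; lra.
have {}D := D HX (pow2_ge_0 _).
set SC := \sum_(n < _) _ in D.
have SC2 : SC ^ 2 <= exp (4 * eps * l).
  have -> : exp (4 * eps * l) = exp (2 * eps * l) ^ 2 by rewrite exp_pow; congr exp; rewrite /=; ring.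
  apply: pow_incr; split; last exact: (coef_sum a q b eps aq Heps b1 l lg).
  apply: sumR_ge0 => n _; apply: Rmult_le_pos; first by left; exact: exp_pos.
  by apply: pow_le; exact: (cos_nonneg q b eps Heps b1 l lg _ (freq_range a q b eps aq Heps b1 l lg n)).
have VR : INR V0 / INR V <= 12 * exp ((b - 1) * l).
  apply: (Rmult_le_reg_r (INR V)); first lra.
  rewrite div_mulK; last lra.
  apply: (Rle_trans _ (12 * exp ((b - 1) * l) * (exp l / 4))).
    have -> : 12 * exp ((b - 1) * l) * (exp l / 4) = 3 * exp (b * l).
      have -> : exp (b * l) = exp ((b - 1) * l) * exp l by rewrite -exp_plus; congr exp; ring.
      by field.
    have : 1 <= exp (b * l) by apply: exp_ge1; apply: Rmult_le_pos; lra.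
    rewrite /V0 S_INR; lra.
  by apply: Rmult_le_compat_l => //; have := exp_pos ((b - 1) * l); lra.
have GS0 : 0 <= G * S.
  have -> : G * S = sqrt G * (sqrt G * S) by rewrite -{1}(sqrt_sqrt G); [ring | lra].
  by apply: Rmult_le_pos; lra.
have EG : exp ((2 + 10 * eta) * (G * S)) <= exp ((2 + 62 * eta) * g0 * l).
  apply: exp_mono; apply: (Rle_trans _ ((2 + 10 * eta) * ((1 + eta) ^ 2 * (g0 * l)))).
    by apply: Rmult_le_compat_l => //; lra.
  have g0l : 0 <= g0 * l by apply: Rmult_le_pos; lra.
  have -> : (2 + 10 * eta) * ((1 + eta) ^ 2 * (g0 * l)) = (2 + 10 * eta) * (1 + eta) ^ 2 * (g0 * l) by ring.
  rewrite [X in _ <= X]Rmult_assoc; apply: Rmult_le_compat_r => //; exact: (proj2 (proj2 (eta_bounds eta Heta))).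
have main1 : 2 * (INR V0 / INR V) * SC ^ 2 * exp ((2 + 10 * eta) * (G * S)) <= 1.
  have VR0 : 0 <= INR V0 / INR V by apply: Rdiv_le_0_compat; [exact: pos_INR | lra].
  apply: (Rle_trans _ (24 * exp ((b - 1) * l) * exp (4 * eps * l) * exp ((2 + 62 * eta) * g0 * l))).
    have p1 := exp_pos ((2 + 10 * eta) * (G * S)).
    apply: Rmult_le_compat => //; [|lra|].
      by apply: Rmult_le_pos; [lra | exact: pow2_ge_0].
    by apply: Rmult_le_compat => //; [lra | exact: pow2_ge_0 | lra].
  have -> : 24 * exp ((b - 1) * l) * exp (4 * eps * l) * exp ((2 + 62 * eta) * g0 * l) =
     24 * exp ((b - 1 + 4 * eps + (2 + 62 * eta) * g0) * l).
    transitivity (24 * (exp ((b - 1) * l) * exp (4 * eps * l) * exp ((2 + 62 * eta) * g0 * l))); first by ring.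
    by rewrite -!exp_plus; congr (Rmult _ (exp _)); ring.
  apply: (Rle_trans _ (24 * exp (- (eps * l)))).
    apply: Rmult_le_compat_l; first lra; apply: exp_mono.
    have : (b - 1 + 4 * eps + (2 + 62 * eta) * g0) * l <= - eps * l; last lra.
    apply: Rmult_le_compat_r; lra.
  rewrite exp_Ropp; apply: (Rmult_le_reg_r (exp (eps * l))); first exact: exp_pos.
  by rewrite (_ : 24 * / exp (eps * l) * exp (eps * l) = 24); [rewrite /l; lra | field; have := exp_pos (eps * l); lra].
have D2 : kap ^ 2 * (/ INR q * exp (4 * (1 - eta) * (sqrt G * S)) - 3) <= 292 * X ^ 2.
  have : (X + 2) ^ 2 <= 9 * X ^ 2 by have [] := square_bounds X X1.
  have : 1 <= X ^ 2 by have [] := square_bounds X X1.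
  rewrite -/S in D; lra.
have qi : 0 < / INR q by apply: Rinv_0_lt_compat; lra.
have D3 : exp ((2 * c + 2 * eta) * Psi z) <= 295 * INR q * X ^ 2.
  have A1 : exp ((2 * c + 3 * eta) * Psi z) <= exp (4 * (1 - eta) * (sqrt G * S)) by exact: exp_mono.
  have E1 : exp ((2 * c + 2 * eta) * Psi z) = exp (- (eta * Psi z)) * exp ((2 * c + 3 * eta) * Psi z).
    by rewrite -exp_plus; congr exp; ring.
  have A2 : exp ((2 * c + 2 * eta) * Psi z) <= kap ^ 2 * exp (4 * (1 - eta) * (sqrt G * S)).
    by rewrite E1; apply: Rmult_le_compat => //; [left; exact: exp_pos | left; exact: exp_pos | lra].
  have A3 : / INR q * (kap ^ 2 * exp (4 * (1 - eta) * (sqrt G * S))) <= 295 * X ^ 2.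
    have : 1 <= X ^ 2 by have [] := square_bounds X X1.
    lra.
  apply: (Rmult_le_reg_l (/ INR q)) => //.
  have -> : / INR q * (295 * INR q * X ^ 2) = 295 * X ^ 2 by field; lra.
  by apply: Rle_trans A3; apply: Rmult_le_compat_l; lra.
have D4 : exp (2 * eta * Psi z) <= 295 * INR q.
  have X2 : X ^ 2 = exp (2 * c * Psi z) by rewrite /X exp_pow; congr exp; rewrite /=; ring.
  apply: (Rmult_le_reg_r (X ^ 2)); first by apply: pow_lt; lra.
  rewrite {1}X2 -exp_plus (_ : 2 * eta * Psi z + 2 * c * Psi z = (2 * c + 2 * eta) * Psi z); [exact: D3 | ring].
have D5 : 300 * INR q <= exp (2 * eta * Psi z).
  rewrite -[X in X <= _]exp_ln; last lra.
  apply: exp_mono.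
  have A1 := Rle_trans _ _ _ f5 PsiL.
  have := Rmult_le_compat_l (2 * eta) _ _ ltac:(lra) A1.
  rewrite (_ : 2 * eta * (ln (300 * INR q) / (2 * eta)) = ln (300 * INR q)); [lra | field; lra].
lra.
Qed.
End Final.

(** * The maximum over the interval *)

Lemma max_exists alpha zeta : is_hurwitz_zeta alpha zeta -> forall x y, 0 <= x <= y -> forall r, r <> 1 ->
  exists M, is_max_on (fun t : R => Cmod (zeta (r, t))) x y M.
Proof.
move=> hz x y [x0 xy] r r1.
have C t : x <= t <= y -> continuity_pt (fun t : R => Cmod (zeta (r, t))) t.
  move=> Ht; apply: cmod_continuity; apply: (pathcont_ver zeta r x y _ t Ht) => u _.
  apply: cdiff_ccont; apply: (zeta_cdiff alpha zeta hz) => E; apply: r1; exact: (f_equal fst E).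
have [t [H1 H2]] := continuity_ab_maj _ x y xy C.
by exists (Cmod (zeta (r, t))); split; [exists t | exact: H1].
Qed.

Theorem theorem1p1
  (a q : Z) (ha : (0 < a < q)%Z) (haq : Z.gcd a q = 1%Z)
  (beta : R) (hbeta : (0 <= beta < 1)%R)
  (c : R) (hc : (0 < c)%R) (hc' : (c < sqrt (2 * (1 - beta)))%R)
  (zeta : C -> C) (hzeta : is_hurwitz_zeta (IZR a / IZR q) zeta) :
  exists T0 : R, forall T : R, (T0 <= T)%R ->
    exists M : R,
      is_max_on (fun t : R => Cmod (zeta ((1 / 2)%R, t))) (Rpower T beta) T M /\
      (exp (c * sqrt (ln T * log3 T / log2 T)) <= M)%R.
Proof.
have c2 : c ^ 2 / 2 < 1 - beta.
  have : c ^ 2 < 2 * (1 - beta); last lra.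
  have S := sqrt_sqrt (2 * (1 - beta)) ltac:(lra).
  have := Rmult_le_0_lt_compat c _ c _ (Rlt_le _ _ hc) (Rlt_le _ _ hc) hc' hc'.
  rewrite S; lra.
pose b := (beta + (1 - c ^ 2 / 2)) / 2.
have c2p : 0 < c ^ 2 by apply: pow_lt.
have b01 : 0 < b <= 1 by rewrite /b; lra.
have cb : c ^ 2 / 2 < 1 - b by rewrite /b; lra.
have natZ k : (0 < k)%Z -> INR (Z.to_nat k) = IZR k.
  by move=> k0; rewrite INR_IZR_INZ Z2Nat.id //; lia.
have aq : (0 < Z.to_nat a < Z.to_nat q)%N by apply/andP; split; apply/ltP; lia.
have hz : is_hurwitz_zeta (INR (Z.to_nat a) / INR (Z.to_nat q)) zeta by rewrite !natZ //; lia.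
have [Z0 HZ] := large_value _ _ b c zeta aq b01 hc cb hz.
exists (exp (exp (Rmax 0 Z0))) => T HT.
have m0 := Rmax_l 0 Z0; have m1 := Rmax_r 0 Z0.
have T0 : 0 < T by have := exp_pos (exp (Rmax 0 Z0)); lra.
have lT : exp (Rmax 0 Z0) <= ln T by rewrite -[X in X <= _]ln_exp; apply: ln_le => //; exact: exp_pos.
have lT1 : 1 <= ln T by have := exp_ineq1_le (Rmax 0 Z0); lra.
have z0 : Rmax 0 Z0 <= ln (ln T) by rewrite -[X in X <= _]ln_exp; apply: ln_le => //; exact: exp_pos.
have [u [u1 u2] big] := HZ (ln (ln T)) ltac:(lra).
have EL : exp (ln (ln T)) = ln T by rewrite exp_ln; lra.
rewrite EL in u1 u2; rewrite exp_ln // in u2.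
have lo : Rpower T beta <= exp (b * ln T).
  by apply: exp_mono; apply: Rmult_le_compat_r; [lra | rewrite /b; lra].
have R0 := exp_pos (beta * ln T).
have [M HM] := max_exists _ zeta hz (Rpower T beta) T ltac:(rewrite /Rpower in lo *; lra) (1 / 2) ltac:(lra).
exists M; split => //; rewrite /log3 /log2.
have -> : sqrt (ln T * ln (ln (ln T)) / ln (ln T)) = Psi (ln (ln T)) by rewrite /Psi exp_ln //; lra.
by apply: Rle_trans big _; apply: (proj2 HM); lra.
Qed.
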